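(* Let $M\ge1$ and let $\ell,m\ge0$ be integers, not both zero, with $\ell+2m\le 2M$. For $\mathbf x\in\mathbb R^\ell$ and $\mathbf z\in(\mathbb C\setminus\mathbb R)^m$, the $(\ell,m)$-correlation function of the real Ginibre ensemble of $2M\times2M$ matrices is $$R_{\ell,m}(\mathbf x,\mathbf z)=\operatorname{Pf}\begin{bmatrix}\widetilde K_{2M}(x_j,x_{j'})&\widetilde K_{2M}(x_j,z_{k'})\\\widetilde K_{2M}(z_k,x_{j'})&\widetilde K_{2M}(z_k,z_{k'})\end{bmatrix},\quad j,j'=1,\dots,\ell;\ k,k'=1,\dots,m,$$ (a block matrix with $2\times2$ blocks), where $$\widetilde K_{2M}(\gamma,\gamma')=\begin{bmatrix}\widetilde{DS}_{2M}(\gamma,\gamma')&\widetilde S_{2M}(\gamma,\gamma')\\-\widetilde S_{2M}(\gamma',\gamma)&\widetilde{IS}_{2M}(\gamma,\gamma')+\mathcal E(\gamma,\gamma')\end{bmatrix}$$ is given, for $x,x'\in\mathbb R$ and $z,z'\in\mathbb C\setminus\mathbb R$, as follows. (1) Real/real: $$\widetilde S_{2M}(x,x')=\frac{e^{-\frac12(x-x')^2}}{\sqrt{2\pi}}e^{-xx'}e_M(xx')+r_M(x,x'),\qquad \widetilde{DS}_{2M}(x,x')=\frac{e^{-\frac12(x-x')^2}}{\sqrt{2\pi}}(x'-x)e^{-xx'}e_M(xx'),$$ $$\widetilde{IS}_{2M}(x,x')=\frac{e^{-x^2/2}}{2\sqrt\pi}\operatorname{sgn}(x')\int_0^{x'^2/2}\frac{e^{-t}}{\sqrt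 t}c_M(x\sqrt{2t})\,dt-\frac{e^{-x'^2/2}}{2\sqrt\pi}\operatorname{sgn}(x)\int_0^{x^2/2}\frac{e^{-t}}{\sqrt t}c_M(x'\sqrt{2t})\,dt.$$ (2) Complex/complex: with $E=\sqrt{\operatorname{erfc}(\sqrt2\operatorname{Im}z)\operatorname{erfc}(\sqrt2\operatorname{Im}z')}$, $$\widetilde S_{2M}(z,z')=\frac{ie^{-\frac12(z-\overline{z}')^2}}{\sqrt{2\pi}}(\overline z'-z)\,E\,e^{-z\overline z'}e_M(z\overline z'),\qquad\widetilde{DS}_{2M}(z,z')=\frac{e^{-\frac12(z-z')^2}}{\sqrt{2\pi}}(z'-z)\,E\,e^{-zz'}e_M(zz'),$$ $$\widetilde{IS}_{2M}(z,z')=-\frac{e^{-\frac12(\overline z-\overline z')^2}}{\sqrt{2\pi}}(\overline z'-\overline z)\,E\,e^{-\overline z\,\overline z'}e_M(\overline z\,\overline z').$$ (3) Real/complex: with $E_1=\sqrt{\operatorname{erfc}(\sqrt2\operatorname{Im}z)}$, $$\widetilde S_{2M}(x,z)=\frac{ie^{-\frac12(x-\overline z)^2}}{\sqrt{2\pi}}(\overline z-x)E_1e^{-x\overline z}e_M(x\overline z),\qquad\widetilde S_{2M}(z,x)=\frac{e^{-\frac12(x-z)^2}}{\sqrt{2\pi}}E_1e^{-xz}e_M(xz)+r_M(z,x),$$ $$\widetilde{DS}_{2M}(x,z)=\frac{e^{-\frac12(x-z)^2}}{\sqrt{2\pi}}(z-x)E_1e^{-xz}e_M(xz),\qquad\widetilde{IS}_{2M}(x,z)=-\frac{ie^{-\frac12(x-\overline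 z)^2}}{\sqrt{2\pi}}E_1e^{-x\overline z}e_M(x\overline z)-i\,r_M(\overline z,x),$$ and $\widetilde K_{2M}(z,x)=-\widetilde K_{2M}(x,z)^{\mathsf T}$. Here $$r_M(z,x)=\frac{e^{-z^2/2}}{\sqrt{2\pi}}\sqrt{\operatorname{erfc}(\sqrt2\,|\operatorname{Im}z|)}\;\frac{2^{M-3/2}}{(2M-2)!}\operatorname{sgn}(x)\,z^{2M-1}\,\gamma\!\left(M-\tfrac12,\tfrac{x^2}2\right)\qquad(z\in\mathbb C,\ x\in\mathbb R).$$
   Context: $\gamma(a,x)=\int_0^xt^{a-1}e^{-t}dt$ is the lower incomplete gamma function; $\operatorname{sgn}0=0$; $c_M(\gamma)=\sum_{k=0}^{M-1}\frac{\gamma^{2k}}{(2k)!}$ and $e_M(\gamma)=\sum_{k=0}^{2M-2}\frac{\gamma^k}{k!}$; $\mathcal E(\gamma,\gamma')=\frac12\operatorname{sgn}(\gamma-\gamma')$ if $\gamma,\gamma'\in\mathbb R$ and $0$ otherwise; $\overline z'$ denotes the conjugate of $z'$; $\mathbb C_*=\mathbb C\setminus\mathbb R$. The real Ginibre ensemble of $2M\times2M$ matrices is $\mathbb R^{2M\times2M}$ with i.i.d. standard normal entries. Its $(\ell,m)$-correlation function satisfies $\int_{\mathbb R^\ell\times\mathbb C_*^m}f\,R_{\ell,m}=\mathbb E\sum f(x_1,\dots,x_\ell,z_1,\dots,z_m)$ for nonnegative measurable $f$, the sum over ordered tuples of distinct real eigenvalues $x_j$ and non-real eigenvalues $z_k$,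 no two of which are equal or complex conjugate to each other. Explicitly (by the known joint eigenvalue density): let $w(\gamma)=e^{-\gamma^2/2}$ for $\gamma\in\mathbb R$ and $w(\gamma)=e^{-(\gamma^2+\overline\gamma^2)/2}\operatorname{erfc}(\sqrt2|\operatorname{Im}\gamma|)$ for $\gamma\in\mathbb C_*$. For non-negative integers $L,K$ with $L+2K=2M$, $\boldsymbol\alpha\in\mathbb R^L$, $\boldsymbol\beta\in\mathbb C^K$, let $\Omega_{L,K}(\boldsymbol\alpha,\boldsymbol\beta)=2^K\prod_jw(\alpha_j)\prod_kw(\beta_k)\,|\Delta|$ with $\Delta$ the Vandermonde determinant in $\alpha_1,\dots,\alpha_L,\beta_1,\overline{\beta_1},\dots,\beta_K,\overline{\beta_K}$, and $Z=\sum_{L+2K=2M}\frac1{L!K!2^K}\int_{\mathbb R^L}\int_{\mathbb C^K}\Omega_{L,K}$ (Lebesgue measure). Then $$R_{\ell,m}(\mathbf x,\mathbf z)=\frac1Z\sum_{\substack{L+2K=2M\\L\ge\ell,K\ge m}}\frac1{(L-\ell)!(K-m)!2^{K-m}}\int_{\mathbb R^{L-\ell}}\int_{\mathbb C^{K-m}}\Omega_{L,K}(\mathbf x\vee\boldsymbol\alpha,\mathbf z\vee\boldsymbol\beta)\,d\boldsymbol\alpha\,d\boldsymbol\beta,$$ with $\vee$ denoting concatenation.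
   Formalization: The kernel formulas are evaluated at the representative of each conjugate pair with positive imaginary part (z_k if Im z_k > 0, otherwise its conjugate), since as printed they fail for Im z_k < 0: for l = 0, m = 1 the Pfaffian would be negative. *)

(* Defs.v *)
From mathcomp Require Import all_boot all_order all_algebra all_fingroup.
From mathcomp Require Import complex.
From mathcomp Require Import all_classical all_reals all_analysis.

Set Implicit Arguments.
Unset Strict Implicit.
Unset Printing Implicit Defensive.

Import Order.TTheory GRing.Theory Num.Theory.

Local Open Scope classical_set_scope.
Local Open Scope complex_scope.
Local Open Scope ring_scope.

Section Pfaffian.
Variable F : fieldType.

Lemma pf_index_subproof n (i : 'I_n) (b : bool) : (2 * i + b < 2 * n)%N.
Proof.
apply: (@leq_trans (2 * i.+1)); last by rewrite leq_pmul2l.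
by rewrite mulnS addnC ltn_add2r; case: b.
Qed.

Definition pf_index n (i : 'I_n) (b : bool) : 'I_(2 * n) :=
  Ordinal (pf_index_subproof i b).

Definition Pf n (A : 'M[F]_(2 * n)) : F :=
  (2 ^ n * n`!)%N%:R^-1 *
  \sum_(s : 'S_(2 * n))
    (-1) ^+ s * \prod_(i < n) A (s (pf_index i false)) (s (pf_index i true)).

Lemma block_index_subproof n (p : 'I_(2 * n)) : (p./2 < n)%N.
Proof. by rewrite ltn_half_double -mul2n. Qed.

Definition block_index n (p : 'I_(2 * n)) : 'I_n :=
  Ordinal (block_index_subproof p).

Definition mx2 (a b c d : F) : 'M[F]_2 :=
  \matrix_(i, j) if i == 0 then (if j == 0 then a else b)
                 else (if j == 0 then c else d).

Definition blocks2_mx n (B : 'I_n -> 'I_n -> 'M[F]_2) : 'M[F]_(2 * n) :=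
  \matrix_(p, q) B (block_index p) (block_index q)
                   (inord (odd p)) (inord (odd q)).

End Pfaffian.

Section SpecialFunctions.
Variable R : realType.
Local Notation mu := (@lebesgue_measure R).

Definition cexp (z : R[i]) : R[i] :=
  (expR (complex.Re z))%:C * (cos (complex.Im z) +i* sin (complex.Im z)).

Definition erfc (x : R) : R :=
  2 / Num.sqrt pi * \int[mu]_(t in `[x, +oo[) expR (- t ^+ 2).

Definition lower_gamma (a x : R) : R :=
  \int[mu]_(t in `[0, x]) (t `^ (a - 1) * expR (- t)).

Definition cM (M : nat) (g : R) : R :=
  \sum_(k < M) g ^+ (2 * k) / (2 * k)`!%:R.

(* (2 * M).-1 = 2M - 1 terms, i.e. k = 0, ..., 2M - 2 *)
Definition eM (M : nat) (g : R[i]) : R[i] :=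
  \sum_(k < (2 * M).-1) g ^+ k / k`!%:R.

End SpecialFunctions.

Section Correlation.
Variable R : realType.
Local Notation mu := (@lebesgue_measure R).

Definition weightR (a : R) : R := expR (- a ^+ 2 / 2).

(* b ^+ 2 + conjc b ^+ 2 has zero imaginary part *)
Definition weightC (b : R[i]) : R :=
  expR (- complex.Re (b ^+ 2 + conjc b ^+ 2) / 2)
  * erfc (Num.sqrt 2 * `|complex.Im b|).

Definition eigenvalues (a : seq R) (b : seq R[i]) : seq R[i] :=
  [seq t%:C | t <- a] ++ flatten [seq [:: t; conjc t] | t <- b].

Definition vdm_det (s : seq R[i]) : R[i] :=
  \det (Vandermonde (size s) (\row_(i < size s) s`_i)).

Definition Omega (a : seq R) (b : seq R[i]) : R :=
  2 ^+ size b * (\prod_(t <- a) weightR t) * (\prod_(t <- b) weightC t)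
  * complex.Re `|vdm_det (eigenvalues a b)|.

Definition intR (f : R -> \bar R) : \bar R := (\int[mu]_t f t)%E.

Definition intC (f : R[i] -> \bar R) : \bar R :=
  (\int[mu]_u \int[mu]_v f (u +i* v))%E.

(* The integral over T^n as an iterated integral; it is only applied to the
   nonnegative function Omega, so by Tonelli the order does not matter. *)
Fixpoint iterated_int (T : Type) (I : (T -> \bar R) -> \bar R) (n : nat)
    (f : seq T -> \bar R) : \bar R :=
  if n is n'.+1 then I (fun t => iterated_int I n' (fun s => f (t :: s)))
  else f [::].

Definition corr_sum (M : nat) (x : seq R) (z : seq R[i]) : \bar R :=
  let l := size x in let m := size z in
  (\sum_(L < (2 * M).+1)
     \sum_(K < M.+1 | ((L + 2 * K == 2 * M) && (l <= L) && (m <= K))%N)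
       ((((L - l)`! * (K - m)`! * 2 ^ (K - m))%N%:R : R)^-1)%:E *
       iterated_int intR (L - l)%N (fun a =>
         iterated_int intC (K - m)%N (fun b => (Omega (x ++ a) (z ++ b))%:E)))%E.

(* All the integrals are finite, by the Gaussian decay of Omega. *)
Definition partition_function (M : nat) : R := fine (corr_sum M [::] [::]).

Definition corr (M : nat) (x : seq R) (z : seq R[i]) : R :=
  fine (corr_sum M x z) / partition_function M.

End Correlation.

Section Kernel.
Variables (R : realType) (M : nat).
Local Notation mu := (@lebesgue_measure R).
Local Notation C := R[i].

Definition gauss (u : C) : C := cexp (- u ^+ 2 / 2) / (Num.sqrt (2 * pi))%:C.

Definition expe (u : C) : C := cexp (- u) * eM M u.

Definition erfcI (z : C) : R := erfc (Num.sqrt 2 * complex.Im z).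

Definition rM (z : C) (x : R) : C :=
  cexp (- z ^+ 2 / 2) / (Num.sqrt (2 * pi))%:C
  * (Num.sqrt (erfc (Num.sqrt 2 * `|complex.Im z|)))%:C
  * (2 `^ (M%:R - 3 / 2) / (2 * M - 2)`!%:R * Num.sg x)%:C
  * z ^+ (2 * M - 1) * (lower_gamma (M%:R - 1 / 2) (x ^+ 2 / 2))%:C.

Definition IS_half (x x' : R) : R :=
  expR (- x ^+ 2 / 2) / (2 * Num.sqrt pi) * Num.sg x'
  * \int[mu]_(t in `[0, x' ^+ 2 / 2])
      (expR (- t) / Num.sqrt t * cM M (x * Num.sqrt (2 * t))).

(* A point of the spectrum: inl x is the real number x, and inr z is a
   non-real complex number z. *)
Definition point : Type := (R + C)%type.

Definition S_kernel (g g' : point) : C :=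
  match g, g' with
  | inl x, inl x' =>
      gauss (x - x')%:C * expe (x * x')%:C + rM x%:C x'
  | inr z, inr z' =>
      'i%C * gauss (z - conjc z') * (conjc z' - z)
      * (Num.sqrt (erfcI z * erfcI z'))%:C * expe (z * conjc z')
  | inl x, inr z =>
      'i%C * gauss (x%:C - conjc z) * (conjc z - x%:C)
      * (Num.sqrt (erfcI z))%:C * expe (x%:C * conjc z)
  | inr z, inl x =>
      gauss (x%:C - z) * (Num.sqrt (erfcI z))%:C * expe (x%:C * z) + rM z x
  end.

Definition DS_kernel_RC (x : R) (z : C) : C :=
  gauss (x%:C - z) * (z - x%:C) * (Num.sqrt (erfcI z))%:C * expe (x%:C * z).

Definition IS_kernel_RC (x : R) (z : C) : C :=
  - ('i%C * gauss (x%:C - conjc z) * (Num.sqrt (erfcI z))%:C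
     * expe (x%:C * conjc z))
  - 'i%C * rM (conjc z) x.

(* In the complex/real case DS and IS are fixed by the requirement that
   K(z, x) = - K(x, z)^T, see kernel_CR below. *)
Definition DS_kernel (g g' : point) : C :=
  match g, g' with
  | inl x, inl x' => gauss (x - x')%:C * (x' - x)%:C * expe (x * x')%:C
  | inr z, inr z' =>
      gauss (z - z') * (z' - z) * (Num.sqrt (erfcI z * erfcI z'))%:C
      * expe (z * z')
  | inl x, inr z => DS_kernel_RC x z
  | inr z, inl x => - DS_kernel_RC x z
  end.

Definition IS_kernel (g g' : point) : C :=
  match g, g' with
  | inl x, inl x' => (IS_half x x' - IS_half x' x)%:C
  | inr z, inr z' =>
      - (gauss (conjc z - conjc z') * (conjc z' - conjc z)
         * (Num.sqrt (erfcI z * erfcI z'))%:C * expe (conjc z * conjc z'))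
  | inl x, inr z => IS_kernel_RC x z
  | inr z, inl x => - IS_kernel_RC x z
  end.

Definition half_sgn (g g' : point) : C :=
  match g, g' with
  | inl x, inl x' => (Num.sg (x - x') / 2)%:C
  | _, _ => 0
  end.

Definition kernel (g g' : point) : 'M[C]_2 :=
  mx2 (DS_kernel g g') (S_kernel g g')
      (- S_kernel g' g) (IS_kernel g g' + half_sgn g g').

Lemma kernel_CR (x : R) (z : C) :
  kernel (inr z) (inl x) = - (kernel (inl x) (inr z))^T.
Proof.
apply/matrixP => i j; rewrite !mxE.
by case: (i == 0); case: (j == 0); rewrite //= ?opprK ?addr0.
Qed.

Definition points l m (x : l.-tuple R) (z : m.-tuple C) (i : 'I_(l + m)) :
    point :=
  match fintype.split i with
  | inl j => inl (tnth x j)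
  | inr k => inr (tnth z k)
  end.

Definition kernel_mx l m (x : l.-tuple R) (z : m.-tuple C) :
    'M[C]_(2 * (l + m)) :=
  blocks2_mx (fun i j => kernel (points x z i) (points x z j)).

End Kernel.

(* The representative in the upper half-plane of the conjugate pair {z, conj z}.
   The closed formulas of S_kernel, DS_kernel and IS_kernel, which contain
   erfc (sqrt 2 * Im z) without an absolute value, are expressions in this
   representative: for l = 0, m = 1 the Pfaffian is S(z, z), a positive multiple
   of Im z, whereas corr is nonnegative and invariant under z |-> conj z. *)
Definition upper (R : realType) (z : R[i]) : R[i] :=
  if 0 < complex.Im z then z else conjc z.

(* Main.v *)
(* With N = 2M, attach to a real point x the vectors
   u_k = x^k w(x) and v_k = the transform of u_k by the kernel sgn(y - x) / 2,
   and to a complex point z (in the upper half-plane) u_k = the square root of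
   the weight times z^k and v_k = i times the conjugate of u_k, k < N. Let D be
   the inverse transpose of the Gram matrix of the monomials for the skew
   product of the ensemble; D is tridiagonal, because both the real and the
   complex part of the Gram matrix satisfy a two-step recursion (integration by
   parts, resp. Stokes' formula on the upper half-plane) whose boundary terms
   cancel. Then the matrix kernel is K(g, g') = [u; v] D [u'; v']^T plus the
   sign jump: telescoping the sums in k gives the closed formulas.

   For l + 2m = N the Pfaffian of the kernel factors as
   Pf(D) * Vandermonde * Pf(sgn), that is as c * Omega, and for l + 2m > N it
   vanishes by rank. Integrating one more real or complex point out of the
   Pfaffian multiplies it by N - (l + 2m), since the Gram matrix is inverse to
   D; by Tonelli's theorem the sum of integrals defining R_(l,m) satisfies the
   same recursion. Descending induction on l + 2m identifies both, and
   l = m = 0 gives the constant Z. *)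
Require Import Defs.
From mathcomp Require Import all_boot all_order all_algebra all_fingroup.
From mathcomp Require Import complex.
From mathcomp Require Import all_classical all_reals all_analysis.
From mathcomp Require Import measurable_realfun ring lra.

Set Implicit Arguments.
Unset Strict Implicit.
Unset Printing Implicit Defensive.

Import Order.TTheory GRing.Theory Num.Theory.
Import numFieldNormedType.Exports.

Local Open Scope classical_set_scope.
Local Open Scope complex_scope.
Local Open Scope ring_scope.

(** * Pfaffians of lists *)

(** Integrating a point out changes the index set, which is awkward for a matrix over ordinals; the
    Pfaffian is therefore treated as [pfl f s], a function of a list expanded along its head. An
    expansion is a contraction [del], that is, an interior product: contractions anticommute, and
    removing the two entries of the integrated point leaves a bilinear term [del2], to which the
    Gram relation applies entry by entry. Each point contributes two list entries, called tokens.
    The sign jump is not of the form a D b^T and would spoil the rank and determinant arguments; it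
    is isolated by giving a real point one pure vector [inl] and one entry [inr] whose jump acts
    only against other [inr]. This split also explains the factor N - (l + 2m): the Gram relation
    gives 2 for each pair of entries, and every [inr] among them takes 1 away, because integrating u
    against the jump reproduces v; what is counted is the number of [inl]. Only the sum of the real
    and the complex integral is identified in this way. Finiteness comes with the induction: the
    integrand is already known to be an explicit Pfaffian, whose integrability is proved together
    with its value. *)

Section Contractions.
Variables (F : comRingType) (T : Type).
Implicit Types (g h : T -> F) (phi psi : seq T -> F) (w f : T -> T -> F).
Implicit Types (s t : seq T).

(* The alternating sum of [g s_k * phi (s without s_k)]. *)
Fixpoint del g phi s : F :=
  if s is b :: s' then g b * phi s' - del g (fun t => phi (b :: t)) s' else 0.

(* The sum over [j < k] of [w s_j s_k * phi (s without s_j, s_k)], with the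
   sign of moving [s_j, s_k] to the front. *)
Fixpoint del2 w phi s : F :=
  if s is b :: s' then del (w b) phi s' + del2 w (fun t => phi (b :: t)) s'
  else 0.

Lemma eq_del g phi psi s :
  (forall t, (size t).+1 = size s -> phi t = psi t) -> del g phi s = del g psi s.
Proof.
elim: s phi psi => [//|b s IH] phi psi e /=; rewrite e //; congr (_ - _).
by apply: IH => t st; apply: e; rewrite /= st.
Qed.

Lemma eq_dell g h phi s : g =1 h -> del g phi s = del h phi s.
Proof. by move=> e; elim: s phi => [//|b s IH] phi /=; rewrite e IH. Qed.

Lemma delD g phi psi s :
  del g (fun t => phi t + psi t) s = del g phi s + del g psi s.
Proof.
by elim: s phi psi => [|b s IH] phi psi /=; rewrite ?addr0// IH; ring.
Qed.

Lemma delZ g c phi s : del g (fun t => c * phi t) s = c * del g phi s.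
Proof. by elim: s phi => [|b s IH] phi /=; rewrite ?mulr0// IH; ring. Qed.

Lemma delB g phi psi s :
  del g (fun t => phi t - psi t) s = del g phi s - del g psi s.
Proof.
by elim: s phi psi => [|b s IH] phi psi /=; rewrite ?subr0// IH; ring.
Qed.

Lemma del0 phi s : del (fun=> 0) phi s = 0.
Proof. by elim: s phi => [//|b s IH] phi /=; rewrite IH; ring. Qed.

Lemma dell_lin g h c phi s :
  del (fun b => c * g b + h b) phi s = c * del g phi s + del h phi s.
Proof.
by elim: s phi => [|b s IH] phi /=; rewrite ?mulr0 ?addr0// IH; ring.
Qed.

Lemma del_det g h c d phi s :
  del (fun b => c * g b - d * h b) phi s = c * del g phi s - d * del h phi s.
Proof. by elim: s phi => [|b s IH] phi /=; rewrite ?mulr0 ?subr0// IH; ring. Qed.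

(** This is the sign rule of interior products; with [g = h] it makes a double contraction
    vanish. *)
Lemma del_anticomm g h phi s : del g (del h phi) s = - del h (del g phi) s.
Proof.
elim: s phi => [|b s IH] phi /=; first by rewrite oppr0.
by rewrite !delB !delZ IH; ring.
Qed.

(** Two given entries can be removed in either order, with opposite signs, so their contributions
    combine into a 2x2 minor of [g] and [h]. *)
Lemma del_del g h phi s :
  del g (del h phi) s = del2 (fun b c => g b * h c - h b * g c) phi s.
Proof.
elim: s phi => [//|b s IH] phi /=; rewrite delB delZ -IH.
rewrite del_det; ring.
Qed.

Lemma eq_del2 w phi psi s :
  (forall t, (size t).+2 = size s -> phi t = psi t) ->
  del2 w phi s = del2 w psi s.
Proof.
elim: s phi psi => [//|b s IH] phi psi e /=; congr (_ + _).
  by apply: eq_del => t st; apply: e; rewrite /= st.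
by apply: IH => t st; apply: e; rewrite /= st.
Qed.

Lemma eq_del2l w w' phi s : w =2 w' -> del2 w phi s = del2 w' phi s.
Proof.
by move=> e; elim: s phi => [//|b s IH] phi /=; rewrite IH (eq_dell _ _ (e b)).
Qed.

Lemma del2B w phi psi s :
  del2 w (fun t => phi t - psi t) s = del2 w phi s - del2 w psi s.
Proof.
by elim: s phi psi => [|b s IH] phi psi /=; rewrite ?subr0// delB IH; ring.
Qed.

Lemma del2Z w c phi s : del2 w (fun t => c * phi t) s = c * del2 w phi s.
Proof. by elim: s phi => [|b s IH] phi /=; rewrite ?mulr0// delZ IH; ring. Qed.

Lemma del2l_lin w w' c phi s :
  del2 (fun a b => c * w a b + w' a b) phi s
  = c * del2 w phi s + del2 w' phi s.
Proof.
by elim: s phi => [|b s IH] phi /=; rewrite ?mulr0 ?addr0// dell_lin IH; ring.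
Qed.

(** [del2] removes two entries and is therefore even: moving a contraction past it costs no sign. *)
Lemma del2_del w g phi s : del2 w (del g phi) s = del g (del2 w phi) s.
Proof.
elim: s phi => [//|b s IH] phi /=.
by rewrite del2B del2Z IH delD del_anticomm; ring.
Qed.

(** A Leibniz rule: the total weight is that of the removed entry plus that of what remains. *)
Lemma del_weight d g phi s :
  del (fun b => d b * g b) phi s
  + del g (fun t => (\sum_(b <- t) d b) * phi t) s
  = (\sum_(b <- s) d b) * del g phi s.
Proof.
elim: s phi => [|b s IH] phi /=; first by rewrite mulr0 addr0.
rewrite big_cons.
have -> : del g (fun t => (\sum_(c <- b :: t) d c) * phi (b :: t)) s =
    d b * del g (fun t => phi (b :: t)) s +
    del g (fun t => (\sum_(c <- t) d c) * phi (b :: t)) s.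
  by rewrite -delZ -delD; apply: eq_del => t _; rewrite big_cons mulrDl.
have := IH (fun t => phi (b :: t)).
set x := del _ _ s; set y := del _ _ s; set z := del _ _ s => e.
have -> : x = (\sum_(b <- s) d b) * z - y by rewrite -e addrK.
by ring.
Qed.

(** The recursion runs on the fuel [n], since [del] calls its continuation on lists that are not
    subterms of [s]. *)
Fixpoint pfn n f s : F :=
  if s is a :: s' then (if n is n'.+1 then del (f a) (pfn n' f) s' else 0)
  else 1.

Definition pfl f s := pfn (size s) f s.

Lemma pfl_nil f : pfl f [::] = 1. Proof. by []. Qed.

Lemma pfn_fuel n f s : (size s <= n)%N -> pfn n f s = pfl f s.
Proof.
rewrite /pfl; elim/ltn_ind: n s => -[|n] IH [|a s]//=; rewrite ltnS => sn.
apply: eq_del => t st; have ts : (size t <= size s)%N by rewrite -st leqnSn.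
by rewrite (IH n)// ?(IH (size s))// (leq_trans ts).
Qed.

Lemma pfl_cons f a s : pfl f (a :: s) = del (f a) (pfl f) s.
Proof.
by rewrite {1}/pfl /=; apply: eq_del => t st; rewrite pfn_fuel// -st.
Qed.

Lemma pfl_cons2 f a b s :
  pfl f (a :: b :: s) = f a b * pfl f s - del (f a) (del (f b) (pfl f)) s.
Proof.
by rewrite pfl_cons /=; congr (_ - _); apply: eq_del => t _; rewrite pfl_cons.
Qed.

Lemma eq_pfl f f' s : f =2 f' -> pfl f s = pfl f' s.
Proof.
move=> e; rewrite /pfl; move: (size s) => n; elim: n s => [|n IH] [|a s]//=.
by rewrite (eq_dell _ _ (e a)); apply: eq_del => t _; exact: IH.
Qed.

(** Euler's identity: a perfect matching is met once for each of its pairs [b, c], with weight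
    [d b + d c], and these weights add up over the matching to that of the list. Weight 1 everywhere
    yields the normalization of the matrix Pfaffian; weight 1 on vector tokens yields the factor in
    the integration step. *)
Lemma pfl_weight d f s :
  del2 (fun b c => (d b + d c) * f b c) (pfl f) s
  = (\sum_(b <- s) d b) * pfl f s.
Proof.
move: s {2}(size s) (leqnn (size s)) => s n; elim: n s => [|n IH] [|a s]//=;
  rewrite ?big_nil ?mul0r// ltnS => sn.
rewrite (@eq_del2 _ _ (del (f a) (pfl f))); last by move=> t _; rewrite pfl_cons.
rewrite del2_del (@eq_del (f a) _ (fun t => (\sum_(b <- t) d b) * pfl f t)); last first.
  by move=> t st; apply: IH; apply: leq_trans sn; rewrite -st.
rewrite (@eq_dell _ (fun c => d a * f a c + d c * f a c)); last first.
  by move=> c; rewrite mulrDl.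
by rewrite dell_lin -addrA del_weight pfl_cons big_cons mulrDl.
Qed.

Lemma pfl_odd f s : odd (size s) -> pfl f s = 0.
Proof.
move: s {2}(size s) (leqnn (size s)) => s n; elim: n s => [|n IH] [|a s]//=.
rewrite ltnS pfl_cons => sn os; rewrite (@eq_del _ _ (fun t => 0 * pfl f t)).
  by rewrite delZ mul0r.
move=> t st; rewrite mul0r IH//; first by apply: leq_trans sn; rewrite -st.
by move: os; rewrite -st /= negbK.
Qed.

Section Antisymmetry.
Variable f : T -> T -> F.
Hypothesis fN : forall a b, f b a = - f a b.

Lemma del_swap g phi :
  (forall r a b s, phi (r ++ a :: b :: s) = - phi (r ++ b :: a :: s)) ->
  forall r a b s, del g phi (r ++ a :: b :: s) = - del g phi (r ++ b :: a :: s).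
Proof.
move=> phiN r a b s; elim: r phi phiN => [|c r IH] phi phiN /=.
  rewrite (@eq_del _ (fun t => phi [:: a, b & t]) (fun t => -1 * phi [:: b, a & t])).
    by rewrite delZ; ring.
  by move=> t _; rewrite mulN1r; exact: (phiN [::]).
rewrite phiN (IH (fun t => phi (c :: t))); first by ring.
by move=> r' a' b' s'; exact: (phiN (c :: r')).
Qed.

Lemma pfn_swap n r a b s :
  pfn n f (r ++ a :: b :: s) = - pfn n f (r ++ b :: a :: s).
Proof.
elim: n r a b s => [|n IH] [|c r] a b s /=; rewrite ?oppr0//; last first.
  exact: del_swap.
(* With fuel 1 the second expansion is cut off: everything is 0 unless the list has just the two
   entries, where [fN] decides. *)
case: n IH => [|n] IH /=.
  case: s => [|c s] /=; first by rewrite fN; ring.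
  set d1 := del _ _ s; set d2 := del _ _ s.
  have -> : d1 = 0 by rewrite /d1 (@eq_del _ _ (fun t => 0 * pfl f t))
    ?delZ ?mul0r// => t _; rewrite mul0r.
  have -> : d2 = 0 by rewrite /d2 (@eq_del _ _ (fun t => 0 * pfl f t))
    ?delZ ?mul0r// => t _; rewrite mul0r.
  by ring.
by rewrite fN del_anticomm; ring.
Qed.

Lemma pfl_swap r a b s : pfl f (r ++ a :: b :: s) = - pfl f (r ++ b :: a :: s).
Proof. by rewrite /pfl pfn_swap !size_cat. Qed.

End Antisymmetry.
End Contractions.

Section ContractionMap.
Variables (F : comRingType) (T1 T : Type) (i : T1 -> T).

Lemma del_map (g : T -> F) phi s :
  del g phi (map i s) = del (g \o i) (phi \o map i) s.
Proof.
elim: s phi => [//|b s IH] phi /=; congr (_ - _).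
exact: (IH (fun t => phi (i b :: t))).
Qed.

Lemma pfl_map (f : T -> T -> F) s :
  pfl f (map i s) = pfl (fun a b => f (i a) (i b)) s.
Proof.
rewrite /pfl size_map; move: (size s) => n; elim: n s => [|n IH] [|a s]//=.
by rewrite del_map; apply: eq_del => t _; exact: IH.
Qed.

End ContractionMap.

Section DirectSum.
Variables (F : comRingType) (T1 T : Type) (i : T1 -> T).

Lemma del_cat0 T2 (j : T2 -> T) (g : T -> F) phi s t :
  (forall b, g (j b) = 0) ->
  del g phi (s ++ map j t) = del g (fun r => phi (r ++ map j t)) s.
Proof.
move=> gj; elim: s phi => [|b s IH] phi /=; last by rewrite IH.
elim: t phi => [//|b t IH] phi /=.
by rewrite gj (IH (fun r => phi (j b :: r))) mul0r subr0.
Qed.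

(** Block-diagonal case: expanding along the heads of the first list, a contraction never reaches
    the second one. *)
Lemma pfl_cat T2 (j : T2 -> T) (f : T -> T -> F) s t :
  (forall a b, f (i a) (j b) = 0) ->
  pfl f (map i s ++ map j t)
  = pfl (fun a b => f (i a) (i b)) s * pfl (fun a b => f (j a) (j b)) t.
Proof.
move=> fij; move: s {2}(size s) (leqnn (size s)) => s n.
elim: n s => [|n IH] [|a s] //; first by rewrite pfl_map pfl_nil mul1r.
  by rewrite pfl_map pfl_nil mul1r.
rewrite /= ltnS => sn.
rewrite !pfl_cons del_cat0// del_map mulrC -delZ.
apply: eq_del => r rs /=.
rewrite IH; first by rewrite mulrC.
by apply: leq_trans sn; rewrite -rs.
Qed.

End DirectSum.

Section Moves.
Variables (F : comRingType) (T : Type) (f : T -> T -> F).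
Hypothesis fN : forall a b, f b a = - f a b.

Lemma pfl_move1 r a s t :
  pfl f (r ++ a :: s ++ t) = (-1) ^+ size s * pfl f (r ++ s ++ a :: t).
Proof.
elim: s r => [|b s IH] r; first by rewrite mul1r.
rewrite cat_cons pfl_swap// -(cat_rcons b) IH cat_rcons exprS.
by rewrite mulN1r mulNr.
Qed.

Lemma pfl_move r s1 s2 t :
  pfl f (r ++ s1 ++ s2 ++ t)
  = (-1) ^+ (size s1 * size s2) * pfl f (r ++ s2 ++ s1 ++ t).
Proof.
elim: s1 r => [|a s1 IH] r; first by rewrite mul1r.
rewrite cat_cons -cat_rcons IH cat_rcons (pfl_move1 r a s2) mulrA -exprD.
by rewrite addnC -mulSn.
Qed.

(** Each [v x] has to pass the [u] of all later pairs, which makes 0 + 1 + ... + (n - 1)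
    transpositions. *)
Lemma pfl_unzip (I : Type) (u v : I -> T) r s t :
  pfl f (r ++ flatten [seq [:: u x; v x] | x <- s] ++ t)
  = (-1) ^+ 'C(size s, 2) * pfl f (r ++ map u s ++ map v s ++ t).
Proof.
elim: s r => [|x s IH] r /=; first by rewrite bin0n mul1r.
rewrite -[r ++ _]cat_rcons -cat_rcons IH !cat_rcons.
have := pfl_move1 (rcons r (u x)) (v x) (map u s) (map v s ++ t).
rewrite !cat_rcons => ->; rewrite mulrA -exprD size_map binS bin1 addnC.
by rewrite addnC.
Qed.

End Moves.

(** * Comparison of the list Pfaffian with signed sums over permutations *)

Section PermutationSum.
Variables (F : numFieldType) (T : Type).

(** Unlike [del], this hands the removed entry to the continuation, so that its iteration [alt] is
    the signed sum over ordered draws of [n] entries. *)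
Fixpoint sdel (Psi : T -> seq T -> F) s : F :=
  if s is b :: s' then Psi b s' - sdel (fun c t => Psi c (b :: t)) s' else 0.

Fixpoint alt n (phi : seq T -> F) s : F :=
  if n is n'.+1 then sdel (fun c t => alt n' (fun r => phi (c :: r)) t) s
  else phi [::].

Fixpoint pairs (f : T -> T -> F) s : F :=
  if s is a :: b :: s' then f a b * pairs f s' else 1.

Lemma eq_sdel Psi Psi' s :
  (forall c t, (size t).+1 = size s -> Psi c t = Psi' c t) ->
  sdel Psi s = sdel Psi' s.
Proof.
elim: s Psi Psi' => [//|b s IH] Psi Psi' e /=; rewrite e//; congr (_ - _).
by apply: IH => c t ct; apply: e; rewrite /= ct.
Qed.

Lemma sdelE (g : T -> F) phi s : sdel (fun c t => g c * phi t) s = del g phi s.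
Proof.
by elim: s phi => [//|b s IH] phi /=; rewrite (IH (fun t => phi (b :: t))).
Qed.

Lemma sdel_sub Psi Psi' s :
  sdel (fun c t => Psi c t - Psi' c t) s = sdel Psi s - sdel Psi' s.
Proof.
by elim: s Psi Psi' => [|b s IH] Psi Psi' /=; rewrite ?subr0// IH; ring.
Qed.

Lemma sdelZ a Psi s : sdel (fun c t => a * Psi c t) s = a * sdel Psi s.
Proof. by elim: s Psi => [|b s IH] Psi /=; rewrite ?mulr0// IH; ring. Qed.

Lemma altZ n a phi s : alt n (fun t => a * phi t) s = a * alt n phi s.
Proof.
elim: n phi s => [//|n IH] phi s /=; rewrite -sdelZ.
by apply: eq_sdel => c t _; exact: IH.
Qed.

(** Every pair is drawn in both orders, and antisymmetry of [f] makes the two contributions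
    equal. *)
Lemma sdel_del2 (f : T -> T -> F) psi s : (forall a b, f b a = - f a b) ->
  sdel (fun c t => del (f c) psi t) s = 2 * del2 f psi s.
Proof.
move=> fN; elim: s psi => [|b s IH] psi /=; first by rewrite mulr0.
rewrite sdel_sub (IH (fun t => psi (b :: t))) (@sdelE (f^~ b)).
rewrite (@eq_dell _ _ (f^~ b) (fun c => (-1) * f b c - 0 * f b c)).
  by rewrite del_det; ring.
by move=> c; rewrite fN; ring.
Qed.

Lemma del2l0 (f : T -> T -> F) phi s : del2 (fun a b => 0 * f a b) phi s = 0.
Proof.
have := del2l_lin f (fun a b => 0 * f a b) 0 phi s.
rewrite mul0r add0r => <-; elim: s phi => [//|b s IH] phi /=.
rewrite IH addr0 (@eq_dell _ _ _ (fun=> 0)) ?del0// => c.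
by rewrite !mul0r addr0.
Qed.

(** Drawing one more pair costs a factor 2 for the order inside it and, by Euler's identity with
    unit weights, a factor [n.+1] for the choice of the pair drawn first. *)
Lemma alt_pairs f n s : (forall a b, f b a = - f a b) -> size s = (2 * n)%N ->
  alt (2 * n) (pairs f) s = (2 ^ n * n`!)%N%:R * pfl f s.
Proof.
move=> fN; elim: n s => [|n IH] s; first by case: s => //= _; rewrite mul1r.
rewrite mulnS => sn.
have -> : alt (2 + 2 * n) (pairs f) s
    = sdel (fun c t => del (f c) (alt (2 * n) (pairs f)) t) s.
  apply: eq_sdel => c t _; rewrite -sdelE; apply: eq_sdel => d r _ /=.
  exact: altZ.
rewrite sdel_del2//.
rewrite (@eq_del2 _ _ _ _ (fun t => (2 ^ n * n`!)%N%:R * pfl f t)); last first.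
  by move=> t; rewrite sn => -[tn]; exact: IH.
rewrite del2Z; have := pfl_weight (fun=> 1) f s.
(* The zero term brings the weight 1 + 1 into the shape of [del2l_lin]. *)
rewrite (@eq_del2l _ _ _ (fun b c => 2 * f b c + 0 * f b c)); last first.
  by move=> b c; ring.
rewrite del2l_lin big_const_seq count_predT sn iter_addr addr0 => e.
rewrite mulrCA; have -> : 2 * del2 f (pfl f) s = (2 * n.+1)%:R * pfl f s.
  by rewrite mulnS -e del2l0 addr0.
rewrite mulrA -natrM; congr (_%:R * _).
by rewrite factS expnS; ring.
Qed.

Lemma sdel_enum n (w : 'I_n.+1 -> T) Psi :
  sdel Psi (map w (enum 'I_n.+1))
  = \sum_(k < n.+1) (-1) ^+ k * Psi (w k) (map (w \o lift k) (enum 'I_n)).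
Proof.
elim: n w Psi => [|n IH] w Psi.
  rewrite enum_ordSl /= (size0nil (size_enum_ord 0)) /= big_ord_recl big_ord0.
  by rewrite subr0 addr0 mul1r.
rewrite enum_ordSl /= -map_comp IH [RHS]big_ord_recl mul1r -sumrN.
congr (_ + _); apply: eq_bigr => k _.
rewrite /= exprS mulN1r mulNr; congr (- (_ * _)).
rewrite enum_ordSl /= -!map_comp; congr (Psi _ (w _ :: _)).
  by apply/val_inj.
by apply: eq_map => j /=; congr w; apply/val_inj; rewrite /= /bump !add1n ltnS !addnS.
Qed.

(** A permutation is split into the image [k] of 0 and a permutation of the rest; the sign
    [(-1) ^+ k] of the deletion is the parity contributed by [lift_perm]. *)
Lemma alt_enum n (w : 'I_n -> T) phi :
  alt n phi (map w (enum 'I_n))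
  = \sum_(s : 'S_n) (-1) ^+ s * phi (map (w \o s) (enum 'I_n)).
Proof.
elim: n w phi => [|n IH] w phi.
  rewrite (big_pred1 1%g) ?odd_perm1 ?mul1r.
    by rewrite (size0nil (size_enum_ord 0)).
  by move=> s; apply/esym/eqP/permP => -[].
pose h (p : 'I_n.+1 * 'S_n) : 'S_n.+1 := lift_perm ord0 p.1 p.2.
have h_inj : injective h.
  move=> [k s] [k' s'] /permP /= e.
  have ek : k = k' by have := e ord0; rewrite !lift_perm_id.
  rewrite {}ek in e *; congr pair; apply/permP => j.
  by have := e (lift ord0 j); rewrite !lift_perm_lift => /lift_inj.
have h_bij : bijective h.
  by apply: inj_card_bij => //; rewrite card_prod !card_Sn card_ord factS.
rewrite /= sdel_enum [RHS](reindex h) /=; last exact: onW_bij.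
rewrite -(pair_big predT predT (fun k s => (-1) ^+ h (k, s) *
  phi [seq (w \o h (k, s)) i | i <- enum 'I_n.+1])) /=.
apply: eq_bigr => k _; rewrite IH mulr_sumr; apply: eq_bigr => s _.
rewrite odd_lift_perm /= signr_addb mulrA signr_odd; congr (_ * phi _).
rewrite enum_ordSl /= lift_perm_id -map_comp; congr (_ :: _).
by apply: eq_map => j /=; rewrite lift_perm_lift.
Qed.

End PermutationSum.

Section PfaffianList.
Variable F : numFieldType.

Lemma pairs_prod T (f : T -> T -> F) x0 n t : size t = (2 * n)%N ->
  pairs f t = \prod_(i < n) f (nth x0 t (2 * i)) (nth x0 t (2 * i).+1).
Proof.
elim: n t => [|n IH] [|a [|b t]]//=; rewrite ?big_ord0// mulnS// => -[tn].
rewrite big_ord_recl [pairs _ _]/= (IH _ tn) muln0; congr (_ * _).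
by apply: eq_bigr => i _; rewrite lift0 mulnS.
Qed.

Lemma Pf_pfl n (A : 'M[F]_(2 * n)) : (forall i j, A j i = - A i j) ->
  Pf A = pfl (fun i j => A i j) (enum 'I_(2 * n)).
Proof.
move=> AN; rewrite /Pf; have := alt_pairs AN (size_enum_ord (2 * n)).
have := alt_enum id (pairs (fun i j => A i j)); rewrite map_id => -> e.
apply: (@mulfI _ (2 ^ n * n`!)%N%:R).
  by rewrite pnatr_eq0 muln_eq0 expn_eq0 /= -lt0n fact_gt0.
rewrite mulVKf; last by rewrite pnatr_eq0 muln_eq0 expn_eq0 /= -lt0n fact_gt0.
rewrite -e; apply: eq_bigr => s _; congr (_ * _).
case: n A AN {e} s => [|n] A _ s.
  by rewrite big_ord0 (size0nil (size_enum_ord (2 * 0))).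
pose x0 : 'I_(2 * n.+1) := pf_index ord0 false.
rewrite (pairs_prod _ x0 (n := n.+1)); last by rewrite size_map size_enum_ord.
have nthE (i : 'I_n.+1) (b : bool) : nth x0 (enum 'I_(2 * n.+1)) (2 * i + b)%N = pf_index i b.
  by apply: ord_inj; rewrite nth_enum_ord// pf_index_subproof.
apply: eq_bigr => i _; have := nthE i true; have := nthE i false.
rewrite addn0 addn1 => <- <-.
have lt0 := pf_index_subproof i false; have lt1 := pf_index_subproof i true.
rewrite addn0 in lt0; rewrite addn1 in lt1.
by rewrite !(nth_map x0) -?enumT ?size_enum_ord.
Qed.

Lemma pf_indexK n (i : 'I_n) b : (block_index (pf_index i b), odd (pf_index i b)) = (i, b).
Proof.
congr pair; last by rewrite /= oddD mul2n odd_double; case: b.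
by apply: val_inj; rewrite /= mul2n; case: b; rewrite ?addn1 ?addn0 /= ?uphalf_double ?doubleK.
Qed.

Lemma block_indexK n (p : 'I_(2 * n)) : pf_index (block_index p) (odd p) = p.
Proof. by apply: ord_inj; rewrite /= addnC -[in RHS](odd_double_half p) -mul2n. Qed.

Lemma prod_pf_index n (f : 'I_(2 * n) -> F) :
  \prod_p f p = \prod_(i < n) (f (pf_index i false) * f (pf_index i true)).
Proof.
rewrite (reindex (fun x : 'I_n * bool => pf_index x.1 x.2)) /=; last first.
  exists (fun p => (block_index p, odd p)) => [[i b] _|p _].
    exact: pf_indexK.
  exact: block_indexK.
rewrite -(pair_big predT predT (fun i b => f (pf_index i b))) /=.
by apply: eq_bigr => i _; rewrite big_bool mulrC.
Qed.

(** A Cauchy-Binet expansion: multiplying out the product assigns a column [t p] of [B] to each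
    index [p], and for fixed [t] the sum over permutations is a determinant. *)
Lemma Pf_congr_sum n q (B : 'M[F]_(2 * n, q)) (A : 'M[F]_q) :
  Pf (B *m A *m B^T) = (2 ^ n * n`!)%N%:R^-1 *
  \sum_(t : {ffun 'I_(2 * n) -> 'I_q})
    (\prod_(i < n) A (t (pf_index i false)) (t (pf_index i true)))
    * \det (\matrix_(i, j) B j (t i)).
Proof.
rewrite /Pf; congr (_ * _).
under [RHS]eq_bigr => t _ do rewrite /determinant mulr_sumr.
rewrite exchange_big; apply: eq_bigr => s _ /=.
under [RHS]eq_bigr => t _ do rewrite mulrCA.
rewrite -mulr_sumr; congr (_ * _).
pose G (i : 'I_n) (c : 'I_q * 'I_q) :=
  B (s (pf_index i false)) c.1 * A c.1 c.2 * B (s (pf_index i true)) c.2.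
transitivity (\prod_(i < n) \sum_c G i c).
  apply: eq_bigr => i _; rewrite mxE.
  rewrite -(pair_big predT predT (fun a b => G i (a, b))) /= exchange_big /=.
  by apply: eq_bigr => b _; rewrite mxE mulr_suml; apply: eq_bigr => a _; rewrite mxE.
rewrite bigA_distr_bigA (reindex (fun t : {ffun 'I_(2 * n) -> 'I_q} =>
  [ffun i => (t (pf_index i false), t (pf_index i true))])) /=; last first.
  exists (fun c : {ffun 'I_n -> 'I_q * 'I_q} =>
    [ffun p : 'I_(2 * n) => if odd p then (c (block_index p)).2
                            else (c (block_index p)).1]) => [t _|c _].
    apply/ffunP => p; rewrite !ffunE /= -[in RHS](block_indexK p).
    by case: (odd p).
  apply/ffunP => i; rewrite !ffunE.
  have [-> ->] := pf_indexK i false; have [-> ->] := pf_indexK i true.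
  by case: (c i).
apply: eq_bigr => t _; rewrite prod_pf_index -big_split.
by apply: eq_bigr => i _ /=; rewrite !mxE ffunE /G /=; ring.
Qed.

(** A non-injective assignment repeats a row of its determinant; an injective one is a permutation
    and contributes its sign times [\det B]. *)
Lemma Pf_congr n (B A : 'M[F]_(2 * n)) : Pf (B *m A *m B^T) = \det B * Pf A.
Proof.
rewrite Pf_congr_sum [in RHS]/Pf mulrCA; congr (_ * _).
rewrite (bigID (fun t : {ffun _ -> _} => injectiveb t)) /= [X in _ + X]big1 ?addr0.
  rewrite mulr_sumr (reindex (@pval _)) /=; last first.
    pose p' := insubd (1%g : 'S_(2 * n)).
    exists p' => [s _|t inj_t]; first exact: valKd.
    by apply: insubdK; exact: inj_t.
  apply: eq_big => [s|s _]; first by rewrite (valP s).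
  have -> : \matrix_(i, j) B j (pval s i) = row_perm s B^T.
    by apply/matrixP => i j; rewrite !mxE pvalE.
  rewrite row_permE det_mulmx det_perm det_tr mulrC (mulrC _ (\det B)) -mulrA.
  by congr (_ * (_ * _)); apply: eq_bigr => i _; rewrite !pvalE.
move=> t /injectivePn[i [j ij tij]].
by rewrite (determinant_alternate ij) ?mulr0// => k; rewrite !mxE tij.
Qed.

Lemma Pf_congr_rank n q (B : 'M[F]_(2 * n, q)) (A : 'M[F]_q) :
  (q < 2 * n)%N -> Pf (B *m A *m B^T) = 0.
Proof.
move=> qn; rewrite Pf_congr_sum big1 ?mulr0// => t _.
have /injectivePn[i [j ij tij]] : ~~ injectiveb t.
  apply/negP => /injectiveP /leq_card.
  by rewrite !card_ord leqNgt qn.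
by rewrite (determinant_alternate ij) ?mulr0// => k; rewrite !mxE tij.
Qed.

End PfaffianList.

(** * Pfaffians of a bilinear form of bounded rank plus a jump *)

Section TokenForm.
Variables (F : numFieldType) (X : Type) (N : nat).
Variables (D : 'M[F]_N) (v : X -> 'rV[F]_N) (E : X -> X -> F).
Hypothesis DN : forall i j, D j i = - D i j.
Hypothesis EN : forall x y, E y x = - E x y.

(* [inl a] is a vector paired through [D] alone; [inr x] is the vector [v x],
   which also interacts with the other [inr y] through the jump [E x y]. *)
Definition token : Type := ('rV[F]_N + X)%type.

Definition token_vec (b : token) : 'rV[F]_N :=
  match b with inl a => a | inr x => v x end.

Definition token_jump (b c : token) : F :=
  match b, c with inr x, inr y => E x y | _, _ => 0 end.

Definition dform (a b : 'rV[F]_N) : F := (a *m D *m b^T) 0 0.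

Definition token_form (b c : token) : F :=
  dform (token_vec b) (token_vec c) + token_jump b c.

Lemma dformE a b : dform a b = \sum_i \sum_j a 0 i * D i j * b 0 j.
Proof.
rewrite /dform mxE exchange_big; apply: eq_bigr => j _.
by rewrite !mxE mulr_suml; apply: eq_bigr => i _.
Qed.

Lemma dformN a b : dform b a = - dform a b.
Proof.
rewrite !dformE exchange_big -sumrN; apply: eq_bigr => i _.
by rewrite -sumrN; apply: eq_bigr => j _; rewrite DN; ring.
Qed.

Lemma token_formN b c : token_form c b = - token_form b c.
Proof.
rewrite /token_form dformN opprD; congr (_ + _).
by case: b c => [?|?] [?|?] /=; rewrite ?oppr0.
Qed.

Lemma congr_mxN k q (B : 'M[F]_(k, q)) (Q : 'M[F]_q) :
  (forall i j, Q j i = - Q i j) ->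
  forall i j, (B *m Q *m B^T) j i = - (B *m Q *m B^T) i j.
Proof.
move=> QN i j; have QT : Q^T = - Q by apply/matrixP => a b; rewrite !mxE QN.
have : (B *m Q *m B^T)^T = - (B *m Q *m B^T).
  by rewrite !trmx_mul trmxK QT mulNmx mulmxN mulmxA.
by move: (B *m Q *m B^T) => M /matrixP /(_ i j); rewrite !mxE.
Qed.

Lemma pfl_congr k (B Q : 'M[F]_k) : (forall i j, Q j i = - Q i j) ->
  pfl (fun i j => (B *m Q *m B^T) i j) (enum 'I_k)
  = \det B * pfl (fun i j => Q i j) (enum 'I_k).
Proof.
move=> QN; have [ok|/negbTE ek] := boolP (odd k).
  by rewrite !pfl_odd ?mulr0// size_enum_ord.
have ke : k = (2 * k./2)%N by rewrite mul2n -[LHS]odd_double_half ek.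
move: (k./2) ke B Q QN => n ->{k ek} B Q QN.
rewrite -(Pf_pfl (congr_mxN B QN)).
by rewrite Pf_congr Pf_pfl.
Qed.

Lemma pfl_congr_rank k q (B : 'M[F]_(k, q)) (Q : 'M[F]_q) :
  (forall i j, Q j i = - Q i j) -> (q < k)%N ->
  pfl (fun i j => (B *m Q *m B^T) i j) (enum 'I_k) = 0.
Proof.
move=> QN; have [ok _|/negbTE ek] := boolP (odd k).
  by rewrite !pfl_odd ?mulr0// size_enum_ord.
have ke : k = (2 * k./2)%N by rewrite mul2n -[LHS]odd_double_half ek.
move: (k./2) ke B => n ->{k ek} B qn.
rewrite -Pf_pfl; last exact: congr_mxN.
exact: Pf_congr_rank.
Qed.

Lemma enum_ordD m n :
  enum 'I_(m + n) = map (@lshift m n) (enum 'I_m) ++ map (@rshift m n) (enum 'I_n).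
Proof.
apply: (inj_map val_inj); rewrite val_enum_ord map_cat.
rewrite -[X in X ++ _]map_comp -[X in _ ++ X]map_comp iotaD add0n.
rewrite -[in iota 0 m]val_enum_ord -[X in iota X n]addn0 iotaDl.
by rewrite -val_enum_ord -map_comp.
Qed.

Section Factor.
Variables (k : nat) (ws : k.-tuple 'rV[F]_N) (xs : seq X).
Let l := size xs.
Let w (i : 'I_k) := tnth ws i.
Let x (i : 'I_l) := tnth (in_tuple xs) i.
(** Each jump token gets one extra coordinate: [inr x] becomes the row of [B] made of [v x] and a
    unit vector. Vectors and jumps together are then a congruence of the block-diagonal matrix of
    [D] and [E]. *)
Let Q : 'M[F]_(N + l) := block_mx D 0 0 (\matrix_(i, j) E (x i) (x j)).
Let B : 'M[F]_(k + l, N + l) :=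
  block_mx (\matrix_i w i) 0 (\matrix_i v (x i)) 1%:M.
Let tok (p : 'I_(k + l)) : token :=
  match fintype.split p with inl i => inl (w i) | inr j => inr (x j) end.

Let tok_enum : map tok (enum 'I_(k + l)) = map inl ws ++ map inr xs.
Proof.
rewrite enum_ordD map_cat -[X in X ++ _ = _]map_comp -[X in _ ++ X = _]map_comp.
have -> : map inl ws = [seq (inl (w i) : token) | i <- enum 'I_k].
  by rewrite -[in LHS](map_tnth_enum ws) -map_comp.
have -> : map inr xs = [seq (inr (x i) : token) | i <- enum 'I_l].
  by rewrite -[X in map inr X = _](map_tnth_enum (in_tuple xs)) -map_comp.
congr (_ ++ _); apply: eq_map => i; rewrite /tok /=.
  by rewrite -[lshift _ _]/(unsplit (inl i)) unsplitK.
by rewrite -[rshift _ _]/(unsplit (inr i)) unsplitK.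
Qed.

Let mul_dform m n (A : 'M[F]_(m, N)) (A' : 'M[F]_(n, N)) i j :
  (A *m D *m A'^T) i j = dform (row i A) (row j A').
Proof.
rewrite /dform !mxE; apply: eq_bigr => p _; rewrite !mxE; congr (_ * _).
by apply: eq_bigr => q _; rewrite !mxE.
Qed.

Let tok_form p q : token_form (tok p) (tok q) = (B *m Q *m B^T) p q.
Proof.
rewrite /B /Q tr_block_mx !mulmx_block !(mul0mx, mulmx0, addr0, add0r, mul1mx).
rewrite trmx0 trmx1 !(mulmx0, mulmx1, addr0).
case: (split_ordP p) => i ->; case: (split_ordP q) => j ->.
- rewrite block_mxEul mul_dform !rowK /tok.
  by rewrite -![lshift _ _]/(unsplit (inl _)) !unsplitK /token_form addr0.
- rewrite block_mxEur mul_dform !rowK /tok -[lshift _ _]/(unsplit (inl _)).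
  by rewrite -[rshift _ _]/(unsplit (inr _)) !unsplitK /token_form addr0.
- rewrite block_mxEdl mul_dform !rowK /tok -[lshift _ _]/(unsplit (inl _)).
  by rewrite -[rshift _ _]/(unsplit (inr _)) !unsplitK /token_form addr0.
- rewrite block_mxEdr mxE mul_dform !rowK mxE /tok.
  by rewrite -![rshift _ _]/(unsplit (inr _)) !unsplitK.
Qed.

Lemma token_gramN i j : Q j i = - Q i j.
Proof.
case: (split_ordP i) => i' ->; case: (split_ordP j) => j' ->;
  rewrite /Q !(block_mxEul, block_mxEur, block_mxEdl, block_mxEdr) ?mxE ?oppr0//.
Qed.

Lemma pfl_tokenE : pfl token_form (map inl ws ++ map inr xs)
  = pfl (fun p q => (B *m Q *m B^T) p q) (enum 'I_(k + l)).
Proof. by rewrite -tok_enum pfl_map; apply: eq_pfl => p q; exact: tok_form. Qed.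

(** The jump tokens add [l] both to the rows and to the columns of [B], so the comparison is between
    [k] and [N]. *)
Lemma pfl_token_rank : (N < k)%N ->
  pfl token_form (map inl ws ++ map inr xs) = 0.
Proof. by move=> ?; rewrite pfl_tokenE pfl_congr_rank ?ltn_add2r//; exact: token_gramN. Qed.

End Factor.

(** With [N] vectors [B] is square and block lower triangular with an identity block, so the vectors
    [v x] disappear from its determinant. *)
Lemma pfl_token_top (ws : N.-tuple 'rV[F]_N) (xs : seq X) :
  pfl token_form (map inl ws ++ map inr xs)
  = \det (\matrix_i tnth ws i) * pfl (fun i j => D i j) (enum 'I_N) * pfl E xs.
Proof.
rewrite pfl_tokenE pfl_congr; last exact: token_gramN.
rewrite det_lblock det1 mulr1 -mulrA; congr (_ * _).
rewrite enum_ordD pfl_cat; last by move=> i j; rewrite block_mxEur mxE.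
rewrite (eq_pfl _ (fun i j => block_mxEul _ _ _ _ i j)); congr (_ * _).
rewrite (eq_pfl _ (fun i j => block_mxEdr _ _ _ _ i j)).
rewrite -[X in _ = pfl E X](map_tnth_enum (in_tuple xs)) pfl_map.
by apply: eq_pfl => i j; rewrite mxE.
Qed.

End TokenForm.

(** * The Pfaffian of a matrix of signs *)

Section SignPfaffian.
Variables (F : numFieldType) (R : realDomainType) (h : F).

Definition jump (x y : R) : F := h * (sgz (x - y))%:~R.

Fixpoint sgn_prod (s : seq R) : F :=
  if s is a :: s' then (\prod_(c <- s') (sgz (a - c))%:~R) * sgn_prod s' else 1.

Lemma jumpN x y : jump y x = - jump x y.
Proof. by rewrite /jump -opprB sgzN rmorphN mulrN. Qed.

Lemma eq_del_subseq (T : eqType) (g g' : T -> F) phi psi s :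
  {in s, g =1 g'} ->
  (forall t, subseq t s -> (size t).+1 = size s -> phi t = psi t) ->
  del g phi s = del g' psi s.
Proof.
elim: s phi psi => [//|b s IH] phi psi gg' e /=.
rewrite gg' ?mem_head// e ?subseq_cons//; congr (_ - _); apply: IH.
  by move=> c cs; apply: gg'; rewrite inE cs orbT.
by move=> t ts st; apply: e; rewrite /= ?eqxx ?st.
Qed.

Lemma del_const (T : Type) c d (s : seq T) :
  del (fun=> c) (fun=> d) s = (odd (size s))%:R * (c * d) :> F.
Proof.
elim: s => [|b s IH] /=; rewrite ?mul0r// IH.
by case: odd => /=; ring.
Qed.

(** All entries above the diagonal equal [h], and the alternating sum of an odd number of equal
    terms is a single term. *)
Lemma pfl_jump_sorted s : sorted (fun x y => y < x) s -> ~~ odd (size s) ->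
  pfl jump s = h ^+ (size s)./2.
Proof.
have gt_trans : transitive (fun x y : R => y < x).
  by move=> y x z yx zy; apply: lt_trans yx.
move: s {2}(size s) (leqnn (size s)) => s n.
elim/ltn_ind: n s => n IH [|a [|b s]]//=; rewrite pfl_cons.
move=> sn srt es.
have eo : odd (size s) = false by move: es; rewrite negbK => /negbTE.
have alla := @order_path_min _ _ a (b :: s) gt_trans srt.
rewrite (@eq_del_subseq _ _ (fun=> h) _ (fun=> h ^+ (size s)./2)).
- by rewrite del_const /= eo mul1r exprS.
- move=> c cs; rewrite /jump gtr0_sgz ?mulr1// subr_gt0.
  exact: (allP alla c cs).
move=> t ts /= [st]; rewrite (IH (size t))// ?st ?(leq_trans _ sn)//.
  by apply: (subseq_sorted gt_trans ts); exact: (@path_sorted _ _ a (b :: s) srt).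
by rewrite eo.
Qed.

Lemma sgn_prod_swap r a b s :
  sgn_prod (r ++ a :: b :: s) = - sgn_prod (r ++ b :: a :: s).
Proof.
elim: r => [|c r IH] /=.
  by rewrite !big_cons -[b - a]opprB sgzN rmorphN /=; ring.
by rewrite IH !big_cat !big_cons /=; ring.
Qed.

Lemma sgn_prod_sorted s : sorted (fun x y => y < x) s -> sgn_prod s = 1.
Proof.
elim: s => [//|a s IH] /= srt; rewrite IH ?(path_sorted srt)// mulr1.
rewrite big_seq big1// => c cs; rewrite gtr0_sgz// subr_gt0.
have gt_trans : transitive (fun x y : R => y < x).
  by move=> y x z yx zy; apply: lt_trans yx.
exact: (allP (order_path_min gt_trans srt) c cs).
Qed.

(* Both sides change sign under adjacent swaps, so sorting reduces the claim
   to strictly decreasing sequences. *)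
Lemma pfl_jump s : ~~ odd (size s) ->
  pfl jump s = h ^+ (size s)./2 * sgn_prod s.
Proof.
pose P t := pfl jump t = h ^+ (size t)./2 * sgn_prod t.
have swapP r a b t : P (r ++ a :: b :: t) -> P (r ++ b :: a :: t).
  rewrite /P (pfl_swap jumpN) (sgn_prod_swap r a b) mulrN !size_cat.
  exact: oppr_inj.
have move1P r a t u : P (r ++ a :: t ++ u) -> P (r ++ t ++ a :: u).
  elim: t r => [//|b t IH] r; rewrite cat_cons => /swapP.
  by rewrite -cat_rcons => /IH; rewrite cat_rcons.
have moveP r t u w : P (r ++ t ++ u ++ w) -> P (r ++ u ++ t ++ w).
  elim: t r => [//|a t IH] r; rewrite cat_cons -cat_rcons => /IH.
  by rewrite cat_rcons => /move1P.
have permP t u : perm_eq t u -> P t -> P u.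
  by apply: catCA_perm_ind => s1 s2 s3; exact: (moveP [::]).
move=> es; have [us|nus] := boolP (uniq s).
  have ps : perm_eq (sort (fun x y => y <= x) s) s by rewrite perm_sort.
  apply: (permP _ _ ps); rewrite /P size_sort.
  have srt : sorted (fun x y => y < x) (sort (fun x y => y <= x) s).
    have := @sort_sorted _ (fun x y : R => y <= x) (fun x y => le_total y x) s.
    have : uniq (sort (fun x y : R => y <= x) s) by rewrite sort_uniq.
    elim: (sort _ _) => [//|a [//|b t] IH] /andP[at_ ut] /andP[ba srt].
    apply/andP; split; last exact: IH.
    by rewrite lt_def ba andbT; apply: contraNneq at_ => ->; rewrite mem_head.
  by rewrite pfl_jump_sorted ?size_sort// sgn_prod_sorted ?mulr1.
have [a [t pt]] : exists a t, perm_eq [:: a, a & t] s.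
  elim: s nus {es} => [//|a s IH] /=; rewrite negb_and negbK.
  have [ais _|_ /IH[b [t bts]]] := boolP (a \in s).
    by exists a, (rem a s); rewrite perm_cons perm_sym perm_to_rem.
  exists b, (a :: t); rewrite -(perm_cons a) in bts; apply: perm_trans bts.
  by rewrite (perm_catCA [:: b; b] [:: a] t).
(* With a repeated entry the right side contains the sign of 0. On the left [jump a a] is 0, and
   what remains is a double contraction by [jump a], equal to its own opposite. *)
apply: (permP _ _ pt); rewrite /P /= big_cons subrr sgz0 !mul0r mulr0.
rewrite pfl_cons2 {1}/jump subrr sgz0 mulr0 mul0r sub0r.
apply/eqP; rewrite oppr_eq0.
have /eqP := del_anticomm (jump a) (jump a) (pfl jump) t.
by rewrite -addr_eq0 -mulr2n mulrn_eq0.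
Qed.

End SignPfaffian.

(** * The top-order Pfaffian *)

Section Vandermonde.
Variable A : comPzRingType.

Fixpoint vdm (s : seq A) : A :=
  if s is a :: s' then (\prod_(c <- s') (c - a)) * vdm s' else 1.

Lemma vdm_nth (s : seq A) :
  \prod_(i < size s) \prod_(j < size s | (i < j)%N) (s`_j - s`_i) = vdm s.
Proof.
elim: s => [|a s IH] /=; first by rewrite big_ord0.
rewrite big_ord_recl /= big_mkcond big_ord_recl /= mul1r -IH; congr (_ * _).
  by rewrite (big_nth 0) big_mkord.
apply: eq_bigr => i _; rewrite big_mkcond big_ord_recl /= mul1r.
by rewrite [RHS]big_mkcond; apply: eq_bigr => j _; rewrite ltnS.
Qed.

Lemma det_Vandermonde_seq (s : seq A) :
  \det (Vandermonde (size s) (\row_(i < size s) s`_i)) = vdm s.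
Proof.
rewrite det_Vandermonde -vdm_nth; apply: eq_bigr => i _.
by apply: eq_bigr => j _; rewrite !mxE.
Qed.

Lemma vdm_cat s t :
  vdm (s ++ t) = vdm s * vdm t * \prod_(a <- s) \prod_(c <- t) (c - a).
Proof.
elim: s => [|a s IH] /=; first by rewrite big_nil; ring.
by rewrite IH big_cat big_cons /=; ring.
Qed.

Lemma vdm_swap r a b s : vdm (r ++ a :: b :: s) = - vdm (r ++ b :: a :: s).
Proof.
elim: r => [|c r IH] /=; first by rewrite !big_cons; ring.
by rewrite IH !big_cat !big_cons /=; ring.
Qed.

Lemma det_scaled_powers N (L : N.-tuple (A * A)) :
  \det (\matrix_i (\row_(k < N) ((tnth L i).1 * (tnth L i).2 ^+ k)))
  = (\prod_(p <- L) p.1) * vdm [seq p.2 | p <- L].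
Proof.
have -> : (\matrix_i (\row_(k < N) ((tnth L i).1 * (tnth L i).2 ^+ k)))
    = diag_mx (\row_i (tnth L i).1)
      *m (Vandermonde N (\row_(i < N) [seq p.2 | p <- L]`_i))^T.
  apply/matrixP => i j; rewrite mul_diag_mx !mxE; congr (_ * _ ^+ _).
  by rewrite (nth_map (tnth L i)) ?size_tuple// -tnth_nth.
rewrite det_mulmx det_diag det_tr -det_Vandermonde_seq; congr (_ * _).
  rewrite big_tuple; apply: eq_bigr => i _; rewrite mxE //.
by rewrite size_map size_tuple.
Qed.

End Vandermonde.

(** * The phase of the Vandermonde product at real points and conjugate pairs *)

Section VandermondePhase.
Variable R : realType.
Local Notation C := R[i].
Local Notation conj_pairs zs := (flatten [seq [:: t; conjc t] | t <- zs]).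
Implicit Types (xs : seq R) (zs : seq C).

Let sgz_diff (a c : R) :
  (sgz (a - c))%:~R * (c%:C - a%:C) = - `|a - c|%:C :> C.
Proof.
have -> : (sgz (a - c))%:~R = (Num.sg (a - c))%:C :> C.
  by rewrite sgrEz rmorph_int.
rewrite normrEsg; apply/eqP; rewrite eq_complex /=; apply/andP; split; apply/eqP; ring.
Qed.

(** There is one factor [- |a - c|] for each pair of points, and the binomial sign compensates for
    the minus signs. *)
Let vdm_real_ge0 xs : 0 <= (-1) ^+ 'C(size xs, 2) * sgn_prod C xs
  * vdm [seq t%:C | t <- xs].
Proof.
elim: xs => [|a s IH] /=; first by rewrite !mul1r.
rewrite binS bin1 exprD.
have -> : (-1) ^+ size s = \prod_(c <- s) (-1) :> C.
  by rewrite big_const_seq count_predT; elim: (size s) => //= n <-; rewrite exprS.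
rewrite big_map; set p1 := \prod_(c <- s) -1; set p2 := \prod_(c <- s) _.
set p3 := \prod_(c <- s) _; set e := (-1) ^+ _.
have -> : e * p1 * (p2 * sgn_prod C s) * (p3 * vdm [seq t%:C | t <- s])
  = (p1 * (p2 * p3)) * (e * sgn_prod C s * vdm [seq t%:C | t <- s]) by ring.
apply: mulr_ge0 IH; rewrite -!big_split /=; apply: prodr_ge0 => c _.
by rewrite sgz_diff mulN1r opprK ler0c.
Qed.

(** The sign product has modulus 1 unless two points coincide, and then the Vandermonde product is
    0. *)
Let norm_sgn_vdm xs : `|sgn_prod C xs| * `|vdm [seq t%:C | t <- xs]|
  = `|vdm [seq t%:C | t <- xs]|.
Proof.
elim: xs => [|a s IH] /=; first by rewrite normr1 mulr1.
rewrite !normrM mulrACA IH; congr (_ * _).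
rewrite big_map !normr_prod -big_split /=; apply: eq_bigr => c _.
rewrite -normrM sgz_diff normrN distrC !normc_def /= subrr !expr0n /= !addr0.
by rewrite !sqrtr_sqr normr_id.
Qed.

Let pair_ge0 (y : C) (b : C) : b = conjc y -> 0 <= y * b.
Proof. by move=> ->; exact: mulcJ_ge0. Qed.

(** A pair contributes conj z - z = -2i Im z, which one factor ['i] makes nonnegative; the factors
    between different pairs group into numbers times their conjugates. *)
Let vdm_pairs_ge0 zs : all (fun z => 0 <= complex.Im z) zs ->
  0 <= 'i%C ^+ size zs * vdm (conj_pairs zs).
Proof.
elim: zs => [|z zs IH] /=; first by rewrite mul1r.
case/andP=> z0 /IH; rewrite big_cons exprS.
set p1 := \prod_(c <- _) _; set p2 := \prod_(c <- _) _ => H.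
have -> : 'i%C * 'i%C ^+ size zs * ((conjc z - z) * p1 * (p2 * vdm (conj_pairs zs)))
  = 'i%C * (conjc z - z) * (p1 * p2) * ('i%C ^+ size zs * vdm (conj_pairs zs)) :> C.
  by ring.
apply: mulr_ge0 H; apply: mulr_ge0.
  rewrite lecE; case: z z0 {p1 p2} => a b /= b0.
  by apply/andP; split; [apply/eqP; ring|lra].
rewrite /p1 /p2 -big_split /= big_flatten /= big_map; apply: prodr_ge0 => w _.
rewrite !big_cons !big_nil !mulr1.
have -> : (w - z) * (w - conjc z) * ((conjc w - z) * (conjc w - conjc z))
  = ((w - z) * (conjc w - conjc z)) * ((w - conjc z) * (conjc w - z)) by ring.
by apply: mulr_ge0; apply: pair_ge0; rewrite rmorphB//= conjcK.
Qed.

Let cross_ge0 xs zs :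
  0 <= \prod_(a <- [seq t%:C | t <- xs]) \prod_(c <- conj_pairs zs) (c - a).
Proof.
rewrite big_map; apply: prodr_ge0 => x _.
rewrite big_flatten /= big_map; apply: prodr_ge0 => w _.
rewrite !big_cons !big_nil !mulr1; apply: pair_ge0.
by rewrite rmorphB /= oppr0.
Qed.

(** The phases on the left are those that the top-order Pfaffian produces: the reordering of the
    real tokens, the sign Pfaffian, and the ['i] in each [v_cplx]. They turn the determinant into
    the modulus in [Omega]. *)
Lemma vdm_phase xs zs : all (fun z => 0 <= complex.Im z) zs ->
  (-1) ^+ 'C(size xs, 2) * sgn_prod C xs * 'i%C ^+ size zs
    * vdm (eigenvalues xs zs)
  = `|vdm (eigenvalues xs zs)|.
Proof.
move=> zs0; rewrite /eigenvalues.
set e := (-1) ^+ _; set V := vdm _; set s := sgn_prod C xs.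
have P : 0 <= e * s * 'i%C ^+ size zs * V.
  rewrite /V vdm_cat; set a := vdm _; set b := vdm _; set c := \prod_(_ <- _) _.
  have -> : e * s * 'i%C ^+ size zs * (a * b * c)
    = (e * s * a) * ('i%C ^+ size zs * b) * c by ring.
  apply: mulr_ge0 (cross_ge0 _ _); apply: mulr_ge0 (vdm_real_ge0 _) _.
  exact: vdm_pairs_ge0.
rewrite -[LHS](ger0_norm P) !normrM !normrX normrN1 complexiE normCi !expr1n mul1r mulr1.
by rewrite /V vdm_cat !normrM !mulrA norm_sgn_vdm.
Qed.

End VandermondePhase.

Section ComplexExp.
Variable R : realType.
Implicit Types (z w : R[i]) (x y : R).

Lemma conjcM z w : conjc (z * w) = conjc z * conjc w.
Proof. exact: rmorphM. Qed.

Lemma conjcX z n : conjc (z ^+ n) = conjc z ^+ n.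
Proof. exact: rmorphXn. Qed.

Lemma real_complexM x y : (x * y)%:C = x%:C * y%:C :> R[i].
Proof. exact: rmorphM. Qed.

Lemma cexpD z w : cexp (z + w) = cexp z * cexp w.
Proof.
case: z w => [a b] [c d]; rewrite /cexp /= expRD cosD sinD.
by apply/eqP; rewrite eq_complex /=; apply/andP; split; apply/eqP; ring.
Qed.

Lemma cexp_real x : cexp x%:C = (expR x)%:C.
Proof.
rewrite /cexp /= cos0 sin0.
by apply/eqP; rewrite eq_complex /=; apply/andP; split; apply/eqP; ring.
Qed.

Lemma cexpJ z : cexp (conjc z) = conjc (cexp z).
Proof.
case: z => a b; rewrite /cexp /= cosN sinN.
by apply/eqP; rewrite eq_complex /=; apply/andP; split; apply/eqP; ring.
Qed.

Lemma cexp_mulJ z : cexp z * conjc (cexp z) = (expR (2 * complex.Re z))%:C.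
Proof.
rewrite -cexpJ -cexpD -cexp_real; congr cexp.
by case: z => a b; apply/eqP; rewrite eq_complex /=; apply/andP; split; apply/eqP; ring.
Qed.

Lemma erfc_ge0 x : 0 <= erfc x.
Proof.
rewrite /erfc mulr_ge0 ?divr_ge0 ?sqrtr_ge0//.
by apply: Rintegral_ge0 => t _; exact: expR_ge0.
Qed.

End ComplexExp.

Section Tokens.
Variables (R : realType) (M : nat).
Local Notation C := R[i].
Local Notation N := (2 * M)%N.
Variable v : R -> 'rV[C]_N.

Definition pvec (c g : C) : 'rV[C]_N := \row_k (c * g ^+ k).

Definition half_weight (z : C) : C :=
  cexp (- z ^+ 2 / 2) * (Num.sqrt (erfcI z))%:C.

Definition u_real (x : R) : 'rV[C]_N := pvec (weightR x)%:C x%:C.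
Definition u_cplx (z : C) : 'rV[C]_N := pvec (half_weight z) z.
Definition v_cplx (z : C) : 'rV[C]_N :=
  pvec ('i%C * conjc (half_weight z)) (conjc z).

(* The inverse transpose of the Gram matrix of the monomials for the skew
   product of the real Ginibre ensemble. *)
Definition tri : 'M[C]_N :=
  \matrix_(k, j) ((Num.sqrt (2 * pi))^-1%:C *
    ((j == k.+1 :> nat)%:R / k`!%:R - (k == j.+1 :> nat)%:R / j`!%:R)).

Lemma triN k j : tri j k = - tri k j.
Proof. by rewrite !mxE; ring. Qed.

Definition tokens (xs : seq R) (zs : seq C) : seq (token C R N) :=
  flatten [seq [:: inl (u_real x); inr x] | x <- xs] ++
  flatten [seq [:: inl (u_cplx z); inl (v_cplx z)] | z <- zs].

Definition gform : token C R N -> token C R N -> C :=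
  token_form tri v (jump 2^-1).

Lemma gformN b c : gform c b = - gform b c.
Proof. exact: (token_formN v triN (@jumpN _ _ _)). Qed.

Lemma half_weight_sqr z : 0 <= complex.Im z ->
  half_weight z * conjc (half_weight z) = (weightC z)%:C.
Proof.
move=> z0; rewrite /half_weight conjcM conjc_real mulrACA cexp_mulJ.
rewrite -!real_complexM -expr2 sqr_sqrtr ?erfc_ge0// /weightC /erfcI (ger0_norm z0).
congr (expR _ * _)%:C.
by case: z {z0} => a b; rewrite /= !expr2 /=; field.
Qed.

Let uv_perm xs zs :
  pfl gform (tokens xs zs) = (-1) ^+ 'C(size xs, 2) * (-1) ^+ (size xs * (2 * size zs)) *
   pfl gform (map inl (map u_real xs ++ flatten [seq [:: u_cplx z; v_cplx z] | z <- zs])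
   ++ map inr xs).
Proof.
rewrite /tokens -[X in pfl _ X]cat0s.
rewrite (pfl_unzip gformN (fun x => inl (u_real x)) inr).
have := pfl_move gformN [seq inl (u_real x) | x <- xs] (map inr xs)
  (flatten [seq [:: inl (u_cplx z); inl (v_cplx z)] | z <- zs]) [::].
rewrite !cats0 cat0s => ->; rewrite mulrA.
congr (_ * _); first congr (_ * _); last congr pfl.
  rewrite size_map size_flatten /shape -map_comp; congr (_ ^+ (_ * _)).
  by elim: zs => //= z zs ->; rewrite mulnS.
rewrite map_cat -map_comp -catA; congr (_ ++ (_ ++ _)).
by elim: zs => //= z zs ->.
Qed.

Let scales xs zs : seq (C * C) := [seq ((weightR x)%:C, x%:C) | x <- xs] ++
  flatten [seq [:: (half_weight z, z); ('i%C * conjc (half_weight z), conjc z)] | z <- zs].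

Lemma size_pairs (T T' : Type) (f g : T -> T') (s : seq T) :
  size (flatten [seq [:: f x; g x] | x <- s]) = (2 * size s)%N.
Proof. by elim: s => //= x s ->; rewrite mulnS. Qed.

Lemma pfl_tokens_top xs zs : (size xs + 2 * size zs = N)%N ->
  all (fun z => 0 <= complex.Im z) zs ->
  2 ^+ M * pfl gform (tokens xs zs)
  = pfl (fun i j => tri i j) (enum 'I_N) * (Omega xs zs)%:C.
Proof.
move=> eN zs0; rewrite uv_perm.
have sL : size (scales xs zs) == N.
  by rewrite size_cat size_map size_pairs -eN.
pose L := Tuple sL.
have ex : odd (size xs) = false.
  by have /(congr1 odd) := eN; rewrite oddD !mul2n !odd_double addbF.
have -> : map u_real xs ++ flatten [seq [:: u_cplx z; v_cplx z] | z <- zs]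
    = [seq pvec p.1 p.2 | p <- L].
  rewrite /= map_cat -map_comp; congr (_ ++ _).
  by rewrite map_flatten -map_comp.
rewrite (pfl_token_top v triN (@jumpN _ _ _) (map_tuple _ L)) pfl_jump ?ex//.
have -> : \matrix_i tnth (map_tuple (fun p => pvec p.1 p.2) L) i
  = \matrix_i (\row_(k < N) ((tnth L i).1 * (tnth L i).2 ^+ k)).
  by apply/matrixP => i k; rewrite !mxE tnth_map mxE.
rewrite det_scaled_powers.
have -> : [seq p.2 | p <- L] = eigenvalues xs zs.
  rewrite /= map_cat -map_comp; congr (_ ++ _).
  by rewrite map_flatten -map_comp.
have -> : \prod_(p <- L) p.1 = (\prod_(t <- xs) weightR t)%:C *
    ('i%C ^+ size zs * (\prod_(t <- zs) weightC t)%:C).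
  rewrite big_cat big_map big_flatten /= big_map !rmorph_prod /=; congr (_ * _).
  elim: zs zs0 {eN sL L} => [|z zs IH] /= => [_|/andP[z0 /IH IHz]].
    by rewrite !big_nil mulr1.
  rewrite !big_cons big_nil mulr1 IHz.
  have -> : half_weight z * ('i%C * conjc (half_weight z)) = 'i%C * (weightC z)%:C.
    by rewrite mulrCA half_weight_sqr.
  by rewrite ['i%C ^+ _.+1]exprS mulrACA.
have vE : vdm_det (eigenvalues xs zs) = vdm (eigenvalues xs zs).
  exact: det_Vandermonde_seq.
rewrite /Omega vE.
rewrite !real_complexM.
have -> : (complex.Re `|vdm (eigenvalues xs zs)|)%:C = `|vdm (eigenvalues xs zs)|.
  by rewrite normc_def.
rewrite -(vdm_phase xs zs0).
have -> : (2 ^+ size zs)%:C = 2 ^+ size zs :> C by rewrite rmorphXn rmorph_nat.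
have -> : (-1) ^+ (size xs * (2 * size zs)) = 1 :> C.
  by rewrite mulnCA exprM sqrrN !expr1n.
(* The first factor is the power of 2 in [Omega]; the second clears the constants 1/2 of the sign
   Pfaffian. *)
have -> : 2 ^+ M = 2 ^+ size zs * 2 ^+ (size xs)./2 :> C.
  rewrite -exprD; congr (_ ^+ _); apply: (@double_inj).
  by rewrite doubleD -2!mul2n -eN addnC -[in LHS](odd_double_half (size xs)) ex.
have e2 : 2 ^+ (size xs)./2 * 2^-1 ^+ (size xs)./2 = 1 :> C.
  by rewrite -exprMn divff ?expr1n// pnatr_eq0.
rewrite mulr1 -[RHS]mul1r -[X in _ = X * _]e2.
set sg := sgn_prod _ _; set V := vdm _; set P := pfl _ _; ring.
Qed.

Lemma tri_pfl_neq0 : pfl (fun i j => tri i j) (enum 'I_N) != 0.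
Proof.
pose d (k j : nat) : C := (Num.sqrt (2 * pi))^-1%:C *
    ((j == k.+1 :> nat)%:R / k`!%:R - (k == j.+1 :> nat)%:R / j`!%:R).
have -> : pfl (fun i j => tri i j) (enum 'I_N) = pfl d (iota 0 N).
  by rewrite -val_enum_ord pfl_map; apply: eq_pfl => i j; rewrite mxE.
(* The start [a] is generalized: in a tridiagonal form the head can only be matched with its
   successor, and removing both leaves a list of the same kind. *)
suff H m a : pfl d (iota a (2 * m)) != 0 by exact: H.
elim: m a => [|m IH] a; first exact: oner_neq0.
rewrite mulnS [iota _ _]/= pfl_cons2 (@eq_del_subseq _ _ _ (fun=> 0) _ (del (d a.+1) (pfl d)))//.
  have a2 : (a == a.+2) = false by apply/negbTE; rewrite neq_ltn ltnS leqnSn.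
  rewrite del0 subr0 mulf_neq0// /d eqxx a2 mul0r subr0.
  rewrite !mulf_neq0 ?oner_neq0// ?invr_eq0 ?pnatr_eq0 -?lt0n ?fact_gt0//.
  rewrite eq_complex /= negb_and invr_eq0 sqrtr_eq0 -ltNge.
  by rewrite mulr_gt0 ?pi_gt0.
move=> j; rewrite mem_iota => /andP[aj _]; rewrite /d.
have -> : (j == a.+1) = false by apply/negbTE; rewrite neq_ltn aj orbT.
have -> : (a == j.+1) = false.
  by apply/negbTE; rewrite neq_ltn ltnS ltnW// ltnW.
by rewrite !mul0r subrr mulr0.
Qed.

Lemma pfl_tokens_rank xs zs : (N < size xs + 2 * size zs)%N ->
  pfl gform (tokens xs zs) = 0.
Proof.
move=> ltN; rewrite uv_perm.
set ws := map u_real xs ++ _.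
have sws : size ws == (size xs + 2 * size zs)%N.
  by rewrite size_cat size_map size_pairs.
by rewrite (@pfl_token_rank _ _ _ tri v _ triN (@jumpN _ _ _) _ (Tuple sws))// mulr0.
Qed.

End Tokens.

(** * Integrating out one eigenvalue *)

Section LinearIntegral.
Variables (R : realType) (X : Type).

(* [I g r] reads: [g] is integrable, with integral [r]. *)
Record linear_integral (I : (X -> R) -> R -> Prop) : Prop := LinearIntegral {
  linear_integral0 : I (fun=> 0) 0;
  linear_integral_lin : forall a g h r s,
    I g r -> I h s -> I (fun x => a * g x + h x) (a * r + s);
  linear_integral_ext : forall g h r, g =1 h -> I g r -> I h r }.

Variable I : (X -> R) -> R -> Prop.
Hypothesis hI : linear_integral I.
Local Notation C := R[i].

Definition cI (g : X -> C) (c : C) : Prop :=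
  I (fun x => complex.Re (g x)) (complex.Re c)
  /\ I (fun x => complex.Im (g x)) (complex.Im c).

Lemma cI_ext g h c : g =1 h -> cI g c -> cI h c.
Proof.
move=> e [re im]; split.
  by apply: (linear_integral_ext hI) re => x /=; rewrite e.
by apply: (linear_integral_ext hI) im => x /=; rewrite e.
Qed.

Lemma cI0 : cI (fun=> 0) 0.
Proof. by split; exact: (linear_integral0 hI). Qed.

Lemma cI_lin a g h c d : cI g c -> cI h d -> cI (fun x => a * g x + h x) (a * c + d).
Proof.
case: a c d => [a1 a2] [c1 c2] [d1 d2] [/= rg ig] [/= rh ih]; split => /=.
  have := linear_integral_lin hI a1 rg (linear_integral_lin hI (- a2) ig rh).
  rewrite mulNr addrA; apply: (linear_integral_ext hI) => x.
  by case: (g x) (h x) => [? ?] [? ?] /=; rewrite mulNr addrA.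
have := linear_integral_lin hI a1 ig (linear_integral_lin hI a2 rg ih).
rewrite addrA; apply: (linear_integral_ext hI) => x.
by case: (g x) (h x) => [? ?] [? ?] /=; rewrite addrA.
Qed.

Lemma cIZ a g c : cI g c -> cI (fun x => a * g x) (a * c).
Proof.
move=> gc; have := cI_lin a gc cI0; rewrite addr0.
by apply: cI_ext => x; rewrite addr0.
Qed.

Lemma cID g h c d : cI g c -> cI h d -> cI (fun x => g x + h x) (c + d).
Proof.
move=> gc hd; have := cI_lin 1 gc hd; rewrite mul1r.
by apply: cI_ext => x; rewrite mul1r.
Qed.

Lemma cIB g h c d : cI g c -> cI h d -> cI (fun x => g x - h x) (c - d).
Proof.
move=> gc hd; have := cI_lin (-1) hd gc; rewrite mulN1r addrC.
by apply: cI_ext => x; rewrite mulN1r addrC.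
Qed.

Lemma cI_sum (J : Type) (r : seq J) (g : J -> X -> C) c :
  (forall j, cI (g j) (c j)) ->
  cI (fun x => \sum_(j <- r) g j x) (\sum_(j <- r) c j).
Proof.
move=> gc; elim: r => [|j r IH].
  by rewrite big_nil; apply: cI_ext cI0 => x; rewrite big_nil.
by rewrite big_cons; apply: cI_ext (cID (gc j) IH) => x; rewrite big_cons.
Qed.

Lemma cI_real g r : I g r -> cI (fun x => (g x)%:C) r%:C.
Proof. by move=> gr; split => //=; exact: (linear_integral0 hI). Qed.

Lemma cI_del (T : Type) (g : X -> T -> C) G phi s :
  (forall b, cI (g^~ b) (G b)) -> cI (fun x => del (g x) phi s) (del G phi s).
Proof.
move=> gG; elim: s phi => [|b s IH] phi /=; first exact: cI0.
apply: cIB (IH _); rewrite mulrC.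
by apply: cI_ext (cIZ (phi s) (gG b)) => x; rewrite mulrC.
Qed.

Lemma cI_del2 (T : Type) (w : X -> T -> T -> C) W phi s :
  (forall b c, cI (fun x => w x b c) (W b c)) ->
  cI (fun x => del2 (w x) phi s) (del2 W phi s).
Proof.
move=> wW; elim: s phi => [|b s IH] phi /=; first exact: cI0.
by apply: cID (IH _); apply: cI_del => c; exact: wW.
Qed.

End LinearIntegral.

Section IntegrateOut.
Variables (R : realType) (M : nat).
Local Notation C := R[i].
Local Notation N := (2 * M)%N.
Variables (I1 : (R -> R) -> R -> Prop) (I2 : (C -> R) -> R -> Prop).
Hypotheses (hI1 : linear_integral I1) (hI2 : linear_integral I2).
Variables (uR vR : nat -> R -> R) (W : nat -> nat -> C -> R).
Variables (H1 H2 : nat -> nat -> R).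
Local Notation v := (fun x => \row_(k < N) (vR k x)%:C).
Local Notation D := (tri R M).
Local Notation f := (gform v).
Hypothesis u_realE : forall x k, u_real M x 0 k = (uR k x)%:C.
Hypothesis uvW : forall z p q, u_cplx M z 0 p * v_cplx M z 0 q
  - v_cplx M z 0 p * u_cplx M z 0 q = (W p q z)%:C.
Hypothesis I1_uv : forall p q : 'I_N,
  I1 (fun t => uR p t * vR q t - vR p t * uR q t) (H1 p q).
Hypothesis I1_jump : forall (p : 'I_N) x,
  I1 (fun t => uR p t * (Num.sg (t - x) / 2)) (vR p x).
Hypothesis I2_W : forall p q : 'I_N, I2 (fun z => W p q (upper z)) (H2 p q).
Hypothesis Gram : forall p k : 'I_N,
  \sum_(q < N) (H1 p q + H2 p q)%:C * D k q = (2 * (p == k)%:R).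

Definition dual (a : 'rV[C]_N) (p : 'I_N) : C := \sum_j D p j * a 0 j.

Let dform_dual (a b : 'rV[C]_N) : dform D a b = \sum_p a 0 p * dual b p.
Proof.
rewrite dformE; apply: eq_bigr => p _; rewrite mulr_sumr.
by apply: eq_bigr => j _; rewrite mulrA.
Qed.

Let pairing (H : nat -> nat -> R) (a b : 'rV[C]_N) : C :=
  \sum_(p < N) \sum_(q < N) dual a p * dual b q * (H p q)%:C.

Let trace (H : nat -> nat -> R) : C :=
  \sum_(p < N) \sum_(q < N) D p q / 2 * (H p q)%:C.

Let dform_dform (a b x y : 'rV[C]_N) : dform D x a * dform D y b - dform D y a * dform D x b
  = \sum_p \sum_q dual a p * dual b q * (x 0 p * y 0 q - y 0 p * x 0 q).
Proof.
rewrite !dform_dual; move: (dual a) (dual b) => da db.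
rewrite !big_distrl /= -sumrB; apply: eq_bigr => p _.
by rewrite !big_distrr /= -sumrB; apply: eq_bigr => q _; ring.
Qed.

Let dform_half (x y : 'rV[C]_N) : dform D x y
  = \sum_(p < N) \sum_(q < N) D p q / 2 * (x 0 p * y 0 q - y 0 p * x 0 q).
Proof.
have two : (2 : C) != 0 by rewrite pnatr_eq0.
apply: (mulfI two); rewrite mulr2n mulrDl mul1r {2}dformN; last exact: triN.
rewrite !dformE -sumrB mulr_sumr; apply: eq_bigr => p _.
by rewrite -sumrB mulr_sumr; apply: eq_bigr => q _; field.
Qed.

Let is_jump (b : token C R N) : C := if b is inr _ then 1 else 0.

Let w1 t b c := f (inl (u_real M t)) b * f (inr t) c
  - f (inr t) b * f (inl (u_real M t)) c.

Let v_realE x k : v x 0 k = (vR k x)%:C. Proof. by rewrite mxE. Qed.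

(** By [I1_jump] the jump part of [inr t], integrated against u, returns the vector of the jump
    token it meets; so [dform] is subtracted once for each of [b], [c] that is a jump token. *)
Let cI_w1 b c : cI I1 (fun t => w1 t b c)
  (pairing H1 (token_vec v b) (token_vec v c)
   - (is_jump b + is_jump c) * dform D (token_vec v b) (token_vec v c)).
Proof.
set a := token_vec v b; set a' := token_vec v c.
have sk t b' c' : dform D (u_real M t) b' * dform D (v t) c' -
   dform D (v t) b' * dform D (u_real M t) c' = \sum_(p < N) \sum_(q < N) dual b' p * dual c' q *
   (uR p t * vR q t - vR p t * uR q t)%:C.
  rewrite dform_dform; apply: eq_bigr => p _; apply: eq_bigr => q _.
  by rewrite !u_realE !v_realE rmorphB !rmorphM.
have cIJ b' c' : cI I1 (fun t => dform D (u_real M t) b' * token_jump (@jump C R 2^-1) (inr t) c')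
    (is_jump c' * dform D (token_vec v c') b').
  case: c' => [c'|x] /=.
    by rewrite mul0r; apply: (cI_ext hI1) (cI0 hI1) => t; rewrite mulr0.
  rewrite mul1r dform_dual.
  have := cI_sum hI1 (index_enum 'I_N) (fun p => cIZ hI1 (dual b' p)
      (cI_real hI1 (I1_jump p x))).
  under [X in cI _ _ X]eq_bigr do rewrite mulrC -v_realE.
  apply: (cI_ext hI1) => t; rewrite dform_dual mulr_suml; apply: eq_bigr => p _.
  rewrite u_realE rmorphM /= mulrA [dual _ _ * _]mulrC; congr (_ * _).
  by rewrite /jump sgrEz rmorphM /= rmorph_int fmorphV rmorph_nat mulrC.
have h := cIB hI1 (cID hI1 (cI_sum hI1 (index_enum 'I_N) (fun p => cI_sum hI1 (index_enum 'I_N)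
  (fun q => cIZ hI1 (dual a p * dual a' q) (cI_real hI1 (I1_uv p q)))))
  (cIJ a c)) (cIJ a' b).
have -> : pairing H1 a a' - (is_jump b + is_jump c) * dform D a a'
  = pairing H1 a a' + is_jump c * dform D a' a - is_jump b * dform D a a'.
  by rewrite [dform D a' a]dformN; [ring|exact: triN].
apply: (cI_ext hI1) h => t.
have fu b' : f (inl (u_real M t)) b' = dform D (u_real M t) (token_vec v b').
  by rewrite /gform /token_form addr0.
have fv b' : f (inr t) b' = dform D (v t) (token_vec v b')
  + token_jump (@jump C R 2^-1) (inr t) b' by [].
rewrite /w1 !fu !fv -sk -/a -/a'.
move: (token_jump _ _ _) (token_jump _ _ _) => j1 j2.
move: (dform _ _ a) (dform _ _ a') => x x'.
by move: (dform _ _ a) (dform _ _ a') => y y'; ring.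
Qed.

Let cI_w2 b c : cI I2 (fun z => f (inl (u_cplx M (upper z))) b * f (inl (v_cplx M (upper z))) c
    - f (inl (v_cplx M (upper z))) b * f (inl (u_cplx M (upper z))) c)
  (pairing H2 (token_vec v b) (token_vec v c)).
Proof.
set a := token_vec v b; set a' := token_vec v c.
have h := cI_sum hI2 (index_enum 'I_N) (fun p => cI_sum hI2 (index_enum 'I_N)
  (fun q => cIZ hI2 (dual a p * dual a' q) (cI_real hI2 (I2_W p q)))).
apply: (cI_ext hI2) h => z.
rewrite /gform /token_form !addr0 -/a -/a' dform_dform.
by apply: eq_bigr => p _; apply: eq_bigr => q _; rewrite uvW.
Qed.

Let cI_trace1 : cI I1 (fun t => f (inl (u_real M t)) (inr t)) (trace H1).
Proof.
have h := cI_sum hI1 (index_enum 'I_N) (fun p => cI_sum hI1 (index_enum 'I_N)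
  (fun q => cIZ hI1 (D p q / 2) (cI_real hI1 (I1_uv p q)))).
apply: (cI_ext hI1) h => t.
rewrite /gform /token_form addr0 dform_half.
apply: eq_bigr => p _; apply: eq_bigr => q _.
by rewrite !u_realE !v_realE rmorphB !rmorphM.
Qed.

Let cI_trace2 : cI I2 (fun z => f (inl (u_cplx M (upper z))) (inl (v_cplx M (upper z))))
  (trace H2).
Proof.
have h := cI_sum hI2 (index_enum 'I_N) (fun p => cI_sum hI2 (index_enum 'I_N)
  (fun q => cIZ hI2 (D p q / 2) (cI_real hI2 (I2_W p q)))).
apply: (cI_ext hI2) h => z.
rewrite /gform /token_form addr0 dform_half.
by apply: eq_bigr => p _; apply: eq_bigr => q _; rewrite uvW.
Qed.

(** The number of vector tokens: a real point counts once, a complex point twice. *)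
Definition tokens_weight (ws : seq (token C R N)) : C :=
  \sum_(b <- ws) (if b is inl _ then 1 else 0).

Let Gram_form a b : pairing H1 a b + pairing H2 a b = 2 * dform D a b.
Proof.
rewrite /pairing -big_split /=.
under eq_bigr do rewrite -big_split /=.
under eq_bigr do under eq_bigr do rewrite -mulrDr -rmorphD /= -mulrA.
under eq_bigr do rewrite -mulr_sumr.
have e (p : 'I_N) : \sum_(q < N) dual b q * (H1 p q + H2 p q)%:C = - 2 * b 0 p.
  rewrite /dual; under eq_bigr do rewrite mulr_suml.
  rewrite exchange_big /= (bigD1 p) //= [X in _ + X]big1 ?addr0 => [|j jp].
    rewrite (eq_bigr (fun q : 'I_N => - b 0 p * ((H1 p q + H2 p q)%:C * D p q))).
      by rewrite -mulr_sumr Gram eqxx /=; ring.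
    by move=> q _; rewrite (triN _ p q); ring.
  rewrite (eq_bigr (fun q : 'I_N => - b 0 j * ((H1 p q + H2 p q)%:C * D j q))).
    by rewrite -mulr_sumr Gram eq_sym (negbTE jp) !mulr0.
  by move=> q _; rewrite (triN _ j q); ring.
under eq_bigr do rewrite e.
rewrite dformN; last exact: triN.
rewrite dform_dual mulrN -mulNr mulr_sumr; apply: eq_bigr => p _; ring.
Qed.

Let Gram_trace : trace H1 + trace H2 = N%:R.
Proof.
rewrite /trace -big_split /=.
under eq_bigr do rewrite -big_split /=.
rewrite (eq_bigr (fun=> 1)); first by rewrite sumr_const card_ord.
move=> p _; have two : (2 : C) != 0 by rewrite pnatr_eq0.
apply: (mulfI two); rewrite mulr1 -[RHS]mulr1.
have := Gram p p; rewrite eqxx => <-; rewrite mulr_sumr; apply: eq_bigr => q _.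
by rewrite rmorphD /=; field.
Qed.

(** Expanding along both new entries gives [f u v * pfl f ws] minus a [del2] of 2x2 minors. The two
    traces add up to N; the minors integrate to [2 * dform] less the jump corrections, that is to
    the weighted form of Euler's identity. *)
Lemma integrate_out ws : exists c1 c2,
  [/\ cI I1 (fun t => pfl f (inl (u_real M t) :: inr t :: ws)) c1,
      cI I2 (fun z => pfl f (inl (u_cplx M (upper z)) :: inl (v_cplx M (upper z)) :: ws)) c2
    & c1 + c2 = (N%:R - tokens_weight ws) * pfl f ws].
Proof.
eexists; eexists; split.
- apply: (cI_ext hI1) (cIB hI1 (cIZ hI1 (pfl f ws) cI_trace1)
    (cI_del2 hI1 (pfl f) ws cI_w1)) => t.
  by rewrite pfl_cons2 del_del mulrC.
- apply: (cI_ext hI2) (cIB hI2 (cIZ hI2 (pfl f ws) cI_trace2)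
    (cI_del2 hI2 (pfl f) ws cI_w2)) => z.
  by rewrite pfl_cons2 del_del mulrC.
pose d (b : token C R N) : C := if b is inl _ then 1 else 0.
rewrite addrACA -opprD -mulrDr Gram_trace mulrC mulrBl; congr (_ - _).
rewrite -(pfl_weight d) -[X in X + _]mul1r -del2l_lin; apply: eq_del2l => b c.
set a := token_vec v b; set a' := token_vec v c.
rewrite mul1r addrAC Gram_form /gform /token_form -/a -/a' /d /a /a'.
(* Two jump tokens have total weight 0, which removes their jump entry; for any other pair the jump
   is 0 anyway. *)
by case: b {a} => b; case: c {a'} => c /=; ring.
Qed.

End IntegrateOut.

(** * Gaussian integrals on the line *)

Section HalfLines.
Variable R : realType.
Local Notation mu := (@lebesgue_measure R).
Implicit Types (f g F : R -> R) (a A B K : R).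

Lemma integrable_oneDsqrV : mu.-integrable [set: R] (EFin \o (fun x => (oneDsqr x)^-1)).
Proof.
have mf : measurable_fun [set: R] (fun x : R => (oneDsqr x)^-1).
  by apply: continuous_measurable_fun; exact: continuous_oneDsqrV.
apply/integrableP; split; first exact/measurable_EFinP.
have f0 (x : R) : 0 <= (oneDsqr x)^-1.
  by rewrite invr_ge0 (le_trans _ (oneDsqr_ge1 x)).
under eq_integral do rewrite /= ger0_norm//.
rewrite ge0_symfun_integralT//; last 2 first.
- exact: continuous_oneDsqrV.
- by move=> x; rewrite /= /oneDsqr sqrrN.
rewrite (_ : [set x | _] = `[0, +oo[%classic) ?integral0y_oneDsqr ?ltry//.
by apply/seteqP; split => x/=; rewrite in_itv/= andbT.
Qed.

(** Domination by K / (1 + x^2), chosen because it is integrable and has the bounded primitive K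
    atan x. *)
Definition decays f K := forall x, `|f x| * oneDsqr x <= K.

Lemma is_derive_continuous F (x df : R) : is_derive x 1 F df -> {for x, continuous F}.
Proof. by move=> dF; apply/differentiable_continuous/derivable1_diffP; case: dF. Qed.

Lemma integrable_subset (D : set R) f : measurable D ->
  mu.-integrable [set: R] (EFin \o f) -> mu.-integrable D (EFin \o f).
Proof. by move=> mD; apply: integrableS. Qed.

Let maj K x := K * (oneDsqr x)^-1.

Let cg K : continuous (maj K).
Proof. by move=> x; apply: cvgM; [exact: cvg_cst|exact: continuous_oneDsqrV]. Qed.

Let g_ge0 K x : 0 <= K -> 0 <= maj K x.
Proof. by move=> K0; rewrite mulr_ge0// invr_ge0 (le_trans _ (oneDsqr_ge1 x)). Qed.

Let integrable_g K D : measurable D -> mu.-integrable D (EFin \o maj K).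
Proof. by move=> mD; apply: integrable_subset => //; exact: integrableZl integrable_oneDsqrV. Qed.

Let decays_on (D : set R) f K := forall x, D x -> `|f x| * oneDsqr x <= K.

Let decays_on_g D f K x : decays_on D f K -> D x ->
  [/\ 0 <= K, `|f x| <= maj K x & 0 <= f x + maj K x].
Proof.
move=> fK Dx; have le : `|f x| <= maj K x.
  by rewrite ler_pdivlMr ?fK// (lt_le_trans _ (oneDsqr_ge1 x)).
split=> //; first by apply: le_trans (fK x Dx); rewrite mulr_ge0// (le_trans _ (oneDsqr_ge1 x)).
by move: le; rewrite ler_norml => /andP[+ _]; rewrite -subr_ge0 opprK.
Qed.

Lemma integrable_on (D : set R) f K : measurable D -> measurable_fun [set: R] f ->
  (forall x, D x -> `|f x| * oneDsqr x <= K) -> mu.-integrable D (EFin \o f).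
Proof.
move=> mD mf fK; apply: (@le_integrable _ _ _ mu D mD (EFin \o f) (EFin \o maj K)) => //;
  last exact: integrable_g.
  by apply/measurable_EFinP; exact: measurable_funS mf.
move=> x Dx; rewrite /= lee_fin; have [_ le _] := decays_on_g fK Dx.
by rewrite (le_trans le)// ler_norm.
Qed.

(** The fundamental theorem on a half-line is applied to nonnegative integrands only: to the
    majorant [maj K], with primitive [K * atan x], and to [f] plus this majorant. The difference
    gives the claim. *)
Lemma FTC_right F f K a A : (forall x : R, is_derive x 1 F (f x)) ->
  continuous f -> (forall x, a <= x -> `|f x| * oneDsqr x <= K) ->
  F x @[x --> +oo] --> A -> \int[mu]_(x in `[a, +oo[) f x = A - F a.
Proof.
move=> dF cf fK FA.
have fK' : decays_on `[a, +oo[ f K by move=> x /=; rewrite in_itv /= andbT; exact: fK.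
have aa : `[a, +oo[%classic a by rewrite /= in_itv /= lexx.
have [K0 _ _] := decays_on_g fK' aa.
have ge0_FTC (h H : R -> R) B : (forall x, a <= x -> 0 <= h x) -> continuous h ->
    (forall x : R, is_derive x 1 H (h x)) -> H x @[x --> +oo] --> B ->
    \int[mu]_(x in `[a, +oo[) h x = B - H a.
  move=> h0 ch dH HA; apply: Rintegral_ge0_continuous_FTC2y => //.
  - exact: continuous_subspaceT.
  - by apply: cvg_at_right_filter; exact: is_derive_continuous (dH a).
  - by move=> x _; rewrite derive1E; case: (dH x).
pose G x := K * atan x.
have dG (x : R) : is_derive x 1 G (maj K x) by apply: is_deriveZ.
have eg : \int[mu]_(x in `[a, +oo[) maj K x = K * (pi / 2) - G a.
  apply: ge0_FTC => //; first by move=> x _; exact: g_ge0.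
  by apply: cvgMr; exact: cvgy_atan.
have efg : \int[mu]_(x in `[a, +oo[) (f x + maj K x) = (A + K * (pi / 2)) - (F a + G a).
  apply: (ge0_FTC (fun x => f x + maj K x) (fun x => F x + G x)).
  - by move=> x ax; have [|//] := decays_on_g (x := x) fK'; rewrite /= in_itv /= ax.
  - by move=> x; apply: cvgD; [exact: cf|exact: cg].
  - by apply: cvgD => //; apply: cvgMr; exact: cvgy_atan.
move: efg; rewrite RintegralD//; first by rewrite eg; lra.
- by apply: integrable_on fK' => //; exact: continuous_measurable_fun.
- exact: integrable_g.
Qed.

Lemma reflect_integral f K a : continuous f ->
  (forall x, x <= a -> `|f x| * oneDsqr x <= K) ->
  \int[mu]_(x in `]-oo, a]) f x = \int[mu]_(x in `[- a, +oo[) f (- x).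
Proof.
move=> cf fK.
have fK' : decays_on `]-oo, a] f K by move=> x /=; rewrite in_itv /=; exact: fK.
have aa : `]-oo, a]%classic a by rewrite /= in_itv /= lexx.
have [K0 _ _] := decays_on_g fK' aa.
have E (h : R -> R) : (forall x, x <= a -> 0 <= h x) -> continuous h ->
    \int[mu]_(x in `]-oo, a]) h x = \int[mu]_(x in `[- a, +oo[) h (- x).
  move=> h0 ch; rewrite /Rintegral; congr fine.
  have := @ge0_integration_by_substitutionNy _ h (- a); rewrite opprK; apply => //.
    exact: continuous_subspaceT.
  by move=> x; rewrite in_itv /= => /ltW; exact: h0.
have mN (h : R -> R) : continuous h -> continuous (fun x => h (- x)).
  by move=> ch x; apply: continuous_comp; [exact: opp_continuous|exact: ch].
have iN (h : R -> R) L : continuous h -> (forall x, x <= a -> `|h x| * oneDsqr x <= L) ->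
    mu.-integrable `[- a, +oo[ (EFin \o (fun x => h (- x))).
  move=> ch hK; apply: (@integrable_on _ _ L) => //.
    exact: continuous_measurable_fun (mN h ch).
  move=> x; rewrite /= in_itv /= andbT lerNl => /hK.
  by rewrite /oneDsqr sqrrN.
have gK x : x <= a -> `|maj K x| * oneDsqr x <= K.
  move=> _; rewrite /maj ger0_norm; last exact: g_ge0.
  by rewrite mulfVK// gt_eqF// (lt_le_trans _ (oneDsqr_ge1 x)).
have eg := E (maj K) (fun x _ => g_ge0 x K0) (@cg K).
have := E (fun x => f x + maj K x); rewrite !RintegralD//.
- rewrite eg => efg; apply: (addIr _ (efg _ _)).
    by move=> x ax; have [|//] := decays_on_g (x := x) fK'; rewrite /= in_itv.
  by move=> x; apply: cvgD; [exact: cf|exact: cg].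
- exact: iN fK.
- exact: iN gK.
- by apply: integrable_on fK' => //; exact: continuous_measurable_fun.
- exact: integrable_g.
Qed.

Lemma FTC_left F f K a B : (forall x : R, is_derive x 1 F (f x)) ->
  continuous f -> (forall x, x <= a -> `|f x| * oneDsqr x <= K) ->
  F x @[x --> -oo] --> B -> \int[mu]_(x in `]-oo, a]) f x = F a - B.
Proof.
move=> dF cf fK FB; rewrite (reflect_integral cf fK).
have -> : F a - B = - B - - F (- - a) by rewrite !opprK addrC.
apply: (@FTC_right (fun x => - F (- x)) (fun x => f (- x)) K).
- move=> x; have dN : is_derive x 1 (-%R : R -> R) (-1).
    exact: is_deriveN.
  have := is_deriveN (is_derive1_comp (dF (- x)) dN).
  by rewrite mulrN1 opprK.
- by move=> x; apply: continuous_comp; [exact: opp_continuous|exact: cf].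
- by move=> x; rewrite lerNl => /fK; rewrite /oneDsqr sqrrN.
- by apply: cvgN; exact/cvgNy_compNP.
Qed.

Lemma decays_integrable f K : measurable_fun [set: R] f -> decays f K ->
  mu.-integrable [set: R] (EFin \o f).
Proof. by move=> mf fK; apply: (@integrable_on _ _ K). Qed.

Definition realI f (r : R) : Prop :=
  mu.-integrable [set: R] (EFin \o f) /\ \int[mu]_x f x = r.

Lemma realI_linear : linear_integral realI.
Proof.
split.
- by split; [exact: integrable0|rewrite /Rintegral integral0].
- move=> a f g r s [if_ fr] [ig gs]; split.
    exact: (integrableD measurableT (integrableZl measurableT a if_) ig).
  rewrite RintegralD//; last exact: (integrableZl measurableT a if_).
  by rewrite RintegralZl// fr gs.
- move=> f g r fg [if_ fr]; split.
    by apply: eq_integrable if_ => // x _; rewrite /= fg.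
  by rewrite -fr; apply: eq_Rintegral => x _; rewrite fg.
Qed.

Lemma realI_split h h1 h2 a : mu.-integrable [set: R] (EFin \o h) ->
  (forall x, x < a -> h x = h1 x) -> (forall x, a < x -> h x = h2 x) ->
  realI h (\int[mu]_(x in `]-oo, a]) h1 x + \int[mu]_(x in `[a, +oo[) h2 x).
Proof.
move=> ih hh1 hh2; split=> //.
have e : [set: R] = `]-oo, a] `|` `]a, +oo[.
  by rewrite -setCitvl setUv.
rewrite e Rintegral_setU//; last 2 first.
- by rewrite -e.
- by rewrite -setCitvl; apply/disj_setPCl.
have ihl := integrable_subset (measurable_itv `]-oo, a[) ih.
have ihr := integrable_subset (measurable_itv `]a, +oo[) ih.
have el : {in `]-oo, a[%classic, h =1 h1}.
  by move=> x; rewrite inE /= in_itv /= => /hh1.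
have er : {in `]a, +oo[%classic, h =1 h2}.
  by move=> x; rewrite inE /= in_itv /= andbT => /hh2.
congr (_ + _).
  rewrite -!Rintegral_itv_bndo_bndc//; first exact: eq_Rintegral.
  by apply: eq_integrable ihl => // x /el; rewrite /= => ->.
rewrite -Rintegral_itv_obnd_cbnd; first exact: eq_Rintegral.
by apply: eq_integrable ihr => // x /er; rewrite /= => ->.
Qed.

Lemma FTC_line F f K A B : (forall x : R, is_derive x 1 F (f x)) ->
  continuous f -> decays f K -> F x @[x --> +oo] --> A -> F x @[x --> -oo] --> B ->
  realI f (A - B).
Proof.
move=> dF cf fK FA FB.
have if_ := decays_integrable (continuous_measurable_fun cf) fK.
have := @realI_split f f f 0 if_ (fun _ _ => erefl) (fun _ _ => erefl).
rewrite (FTC_left dF cf (fun x _ => fK x) FB) (FTC_right dF cf (fun x _ => fK x) FA).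
by rewrite addrC addrA subrK.
Qed.

Lemma measurable_sg y : measurable_fun [set: R] (fun x : R => Num.sg (x - y)).
Proof.
have -> : (fun x => Num.sg (x - y)) =
    (fun x => \1_(`]y, +oo[%classic) x - \1_(`]-oo, y[%classic) x) :> (R -> R).
  apply/funext => x; rewrite !indicE !mem_setE !in_itv /= andbT.
  case: (ltgtP x y) => xy; rewrite ?subr0 ?sub0r.
  - by rewrite ltr0_sg ?subr_lt0.
  - by rewrite gtr0_sg ?subr_gt0.
  - by rewrite xy !subrr sgr0.
by apply: measurable_funB; exact: measurable_indic.
Qed.

(** The half-lines left and right of [y] contribute -(F y - B)/2 and (A - F y)/2. *)
Lemma FTC_jump F f K A B y : (forall x : R, is_derive x 1 F (f x)) ->
  continuous f -> decays f K -> F x @[x --> +oo] --> A -> F x @[x --> -oo] --> B ->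
  realI (fun x => f x * (Num.sg (x - y) / 2)) ((A + B) / 2 - F y).
Proof.
move=> dF cf fK FA FB.
have mf := continuous_measurable_fun cf.
have if_ := decays_integrable mf fK.
have ih : mu.-integrable [set: R] (EFin \o (fun x => f x * (Num.sg (x - y) / 2))).
  apply: (@decays_integrable _ K).
    by apply: measurable_funM => //; apply: measurable_funM => //; exact: measurable_sg.
  move=> x; apply: le_trans (fK x); rewrite ler_wpM2r//.
  rewrite normrM ler_piMr// normrM normr_sg (@ger0_norm _ 2^-1) ?invr_ge0//.
  by case: (_ != _); rewrite /= ?mul0r ?ler01// mul1r invf_le1 ?ler1n.
have := realI_split (a := y) (h1 := fun x => - 2^-1 * f x)
  (h2 := fun x => 2^-1 * f x) ih.
have sub (D : set R) : measurable D -> mu.-integrable D (EFin \o f).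
  by move=> mD; apply: integrableS if_.
rewrite !RintegralZl//; try exact: sub.
rewrite (FTC_left dF cf (fun x _ => fK x) FB) (FTC_right dF cf (fun x _ => fK x) FA).
have -> : - 2^-1 * (F y - B) + 2^-1 * (A - F y) = (A + B) / 2 - F y by field.
apply => x xy; first by rewrite ltr0_sg ?subr_lt0//; ring.
by rewrite gtr0_sg ?subr_gt0//; ring.
Qed.

End HalfLines.

Section Gaussian.
Variable R : realType.
Local Notation mu := (@lebesgue_measure R).
Implicit Types (c x : R) (k : nat).

(** The rate may be negative: [ew (-1)] is the growing factor of the complex weight. *)
Definition ew c x := expR (- (c * x ^+ 2)).


Lemma ew_ge0 c x : 0 <= ew c x. Proof. exact: expR_ge0. Qed.

Lemma ewN c x : ew c (- x) = ew c x. Proof. by rewrite /ew sqrrN. Qed.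

Lemma ewD c d x : ew (c + d) x = ew c x * ew d x.
Proof. by rewrite /ew -expRD; congr expR; ring. Qed.

Lemma weightR_ew x : weightR x = ew 2^-1 x.
Proof. by rewrite /weightR /ew; congr expR; ring. Qed.

Lemma is_derive_ew c x : is_derive x 1 (ew c) (- (2 * c * x) * ew c x).
Proof. rewrite /ew; apply: is_derive_eq; rewrite /GRing.scale /=; ring. Qed.

Lemma is_derive_pow_ew c k x : is_derive x 1 (fun y : R => y ^+ k * ew c y)
  ((k%:R * x ^+ k.-1 - 2 * c * x ^+ k.+1) * ew c x).
Proof.
have dX : is_derive x 1 (fun y : R => y ^+ k) (k%:R * x ^+ k.-1).
  have := is_deriveX k (is_derive_id x (1 : R)); rewrite /GRing.scale /= mulr1.
  by congr is_derive; apply/funext => y; rewrite exprfctE.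
have := is_deriveM dX (is_derive_ew c x); rewrite /GRing.scale /= => h; apply: is_derive_eq.
by rewrite exprS; ring.
Qed.

Lemma continuous_ew c : continuous (ew c).
Proof. by move=> x; exact: is_derive_continuous (is_derive_ew c x). Qed.

Lemma continuous_pow_ew c k : continuous (fun y : R => y ^+ k * ew c y : R).
Proof. by move=> x; exact: is_derive_continuous (is_derive_pow_ew c k x). Qed.

Lemma decays_pow_ew c k : 0 < c -> exists K, decays (fun x => x ^+ k * ew c x) K.
Proof.
(* With o = 1 + x^2, the bound is (c o)^(k+1) / (k+1)! <= exp (c o); the factor [expR c] passes from
   exp (- c o) to [ew c x]. One power of o serves [decays], the others dominate |x|^k. *)
move=> c0; exists (c^-1 ^+ k.+1 * (k.+1)`!%:R * expR c) => x.
have o1 := oneDsqr_ge1 x; have o0 : 0 <= oneDsqr x by rewrite (le_trans _ o1).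
have xo : `|x| <= oneDsqr x.
  by rewrite /oneDsqr -(real_normK (num_real x)); have := normr_ge0 x; nra.
rewrite normrM normrX (ger0_norm (ew_ge0 c x)).
apply: (@le_trans _ _ (oneDsqr x ^+ k.+1 * ew c x)).
  rewrite mulrAC exprSr; apply: ler_wpM2r; first exact: ew_ge0.
  by apply: ler_wpM2r => //; rewrite lerXn2r// ?nnegrE.
have := expR_ge1Dxn k (mulr_ge0 (ltW c0) o0) => h.
have {}h : (c * oneDsqr x) ^+ k.+1 / (k.+1)`!%:R <= expR (c * oneDsqr x).
  by apply: le_trans h; rewrite lerDr.
rewrite ler_pdivrMr ?ltr0n ?fact_gt0// in h.
have -> : oneDsqr x ^+ k.+1 = c^-1 ^+ k.+1 * (c * oneDsqr x) ^+ k.+1.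
  by rewrite -exprMn mulrA mulVf ?mul1r// gt_eqF.
have -> : expR c = expR (c * oneDsqr x) * ew c x.
  by rewrite /ew -expRD; congr expR; rewrite /oneDsqr; ring.
rewrite !mulrA; apply: ler_wpM2r; first exact: ew_ge0.
rewrite -!mulrA; apply: ler_wpM2l; first by rewrite exprn_ge0 ?invr_ge0 ?ltW.
by rewrite [leRHS]mulrC.
Qed.

Lemma decays_cvgy f (K : R) : decays f K -> f x @[x --> +oo] --> (0 : R).
Proof.
move=> fK; apply/cvgr0Pnorm_lt => e e0; near=> x.
have x1 : 1 < x by near: x; apply: nbhs_pinfty_gt; rewrite num_real.
have xK : K / e < x by near: x; apply: nbhs_pinfty_gt; rewrite num_real.
have h := fK x; rewrite ltr_pdivrMr// in xK.
rewrite ltNge; apply/negP => ef.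
have : e * x < e * oneDsqr x by rewrite ltr_pM2l// /oneDsqr; nra.
have : e * oneDsqr x <= `|f x| * oneDsqr x.
  by rewrite ler_wpM2r// (le_trans _ (oneDsqr_ge1 x)).
lra.
Unshelve. all: by end_near. Qed.

Lemma decays_cvgNy f (K : R) : decays f K -> f x @[x --> -oo] --> (0 : R).
Proof.
move=> fK; apply/cvgNy_compNP; apply: (@decays_cvgy _ K) => x.
by have := fK (- x); rewrite /oneDsqr sqrrN.
Qed.

Lemma decays_lin a f g (K L : R) : decays f K -> decays g L ->
  decays (fun x => a * f x + g x) (`|a| * K + L).
Proof.
move=> fK gL x; apply: (@le_trans _ _ (`|a| * (`|f x| * oneDsqr x) + `|g x| * oneDsqr x)).
  by rewrite mulrA -mulrDl ler_wpM2r ?(le_trans _ (oneDsqr_ge1 x))// -normrM ler_normD.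
by rewrite lerD// ler_wpM2l.
Qed.

Definition moment c k : R := \int[mu]_x (x ^+ k * ew c x).

Lemma realI_moment c k : 0 < c -> realI (fun x => x ^+ k * ew c x) (moment c k).
Proof.
move=> /(decays_pow_ew k)[K fK]; split=> //.
apply: decays_integrable fK.
by apply: continuous_measurable_fun; exact: continuous_pow_ew.
Qed.

Let dpow c k x := (k%:R * x ^+ k.-1 - 2 * c * x ^+ k.+1) * ew c x.

Let dpow_cont c k : continuous (dpow c k).
Proof.
have -> : dpow c k = (fun x => k%:R * (x ^+ k.-1 * ew c x) + (- (2 * c)) * (x ^+ k.+1 * ew c x)).
  by apply/funext => x; rewrite /dpow; ring.
by move=> x; apply: cvgD; apply: cvgM; (exact: cvg_cst || exact: continuous_pow_ew).
Qed.

Let dpow_decays c k : 0 < c -> exists K, decays (dpow c k) K.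
Proof.
move=> c0; have [K1 h1] := decays_pow_ew k.-1 c0; have [K2 h2] := decays_pow_ew k.+1 c0.
exists (`|k%:R| * K1 + (`|- (2 * c)| * K2 + K2 * 0)) => x.
have -> : dpow c k x = k%:R * (x ^+ k.-1 * ew c x)
    + ((- (2 * c)) * (x ^+ k.+1 * ew c x) + 0) by rewrite /dpow; ring.
apply: (decays_lin k%:R h1 (decays_lin (g := fun=> 0) (- (2 * c)) h2 _)).
by move=> y; rewrite normr0 mul0r mulr0.
Qed.

Lemma realI_uniq (f : R -> R) (r s : R) : realI f r -> realI f s -> r = s.
Proof. by move=> [_ <-] [_ <-]. Qed.

(** The derivative of [x ^+ k * ew c x] has integral 0. At [k = 0] the truncated predecessor is
    multiplied by 0. *)
Lemma moment_rec c k : 0 < c -> 2 * c * moment c k.+1 = k%:R * moment c k.-1.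
Proof.
move=> c0; have [K fK] := decays_pow_ew k c0; have [L dL] := dpow_decays k c0.
have h1 := FTC_line (fun x => is_derive_pow_ew c k x) (@dpow_cont c k) dL
  (decays_cvgy fK) (decays_cvgNy fK).
have h2 := linear_integral_lin (@realI_linear R) k%:R (realI_moment k.-1 c0)
  (linear_integral_lin (@realI_linear R) (- (2 * c)) (realI_moment k.+1 c0)
     (linear_integral0 (@realI_linear R))).
have {}h2 : realI (dpow c k) (k%:R * moment c k.-1 + (- (2 * c) * moment c k.+1 + 0)).
  by apply: (linear_integral_ext (@realI_linear R)) h2 => x; rewrite /dpow; ring.
have := realI_uniq h1 h2; lra.
Qed.

Lemma moment1 c : 0 < c -> moment c 1 = 0.
Proof.
move=> c0; have := moment_rec 0 c0; rewrite mul0r => /eqP.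
by rewrite mulf_eq0 mulf_eq0 pnatr_eq0 (gt_eqF c0) => /eqP.
Qed.

Lemma moment_gauss : moment 1 0 = Num.sqrt pi.
Proof.
rewrite /moment /Rintegral -[RHS]/(fine (Num.sqrt pi)%:E) -integralT_gauss.
by congr fine; apply: eq_integral => x _; rewrite mul1r /ew mul1r.
Qed.

Definition tail c x : R := \int[mu]_(t in `[x, +oo[) ew c t.

Lemma decays_ew c : 0 < c -> exists K, decays (ew c) K.
Proof.
by move=> /(decays_pow_ew 0)[K h]; exists K => x; have := h x; rewrite mul1r.
Qed.

Lemma realI_ew c : 0 < c -> realI (ew c) (moment c 0).
Proof.
move=> /(realI_moment 0); apply: (linear_integral_ext (@realI_linear R)) => x.
by rewrite mul1r.
Qed.

Lemma tail_split c x : 0 < c ->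
  \int[mu]_(t in `]-oo, x]) ew c t + tail c x = moment c 0.
Proof.
move=> c0; have [i e] := realI_ew c0.
have h := @realI_split _ (ew c) _ _ x i (fun _ _ => erefl) (fun _ _ => erefl).
exact: realI_uniq h (realI_ew c0).
Qed.

Lemma tail_ge0 c x : 0 <= tail c x.
Proof. by apply: Rintegral_ge0 => t _; exact: ew_ge0. Qed.

Lemma is_derive_tail c x : 0 < c -> is_derive x 1 (tail c) (- ew c x).
Proof.
move=> c0; have [i _] := realI_ew c0.
pose G y := \int[mu]_(t in `]-oo, y]) ew c t.
have [dG G'] : derivable G x 1 /\ derive1 G x = ew c x.
  apply: (@continuous_FTC1 R (ew c) (BInfty _ true) x (x + 1)).
  - by rewrite ltrDl.
  - exact: integrable_subset i.
  - by rewrite ltNyr.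
  - exact: continuous_ew.
have dG' : is_derive x 1 G (ew c x).
  by rewrite -G' derive1E; exact: derivableP.
have -> : tail c = (fun y => moment c 0 - G y).
  by apply/funext => y; rewrite -(tail_split y c0) [_ + tail c y]addrC addrK.
by have := is_deriveB (is_derive_cst (moment c 0) x 1) dG'; rewrite sub0r.
Qed.

Lemma tailN c x : 0 < c -> tail c (- x) = moment c 0 - tail c x.
Proof.
move=> c0; rewrite -(tail_split (- x) c0); have [K fK] := decays_ew c0.
have -> : \int[mu]_(t in `]-oo, - x]) ew c t = tail c x.
  rewrite (reflect_integral (@continuous_ew c) (fun x _ => fK x)) opprK.
  by apply: eq_Rintegral => t _; rewrite ewN.
by rewrite [tail c x + _]addrC addrK.
Qed.

Lemma tail0 c : 0 < c -> tail c 0 = moment c 0 / 2.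
Proof. by move=> c0; have := tailN 0 c0; rewrite oppr0; lra. Qed.

(* [exp (- c t^2) <= exp (- (c - d) x^2) * exp (- d t^2)] for [t >= x >= 0]. *)
Lemma tail_le c d x : 0 < d -> d <= c -> 0 <= x ->
  tail c x <= ew (c - d) x * moment d 0.
Proof.
move=> d0 dc x0; have c0 := lt_le_trans d0 dc.
have [i _] := realI_ew c0; have [j _] := realI_ew d0.
apply: (@le_trans _ _ (ew (c - d) x * tail d x)); last first.
  rewrite ler_wpM2l ?ew_ge0// -(tail_split x d0) lerDr.
  by apply: Rintegral_ge0 => t _; exact: ew_ge0.
rewrite /tail -RintegralZl//; last exact: integrable_subset j.
apply: le_Rintegral => //; first exact: integrable_subset i.
  by apply: integrable_subset => //; exact: (integrableZl measurableT _ j).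
move=> t; rewrite /= in_itv /= andbT => xt.
rewrite /ew -expRD ler_expR.
have : x ^+ 2 <= t ^+ 2 by rewrite lerXn2r ?nnegrE// (le_trans x0).
move=> xt2; have : 0 <= (c - d) * (t ^+ 2 - x ^+ 2) by rewrite mulr_ge0 ?subr_ge0.
by nra.
Qed.

Lemma tail_cvgy c : 0 < c -> tail c x @[x --> +oo] --> (0 : R).
Proof.
move=> c0; have c2 : 0 < c / 2 by rewrite divr_gt0.
have [K fK] := decays_ew c2.
apply: (@squeeze_cvgr _ _ _ _ (fun=> 0) (fun x => ew (c / 2) x * moment (c / 2) 0)).
- near=> x; have x0 : 0 <= x by near: x; apply: nbhs_pinfty_ge; rewrite num_real.
  rewrite tail_ge0 /=.
  have -> : ew (c / 2) x = ew (c - c / 2) x by congr (ew _ x); field.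
  by apply: tail_le => //; lra.
- exact: cvg_cst.
- rewrite -(mul0r (moment (c / 2) 0)); apply: cvgM; last exact: cvg_cst.
  exact: decays_cvgy fK.
Unshelve. all: by end_near. Qed.

Lemma tail_cvgNy c : 0 < c -> tail c x @[x --> -oo] --> moment c 0.
Proof.
move=> c0; apply/cvgNy_compNP.
have -> : tail c \o -%R = (fun x => moment c 0 - tail c x).
  by apply/funext => x /=; rewrite tailN.
have : (fun x => moment c 0 - tail c x) x @[x --> +oo] --> moment c 0 - 0.
  by apply: cvgB; [exact: cvg_cst|exact: tail_cvgy].
by rewrite subr0.
Qed.

Lemma erfc_tail x : erfc x = 2 / Num.sqrt pi * tail 1 x.
Proof.
by congr (_ * _); apply: eq_Rintegral => t _; rewrite /ew mul1r.
Qed.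

Lemma erfc0 : erfc (0 : R) = 1.
Proof.
rewrite erfc_tail tail0// moment_gauss.
have s0 : Num.sqrt pi != 0 :> R by rewrite gt_eqF// sqrtr_gt0 pi_gt0.
by field.
Qed.

(* The skew integral transform of [x^k exp (- x^2 / 2)]. *)
Fixpoint vR k x : R :=
  match k with
  | 0 => tail 2^-1 x - moment 2^-1 0 / 2
  | 1 => ew 2^-1 x
  | k'.+2 => k'.+1%:R * vR k' x + x ^+ k'.+1 * ew 2^-1 x
  end.

Definition uR k x : R := x ^+ k * ew 2^-1 x.

Let half_gt0 : 0 < 2^-1 :> R. Proof. by rewrite invr_gt0. Qed.

Lemma nat_ind2 (P : nat -> Prop) : P 0%N -> P 1%N ->
  (forall k, P k -> P k.+1 -> P k.+2) -> forall k, P k.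
Proof.
move=> P0 P1 PS k; suff: P k /\ P k.+1 by case.
by elim: k => [//|k [Pk Pk1]]; split=> //; exact: PS.
Qed.

(** In the recursive case the lower-order part of the derivative of [x ^+ k.+1 * ew 2^-1 x] cancels
    [k.+1%:R * uR k x]. *)
Lemma is_derive_vR k x : is_derive x 1 (vR k) (- uR k x).
Proof.
elim/nat_ind2: k => [||k IH _] /=.
- have := is_deriveB (is_derive_tail x half_gt0) (is_derive_cst (moment 2^-1 0 / 2) x 1).
  by rewrite subr0 /uR mul1r.
- by apply: is_derive_eq (is_derive_ew _ x) _; rewrite /uR; field.
have h := is_deriveD (is_deriveZ (k.+1%:R : R) IH) (is_derive_pow_ew 2^-1 k.+1 x).
by apply: is_derive_eq h _; rewrite /GRing.scale /uR /=; rewrite !exprS; field.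
Qed.

Lemma continuous_uR k : continuous (uR k). Proof. exact: continuous_pow_ew. Qed.

Lemma continuous_vR k : continuous (vR k).
Proof. by move=> x; exact: is_derive_continuous (is_derive_vR k x). Qed.

Lemma vR_rec k x : vR k.+1 x - k%:R * vR k.-1 x = uR k x.
Proof. by case: k => [|k] /=; rewrite /uR; ring. Qed.

(** Opposite limits make the mean of the end values vanish in [FTC_jump], and give a product of two
    [vR] the same limit at both ends. *)
Lemma vR_cvg k : exists A : R, vR k x @[x --> +oo] --> A /\ vR k x @[x --> -oo] --> - A.
Proof.
elim/nat_ind2: k => [||k [A [Ay ANy]] _].
- exists (- (moment 2^-1 0 / 2)); split.
    have : (fun x => tail 2^-1 x - moment 2^-1 0 / 2) x @[x --> +oo] --> 0 - moment 2^-1 0 / 2.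
      by apply: cvgB; [exact: tail_cvgy|exact: cvg_cst].
    by rewrite sub0r.
  have : (fun x => tail 2^-1 x - moment 2^-1 0 / 2) x @[x --> -oo] -->
      moment 2^-1 0 - moment 2^-1 0 / 2.
    by apply: cvgB; [exact: tail_cvgNy|exact: cvg_cst].
  by rewrite (_ : _ - _ = - - (moment 2^-1 0 / 2)) ?opprK//; field.
- have [K fK] := decays_ew half_gt0.
  by exists 0; rewrite oppr0; split; [exact: decays_cvgy fK|exact: decays_cvgNy fK].
have [K fK] := decays_pow_ew k.+1 half_gt0.
exists (k.+1%:R * A + 0); split.
  by apply: cvgD; [apply: cvgM => //; exact: cvg_cst|exact: decays_cvgy fK].
rewrite opprD -mulrN oppr0.
by apply: cvgD; [apply: cvgM => //; exact: cvg_cst|exact: decays_cvgNy fK].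
Qed.

Lemma vR_bounded k : exists K, forall x, `|vR k x| <= K.
Proof.
elim/nat_ind2: k => [||k [K vK] _].
- exists (moment 2^-1 0 + moment 2^-1 0 / 2) => x /=.
  have m0 : 0 <= moment 2^-1 0.
    rewrite -(tail_split 0 half_gt0); apply: addr_ge0; last exact: tail_ge0.
    by apply: Rintegral_ge0 => t _; exact: ew_ge0.
  have := tail_ge0 2^-1 x; have := tail_ge0 2^-1 (- x); rewrite tailN// => h1 h2.
  by rewrite ler_norml; apply/andP; split; lra.
- have [K fK] := decays_ew half_gt0; exists K => x /=.
  by apply: le_trans (fK x); rewrite ler_peMr// oneDsqr_ge1.
have [L fL] := decays_pow_ew k.+1 half_gt0.
exists (k.+1%:R * K + L) => x /=.
rewrite (le_trans (ler_normD _ _))// lerD//.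
  by rewrite normrM ger0_norm// ler_wpM2l.
by apply: le_trans (fL x); rewrite ler_peMr// oneDsqr_ge1.
Qed.

Lemma decays_uv p q : exists K, decays (fun x => uR p x * vR q x) K.
Proof.
have [K uK] := decays_pow_ew p half_gt0; have [L vL] := vR_bounded q.
exists (K * L) => x; rewrite normrM mulrAC ler_pM//.
exact: uK.
Qed.

Lemma continuous_uv p q : continuous (fun x => uR p x * vR q x).
Proof. by move=> x; apply: cvgM; [exact: continuous_uR|exact: continuous_vR]. Qed.

Definition J p q : R := \int[mu]_x (uR p x * vR q x).

Lemma realI_J p q : realI (fun x => uR p x * vR q x) (J p q).
Proof.
have [K uK] := decays_uv p q; split=> //; apply: decays_integrable uK.
by apply: continuous_measurable_fun; exact: continuous_uv.
Qed.

(* [u_p v_q + v_p u_q] is minus the derivative of [v_p v_q], whose limits at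
   both ends agree. *)
Lemma J_antisym p q : J q p = - J p q.
Proof.
have [A [Ay ANy]] := vR_cvg p; have [B [By BNy]] := vR_cvg q.
have [K1 h1] := decays_uv p q; have [K2 h2] := decays_uv q p.
have dF (x : R) : is_derive x 1 (fun y => vR p y * vR q y)
    (-1 * (uR p x * vR q x) + -1 * (uR q x * vR p x)).
  apply: is_derive_eq (is_deriveM (is_derive_vR p x) (is_derive_vR q x)) _.
  by rewrite /GRing.scale /=; ring.
have hd : decays (fun x => -1 * (uR p x * vR q x) + -1 * (uR q x * vR p x))
    (`|-1| * K1 + (`|-1| * K2 + 0)).
  apply: decays_lin => // x; have := decays_lin (-1) h2 (g := fun=> 0) (L := 0).
  by rewrite addr0 => h; have := h _ x; rewrite addr0; apply => y; rewrite normr0 mul0r.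
have hc : continuous (fun x => -1 * (uR p x * vR q x) + -1 * (uR q x * vR p x)).
  by move=> x; apply: cvgD; apply: cvgM; (exact: cvg_cst || exact: continuous_uv).
have hy : (fun y => vR p y * vR q y) x @[x --> +oo] --> A * B by exact: cvgM.
have hNy : (fun y => vR p y * vR q y) x @[x --> -oo] --> A * B.
  by rewrite -mulrNN; exact: cvgM.
have i1 := FTC_line dF hc hd hy hNy.
have i2 := linear_integral_lin (@realI_linear R) (-1) (realI_J p q)
  (linear_integral_lin (@realI_linear R) (-1) (realI_J q p)
    (linear_integral0 (@realI_linear R))).
have {}i2 : realI (fun x => -1 * (uR p x * vR q x) + -1 * (uR q x * vR p x))
    (-1 * J p q + (-1 * J q p + 0)).
  by apply: (linear_integral_ext (@realI_linear R)) i2 => x; rewrite addr0.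
have := realI_uniq i1 i2; lra.
Qed.

Lemma realI_uv p q :
  realI (fun x => uR p x * vR q x - vR p x * uR q x) (2 * J p q).
Proof.
have := linear_integral_lin (@realI_linear R) (-1) (realI_J q p) (realI_J p q).
rewrite J_antisym mulN1r opprK -mulr2n mulr_natl.
by apply: (linear_integral_ext (@realI_linear R)) => x; ring.
Qed.

(** By [vR_rec] the integrand collapses to a product of two Gaussians of rate 1/2, hence to one of
    rate 1. *)
Lemma J_rec p k : J p k.+1 - k%:R * J p k.-1 = moment 1 (p + k).
Proof.
have i1 := linear_integral_lin (@realI_linear R) (- k%:R) (realI_J p k.-1) (realI_J p k.+1).
have {}i1 : realI (fun x => x ^+ (p + k) * ew 1 x) (- k%:R * J p k.-1 + J p k.+1).
  apply: (linear_integral_ext (@realI_linear R)) i1 => x.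
  have -> : ew 1 x = ew 2^-1 x * ew 2^-1 x by rewrite -ewD; congr (ew _ x); field.
  have := vR_rec k x; rewrite /uR exprD => h.
  by rewrite mulrACA -h; ring.
have := realI_uniq i1 (realI_moment (p + k) ltr01); lra.
Qed.

Lemma realI_jump p y : realI (fun x => uR p x * (Num.sg (x - y) / 2)) (vR p y).
Proof.
have [A [Ay ANy]] := vR_cvg p; have [K uK] := decays_pow_ew p half_gt0.
have dN (x : R) : is_derive x 1 (fun y => - vR p y) (uR p x).
  by have := is_deriveN (is_derive_vR p x); rewrite opprK.
have := FTC_jump y dN (@continuous_uR p) uK (cvgN Ay) (cvgN ANy).
have -> : (- A + - - A) / 2 - - vR p y = vR p y by lra.
by apply; typeclasses eauto.
Qed.

End Gaussian.

(** * The Gram matrix *)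

Section ComplexWeights.
Variable R : realType.
Local Notation mu := (@lebesgue_measure R).
Implicit Types (x y : R) (k : nat).

Let half_gt0 : 0 < 2^-1 :> R. Proof. by rewrite invr_gt0. Qed.

(* The constant of [d/dy erfc (sqrt 2 y) = - c exp (- 2 y^2)]. *)
Definition erfc_const : R := 2 * Num.sqrt 2 / Num.sqrt pi.

Definition herfc y : R := erfc (Num.sqrt 2 * y).

(** At u + iv the complex weight is [ew 1 u * hw |v|]. *)
Definition hw y : R := ew (-1) y * herfc y.

Lemma is_derive_herfc y : is_derive y 1 herfc (- (erfc_const * ew 2 y)).
Proof.
have -> : herfc = (fun y => 2 / Num.sqrt pi * tail 1 (Num.sqrt 2 * y)).
  by apply/funext => x; rewrite /herfc erfc_tail.
have dl : is_derive y 1 (fun y : R => Num.sqrt 2 * y) (Num.sqrt 2).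
  by have := is_deriveZ (Num.sqrt 2) (is_derive_id y (1 : R)); rewrite /GRing.scale /= mulr1.
have := is_derive1_comp (is_derive_tail (Num.sqrt 2 * y) (@ltr01 R)) dl => h.
apply: is_derive_eq (is_deriveZ (2 / Num.sqrt pi) h) _.
rewrite /GRing.scale /= /ew mul1r exprMn sqr_sqrtr// /erfc_const.
by field; rewrite gt_eqF// sqrtr_gt0 pi_gt0.
Qed.

Lemma continuous_herfc : continuous herfc.
Proof. by move=> y; exact: is_derive_continuous (is_derive_herfc y). Qed.

Lemma herfc_ge0 y : 0 <= herfc y. Proof. exact: erfc_ge0. Qed.

Let C0 : R := 2 / Num.sqrt pi * moment 4^-1 0.

(** [tail_le] with rate 1/4 at sqrt 2 y gives the factor e^(- 3 y^2 / 2), which beats the growth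
    e^(y^2) and leaves e^(- y^2 / 2). *)
Lemma hw_le y : 0 <= y -> hw y <= C0 * ew 2^-1 y.
Proof.
move=> y0; rewrite /hw /herfc erfc_tail.
have q0 : 0 < 4^-1 :> R by rewrite invr_gt0.
have q1 : 4^-1 <= 1 :> R by rewrite invf_le1// ler1n.
have h := tail_le q0 q1 (mulr_ge0 (sqrtr_ge0 2) y0).
have e : ew (-1) y * ew (1 - 4^-1) (Num.sqrt 2 * y) = ew 2^-1 y.
  by rewrite /ew -expRD exprMn sqr_sqrtr//; congr expR; field.
have pos : 0 <= ew (-1) y * (2 / Num.sqrt pi) by rewrite mulr_ge0 ?ew_ge0// divr_ge0.
rewrite mulrA; apply: le_trans (ler_wpM2l pos h) _.
by rewrite -e /C0 le_eqVlt; apply/orP; left; apply/eqP; ring.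
Qed.

Lemma hw_ge0 y : 0 <= hw y. Proof. by rewrite mulr_ge0 ?ew_ge0 ?herfc_ge0. Qed.

Lemma continuous_hw : continuous hw.
Proof. by move=> y; apply: cvgM; [exact: continuous_ew|exact: continuous_herfc]. Qed.

Lemma decays_hw k : exists K, forall y, 0 <= y -> `|y ^+ k * hw y| * oneDsqr y <= K.
Proof.
have [K hK] := decays_pow_ew k half_gt0; exists (C0 * K) => y y0.
have C00 : 0 <= C0.
  by have := hw_le (lexx 0); have := hw_ge0 0; rewrite /ew expr0n /= mulr0 oppr0 expR0; lra.
apply: (@le_trans _ _ (C0 * (`|y ^+ k * ew 2^-1 y| * oneDsqr y))); last exact: ler_wpM2l.
rewrite [leRHS]mulrA ler_wpM2r ?(le_trans _ (oneDsqr_ge1 y))//.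
rewrite (normrM _ (hw y)) (normrM _ (ew _ y)) (ger0_norm (hw_ge0 y))
  (ger0_norm (ew_ge0 _ _)) [leRHS]mulrCA.
by rewrite ler_wpM2l// hw_le.
Qed.

Lemma realI_abs (f : R -> R) K : continuous f ->
  (forall y, 0 <= y -> `|f y| * oneDsqr y <= K) ->
  realI (fun y => f `|y|) (\int[mu]_y f `|y|).
Proof.
move=> cf fK; split=> //; apply: (@decays_integrable _ _ K).
  apply: continuous_measurable_fun => y; apply: continuous_comp; last exact: cf.
  exact: norm_continuous.
by move=> y; have := fK _ (normr_ge0 y); rewrite /oneDsqr real_normK ?num_real.
Qed.

(** The absolute values come from [upper], which folds the plane onto the upper half-plane and so
    counts it twice. *)
Definition h_moment k : R := \int[mu]_y (`|y| ^+ k * hw `|y|).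
Definition g_moment k : R := \int[mu]_y (`|y| ^+ k * ew 1 `|y|).

Let continuous_pow_hw k : continuous (fun y : R => y ^+ k * hw y : R).
Proof. by move=> y; apply: cvgM; [exact: exprn_continuous|exact: continuous_hw]. Qed.

Lemma realI_h_moment k : realI (fun y => `|y| ^+ k * hw `|y|) (h_moment k).
Proof.
have [K hK] := decays_hw k.
exact: (realI_abs (@continuous_pow_hw k) hK).
Qed.

Lemma realI_g_moment k : realI (fun y => `|y| ^+ k * ew 1 `|y|) (g_moment k).
Proof.
have [K hK] := decays_pow_ew k (@ltr01 R).
exact: (realI_abs (@continuous_pow_ew R 1 k) (fun y _ => hK y)).
Qed.

Let dh k y := (k%:R * y ^+ k.-1 + 2 * y ^+ k.+1) * hw y - erfc_const * (y ^+ k * ew 1 y).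

Let is_derive_pow_hw k y : is_derive y 1 (fun y : R => y ^+ k * hw y) (dh k y).
Proof.
have := is_deriveM (is_derive_pow_ew (-1) k y) (is_derive_herfc y).
rewrite (_ : (fun y : R => y ^+ k * hw y) = (fun y : R => y ^+ k * ew (-1) y) * herfc); last first.
  by apply/funext => x; rewrite /hw mulrA.
move=> h; apply: is_derive_eq h _; rewrite /GRing.scale /= /dh /hw.
have -> : ew 1 y = ew (-1) y * ew 2 y by rewrite -ewD; congr (ew _ y); ring.
by ring.
Qed.

(* Integration by parts on both half-lines. *)
Lemma h_moment_rec k :
  k%:R * h_moment k.-1 + 2 * h_moment k.+1
  = erfc_const * g_moment k - 2 * (k == 0%N)%:R.
Proof.
have lin := @realI_linear R.
have i := linear_integral_lin lin k%:R (realI_h_moment k.-1)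
  (linear_integral_lin lin 2 (realI_h_moment k.+1)
  (linear_integral_lin lin (- erfc_const) (realI_g_moment k) (linear_integral0 lin))).
have {}i : realI (fun y => dh k `|y|) (k%:R * h_moment k.-1 + (2 * h_moment k.+1
    + (- erfc_const * g_moment k + 0))).
  by apply: (linear_integral_ext lin) i => y; rewrite /dh; ring.
have cdh : continuous (dh k).
  move=> y; have -> : dh k = (fun y => (k%:R * (y ^+ k.-1 * hw y) + 2 * (y ^+ k.+1 * hw y))
      - erfc_const * (y ^+ k * ew 1 y)) by apply/funext => x; rewrite /dh; ring.
  by apply: cvgB; [apply: cvgD|]; apply: cvgM; (exact: cvg_cst ||
    exact: continuous_pow_hw || exact: continuous_pow_ew).
have [K1 h1] := decays_hw k.-1; have [K2 h2] := decays_hw k.+1.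
have [K3 h3] := decays_pow_ew k (@ltr01 R).
pose K := k%:R * K1 + 2 * K2 + `|erfc_const| * K3.
have dhK y : 0 <= y -> `|dh k y| * oneDsqr y <= K.
  move=> y0; have o0 := le_trans ler01 (oneDsqr_ge1 y).
  apply: (@le_trans _ _ ((k%:R * `|y ^+ k.-1 * hw y| + 2 * `|y ^+ k.+1 * hw y|
    + `|erfc_const| * `|y ^+ k * ew 1 y|) * oneDsqr y)).
    rewrite ler_wpM2r//.
    have -> : dh k y = k%:R * (y ^+ k.-1 * hw y) + 2 * (y ^+ k.+1 * hw y)
      - erfc_const * (y ^+ k * ew 1 y) by rewrite /dh; ring.
    apply: (le_trans (ler_normB _ _)); rewrite normrM lerD//.
    apply: (le_trans (ler_normD _ _)); rewrite !(normrM _ (_ * _)).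
    by rewrite !(@ger0_norm _ _%:R).
  rewrite 2!mulrDl /K; apply: lerD; first apply: lerD.
  - by rewrite -[leLHS]mulrA ler_wpM2l// h1.
  - by rewrite -[leLHS]mulrA ler_wpM2l// h2.
  - by rewrite -[leLHS]mulrA ler_wpM2l.
have Fy : (fun y : R => y ^+ k * hw y) x @[x --> +oo] --> (0 : R).
  have [K4 h4] := decays_pow_ew k half_gt0; have := decays_cvgy h4 => c4.
  apply: (@squeeze_cvgr _ _ _ _ (fun=> 0) (fun y => C0 * (y ^+ k * ew 2^-1 y))).
  - near=> y; have y0 : 0 <= y by near: y; apply: nbhs_pinfty_ge; rewrite num_real.
    rewrite mulr_ge0 ?exprn_ge0 ?hw_ge0//= [leRHS]mulrCA ler_wpM2l ?exprn_ge0//.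
    exact: hw_le.
  - exact: cvg_cst.
  - by rewrite -(mulr0 C0); apply: cvgM => //; exact: cvg_cst.
have r := FTC_right (is_derive_pow_hw k) cdh dhK Fy.
have l : \int[mu]_(x in `]-oo, 0%R]) dh k (- x) = \int[mu]_(x in `[0%R, +oo[) dh k x.
  rewrite (@reflect_integral R (fun y => dh k (- y)) K); last 2 first.
  - by move=> y; apply: continuous_comp; [exact: opp_continuous|exact: cdh].
  - by move=> y; rewrite -oppr_ge0 => /dhK; rewrite /oneDsqr sqrrN.
  by rewrite oppr0; apply: eq_Rintegral => x _; rewrite opprK.
have s : realI (fun y => dh k `|y|) (\int[mu]_(x in `]-oo, 0%R]) dh k (- x)
    + \int[mu]_(x in `[0%R, +oo[) dh k x).
  by apply: (realI_split i.1) => y y0; [rewrite ltr0_norm|rewrite gtr0_norm].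
have := realI_uniq i s; rewrite l r.
(* The boundary value at 0, present only for [k = 0] because [hw 0 = 1]. It enters once from each
   half-line, whence the constant 2 in the recursion. *)
have -> : (0 : R) ^+ k * hw 0 = (k == 0%N)%:R.
  by rewrite expr0n /hw /herfc mulr0 erfc0 /ew expr0n /= mulr0 oppr0 expR0 !mulr1.
move=> e; lra.
Unshelve. all: by end_near. Qed.

(** As in [intC], the inner variable is the imaginary part; integrability is required on every line
    and then for the partial integral [G]. *)
Definition planeI (f : R[i] -> R) (r : R) : Prop :=
  exists G, (forall u, realI (fun v => f (u +i* v)) (G u)) /\ realI G r.

Lemma planeI_linear : linear_integral planeI.
Proof.
have lin := @realI_linear R; split.
- by exists (fun=> 0); split=> [u|]; exact: (linear_integral0 lin).
- move=> a f g r s [F [hF Fr]] [G [hG Gs]].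
  exists (fun u => a * F u + G u); split=> [u|]; exact: (linear_integral_lin lin).
- move=> f g r fg [F [hF Fr]]; exists F; split=> // u.
  by apply: (linear_integral_ext lin) (hF u) => v.
Qed.

Lemma planeI_prod f g (r s : R) : realI f r -> realI g s ->
  planeI (fun z => f (complex.Re z) * g (complex.Im z)) (r * s).
Proof.
have lin := @realI_linear R; move=> fr gs.
have Z h t c : realI h t -> realI (fun x => c * h x) (c * t).
  move=> ht; have := linear_integral_lin lin c ht (linear_integral0 lin).
  by rewrite addr0; apply: (linear_integral_ext lin) => x; rewrite addr0.
exists (fun u => f u * s); split=> [u /=|]; first exact: Z.
by rewrite mulrC; apply: (linear_integral_ext lin) (Z _ _ s fr) => u; rewrite mulrC.
Qed.

Lemma planeI_uniq f (r s : R) : planeI f r -> planeI f s -> r = s.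
Proof.
move=> [F [hF Fr]] [G [hG Gs]].
have e : F = G by apply/funext => u; exact: realI_uniq (hF u) (hG u).
by rewrite e in Fr; exact: realI_uniq Fr Gs.
Qed.

End ComplexWeights.

Section CoefFunctional.
Variables (A V : comNzRingType) (lam : A -> V).
Hypothesis lamD : {morph lam : x y / x + y}.
Implicit Types (b : nat -> V) (Q : {poly A}).

(** A formal integral: the j-th power of the outer variable becomes the moment [b j], and [lam]
    integrates the coefficients. Differentiation and multiplication by the variable become
    operations on [b]. *)
Definition Lf b Q : V := \sum_(j < size Q) lam Q`_j * b j.

Let lam0 : lam 0 = 0.
Proof. by apply: (addrI (lam 0)); rewrite -lamD !addr0. Qed.

Lemma Lf_wide n b Q : (size Q <= n)%N -> Lf b Q = \sum_(j < n) lam Q`_j * b j.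
Proof.
move=> le; rewrite /Lf (big_ord_widen n (fun j => lam Q`_j * b j))// big_mkcond.
apply: eq_bigr => j _; case: ltnP => // sj.
by rewrite nth_default// lam0 mul0r.
Qed.

Lemma LfD b P Q : Lf b (P + Q) = Lf b P + Lf b Q.
Proof.
pose n := maxn (size P) (size Q).
rewrite !(@Lf_wide n) ?leq_maxl ?leq_maxr ?size_polyD//.
by rewrite -big_split; apply: eq_bigr => j _; rewrite coefD lamD mulrDl.
Qed.

Lemma Lf0 b : Lf b 0 = 0.
Proof. by rewrite /Lf size_poly0 big_ord0. Qed.

Lemma LfN b Q : Lf b (- Q) = - Lf b Q.
Proof. by apply: (addrI (Lf b Q)); rewrite -LfD !subrr Lf0. Qed.

Lemma LfMn b Q n : Lf b (Q *+ n) = n%:R * Lf b Q.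
Proof.
elim: n => [|n IH]; first by rewrite mulr0n Lf0 mul0r.
by rewrite mulrS LfD IH -[n.+1]add1n natrD mulrDl mul1r.
Qed.

Lemma Lf_lin a b b' Q :
  Lf (fun j => a * b j + b' j) Q = a * Lf b Q + Lf b' Q.
Proof. by rewrite mulr_sumr -big_split; apply: eq_bigr => j _ /=; ring. Qed.

Lemma Lf_mulX b Q : Lf b ('X * Q) = Lf (fun j => b j.+1) Q.
Proof.
rewrite (@Lf_wide (size Q).+1); last first.
  by rewrite (leq_trans (size_polyMleq _ _))// size_polyX.
rewrite big_ord_recl coefXM eqxx lam0 mul0r add0r.
by apply: eq_bigr => j _; rewrite lift0 coefXM.
Qed.

Lemma Lf_deriv b Q : Lf b Q^`() = Lf (fun j => j%:R * b j.-1) Q.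
Proof.
have lamMn x n : lam (x *+ n) = n%:R * lam x.
  elim: n => [|n IH]; first by rewrite mulr0n lam0 mul0r.
  by rewrite mulrS lamD IH -[n.+1]add1n natrD mulrDl mul1r.
rewrite (@Lf_wide (size Q)); last exact: leq_trans (size_poly _ _) (leq_pred _).
rewrite [RHS](@Lf_wide (size Q).+1)// [RHS]big_ord_recl mul0r mulr0 add0r.
by apply: eq_bigr => j _; rewrite lift0 coef_deriv lamMn; ring.
Qed.

Lemma eq_Lf b b' Q : b =1 b' -> Lf b Q = Lf b' Q.
Proof. by move=> e; apply: eq_bigr => j _; rewrite e. Qed.

End CoefFunctional.

Section Bivariate.
Variable A : comNzRingType.
Implicit Types P Q : {poly {poly A}}.

(* The inner variable is the real part, the outer one is ['i] times the
   imaginary part, so that [polyz] and [polyzb] are z and its conjugate. *)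
Definition polyz : {poly {poly A}} := 'X%:P + 'X.
Definition polyzb : {poly {poly A}} := 'X%:P - 'X.
Definition dX Q : {poly {poly A}} := map_poly (@deriv A) Q.

Let coef_dX Q j : (dX Q)`_j = (Q`_j)^`().
Proof. by rewrite coef_map_id0 // deriv0. Qed.

Lemma dXM P Q : dX (P * Q) = dX P * Q + P * dX Q.
Proof.
apply/polyP => j; rewrite coefD coef_dX !coefM raddf_sum -big_split /=.
by apply: eq_bigr => i _; rewrite derivM !coef_dX.
Qed.

Let dX1 : dX 1 = 0.
Proof. by apply/polyP => j; rewrite coef_dX coef1 coef0; case: eqP => _ /=; rewrite ?derivC. Qed.

Lemma dX_exp P n : dX P = 1 -> dX (P ^+ n) = P ^+ n.-1 *+ n.
Proof.
move=> dP; elim: n => [|[|n] IH]; first by rewrite expr0 dX1.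
  by rewrite expr1 dP.
by rewrite exprS dXM dP mul1r IH mulrnAr -exprS [RHS]mulrS.
Qed.

Let dX_z : dX polyz = 1.
Proof.
apply/polyP => j; rewrite coef_dX /polyz coefD coefC coefX coef1.
by case: j => [|[|j]] /=; rewrite ?addr0 ?add0r ?derivX ?derivC.
Qed.

Let dX_zb : dX polyzb = 1.
Proof.
apply/polyP => j; rewrite coef_dX /polyzb coefB coefC coefX coef1.
by case: j => [|[|j]] /=; rewrite ?subr0 ?sub0r ?derivX ?derivN ?derivC ?oppr0.
Qed.

Lemma dX_zz p k : dX (polyz ^+ p * polyzb ^+ k)
  = polyz ^+ p.-1 * polyzb ^+ k *+ p + polyz ^+ p * polyzb ^+ k.-1 *+ k.
Proof. by rewrite dXM !dX_exp// mulrnAl mulrnAr. Qed.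

Lemma dY_zz p k : (polyz ^+ p * polyzb ^+ k)^`()
  = polyz ^+ p.-1 * polyzb ^+ k *+ p - polyz ^+ p * polyzb ^+ k.-1 *+ k.
Proof.
rewrite derivM !deriv_exp /polyz /polyzb derivD derivB derivX derivC.
by rewrite add0r sub0r mul1r mulN1r mulrnAl mulNrn mulrN mulrnAr.
Qed.

End Bivariate.

(** * Half-plane moments of the products of powers of z and its conjugate *)

Section ComplexMoments.
Variable R : realType.
Local Notation C := R[i].
Local Notation Z := (polyz R).
Local Notation Zb := (polyzb R).
Implicit Types (Q : {poly {poly R}}) (p k j : nat).

Definition Xf (p : {poly R}) : R := Lf id (moment 1) p.
Definition XfC (p : {poly R}) : C := (Xf p)%:C.

Let XfD : {morph Xf : p q / p + q}.
Proof. by move=> p q; rewrite /Xf LfD. Qed.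

Let XfCD : {morph XfC : p q / p + q}.
Proof. by move=> p q; rewrite /XfC XfD rmorphD. Qed.

Lemma Xf_deriv (p : {poly R}) : Xf p^`() = Xf ('X * p *+ 2).
Proof.
rewrite /Xf Lf_deriv// LfMn// Lf_mulX// /Lf mulr_sumr; apply: eq_bigr => j _.
have := @moment_rec R 1 j ltr01; rewrite mulr1 => <-.
by rewrite mulrCA.
Qed.

(** Integration against e^(- x^2) in the real part, combined with a moment sequence [b] for the
    outer variable. *)
Definition L (b : nat -> C) Q : C := Lf XfC b Q.

(** Gaussian integration by parts in the real variable, coefficient by coefficient. *)
Lemma L_dX b Q : L b (dX Q) = 2 * L b ('X%:P * Q).
Proof.
have XfC0 : XfC 0 = 0 by rewrite /XfC /Xf Lf0.
rewrite /L (@Lf_wide _ _ _ XfCD (size Q)); last exact: size_poly.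
rewrite [in RHS](@Lf_wide _ _ _ XfCD (size Q)); last first.
  by rewrite (leq_trans (size_polyMleq _ _))// size_polyC polyX_eq0.
rewrite mulr_sumr; apply: eq_bigr => j _.
rewrite coef_map_id0 ?deriv0// coefCM /XfC Xf_deriv /Xf LfMn//.
by rewrite rmorphM rmorph_nat mulrA.
Qed.

Lemma L_lin a b b' Q : L (fun j => a * b j + b' j) Q = a * L b Q + L b' Q.
Proof. exact: Lf_lin. Qed.

Lemma eq_L b b' Q : b =1 b' -> L b Q = L b' Q.
Proof. exact: eq_Lf. Qed.

Lemma L_dY b Q : L b Q^`() = L (fun j => j%:R * b j.-1) Q.
Proof. exact: Lf_deriv. Qed.

Lemma L_Y b Q : L b ('X * Q) = L (fun j => b j.+1) Q.
Proof. exact: Lf_mulX. Qed.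

Lemma LD b P Q : L b (P + Q) = L b P + L b Q. Proof. exact: LfD. Qed.
Lemma LB b P Q : L b (P - Q) = L b P - L b Q. Proof. by rewrite /L LfD// LfN. Qed.
Lemma LMn b Q n : L b (Q *+ n) = n%:R * L b Q. Proof. exact: LfMn. Qed.

Lemma L_delta (c : C) Q : L (fun j => c * (j == 0%N)%:R) Q = c * XfC Q`_0.
Proof.
rewrite /L (@Lf_wide _ _ _ XfCD (size Q).+1)// big_ord_recl big1 ?addr0.
  by rewrite mulr1 mulrC.
by move=> j _; rewrite lift0 !mulr0.
Qed.

(** The powers of ['i] appear because the outer variable stands for i y. [mC] belongs to the
    Gaussian on the full plane, [hC] to the folded complex weight, [gC] to the boundary term of its
    recursion. *)
Definition mC j : C := 'i%C ^+ j * (moment 1 j)%:C.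
Definition hC j : C := 'i%C ^+ j * (h_moment R j)%:C.
Definition gC j : C := 'i%C ^+ j * (g_moment R j)%:C.

Let i2 : 'i%C * 'i%C = -1 :> C. Proof. by rewrite -expr2 sqr_i. Qed.

Let mC_rec j : j%:R * mC j.-1 = - 2 * mC j.+1.
Proof.
rewrite /mC; have := @moment_rec R 1 j ltr01; rewrite mulr1 => /(congr1 (real_complex R)).
rewrite !rmorphM !rmorph_nat => e.
rewrite mulrCA -e; case: j {e} => [|j]; first by rewrite moment1// !mulr0.
rewrite !exprS; have -> : 'i%C * ('i%C * 'i%C ^+ j) = - 'i%C ^+ j :> C.
  by rewrite mulrA i2 mulN1r.
by rewrite /=; ring.
Qed.

Let hC_rec j : j%:R * hC j.-1
  = 2 * hC j.+1 + (2 * 'i%C * (j == 0%N)%:R + - ('i%C * (erfc_const R)%:C) * gC j).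
Proof.
rewrite /hC /gC; have := h_moment_rec R j; move: (erfc_const R) => E.
move=> /(congr1 (real_complex R)).
rewrite rmorphD rmorphB !rmorphM !rmorph_nat => e.
have {}e : E%:C * (g_moment R j)%:C = j%:R * (h_moment R j.-1)%:C
  + 2 * (h_moment R j.+1)%:C + 2 * (j == 0%N)%:R by rewrite e subrK.
have -> : - ('i%C * E%:C) * ('i%C ^+ j * (g_moment R j)%:C)
  = - ('i%C * 'i%C ^+ j) * (E%:C * (g_moment R j)%:C) :> C by ring.
rewrite e; case: j {e} => [|j]; first by rewrite !expr0 expr1 /=; ring.
rewrite !exprS; have -> : 'i%C * ('i%C * 'i%C ^+ j) = - 'i%C ^+ j :> C.
  by rewrite mulrA i2 mulN1r.
by rewrite /=; ring.
Qed.

Let zz p k : {poly {poly R}} := Z ^+ p * Zb ^+ k.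

(** Since the outer variable is i y, the operator on the left is twice the derivative in conj z: it
    kills z and sends conj z to 2. *)
Let zz_diff p k : dX (zz p k) - (zz p k)^`() = zz p k.-1 *+ k *+ 2.
Proof.
by rewrite /zz dX_zz dY_zz opprB [_ *+ k - _]addrC addrACA subrr add0r mulr2n.
Qed.

Let zz_sum p k : dX (zz p k) + (zz p k)^`() = zz p.-1 k *+ p *+ 2.
Proof. by rewrite /zz dX_zz dY_zz addrACA subrr addr0 mulr2n. Qed.

Let zz_mulZ p k : zz p.+1 k = 'X%:P * zz p k + 'X * zz p k.
Proof. by rewrite /zz exprS -mulrA mulrDl. Qed.

Let zz_mulZb p k : zz p k.+1 = 'X%:P * zz p k - 'X * zz p k.
Proof. by rewrite /zz exprS mulrCA mulrBl. Qed.

Lemma zz_coef0 p k : (zz p k)`_0 = 'X^(p + k).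
Proof.
have c0 (P Q : {poly {poly R}}) : (P * Q)`_0 = P`_0 * Q`_0.
  by rewrite coefM big_ord_recl big_ord0 addr0 subn0.
have cX (P : {poly {poly R}}) n : (P ^+ n)`_0 = P`_0 ^+ n.
  by elim: n => [|n IH]; rewrite ?expr0 ?coef1// !exprS c0 IH.
rewrite /zz c0 !cX /polyz /polyzb coefD coefB !coefC !coefX /= addr0 subr0.
by rewrite exprD.
Qed.

Lemma Xf_Xn n : Xf 'X^n = moment 1 n.
Proof.
rewrite /Xf /Lf size_polyXn big_ord_recr /= coefXn eqxx mul1r big1 ?add0r// => j _.
by rewrite coefXn ltn_eqF ?mul0r.
Qed.

(* Stokes' formula for the weight of the upper half-plane. *)
Lemma L_h_rec p k : L hC (zz p k.+1) - k%:R * L hC (zz p k.-1)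
  = 'i%C * ((moment 1 (p + k))%:C - (erfc_const R)%:C / 2 * L gC (zz p k)).
Proof.
have two : (2 : C) != 0 by rewrite pnatr_eq0.
have e1 : L hC (dX (zz p k) - (zz p k)^`()) = 2 * (k%:R * L hC (zz p k.-1)).
  by rewrite zz_diff !LMn.
have e2 : L hC (zz p k)^`() = 2 * L hC ('X * zz p k) + (2 * 'i%C * (moment 1 (p + k))%:C
    + - ('i%C * (erfc_const R)%:C) * L gC (zz p k)).
  rewrite L_dY (eq_L _ hC_rec) (L_lin 2 (fun j => hC j.+1)) -L_Y.
  rewrite (@eq_L (fun j => 2 * 'i%C * (j == 0%N)%:R + - ('i%C * (erfc_const R)%:C) * gC j)
    (fun j => - ('i%C * (erfc_const R)%:C) * gC j
    + 2 * 'i%C * (j == 0%N)%:R)); last by move=> j; exact: addrC.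
  by rewrite L_lin L_delta zz_coef0 /XfC Xf_Xn; ring.
apply: (mulfI two); rewrite mulrBr mulrA (_ : 2 * k%:R = k%:R * 2); last by rewrite mulrC.
rewrite -mulrA.
have {e1} <- : L hC (dX (zz p k) - (zz p k)^`()) = k%:R * (2 * L hC (zz p k.-1)).
  by rewrite e1; ring.
by rewrite LB zz_mulZb LB e2 L_dX; field.
Qed.

Lemma L_m_up p k : p%:R * L mC (zz p.-1 k) = L mC (zz p k.+1).
Proof.
have two : (2 : C) != 0 by rewrite pnatr_eq0.
have e2 : L mC (zz p k)^`() = - 2 * L mC ('X * zz p k).
  rewrite L_dY (eq_L _ mC_rec) L_Y /L /Lf mulr_sumr.
  by apply: eq_bigr => j _; ring.
apply: (mulfI two); rewrite -[p%:R * _]LMn -[LHS]LMn -zz_sum.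
by rewrite zz_mulZb LB LD e2 L_dX; ring.
Qed.

Lemma L_m_down p k : k%:R * L mC (zz p k.-1) = L mC (zz p.+1 k).
Proof.
have two : (2 : C) != 0 by rewrite pnatr_eq0.
have e2 : L mC (zz p k)^`() = - 2 * L mC ('X * zz p k).
  rewrite L_dY (eq_L _ mC_rec) L_Y /L /Lf mulr_sumr.
  by apply: eq_bigr => j _; ring.
apply: (mulfI two); rewrite -[k%:R * _]LMn -[LHS]LMn -zz_diff.
by rewrite zz_mulZ LB LD e2 L_dX; ring.
Qed.

(** Orthogonality of the monomials for e^(- |z|^2): the two preceding recursions lower both
    exponents together, until one of them is 0. *)
Lemma L_m p k : L mC (zz p k) = (p == k)%:R * p`!%:R * pi%:C.
Proof.
elim: p k => [|p IH] [|k].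
- rewrite eqxx fact0 !mul1r.
  rewrite /L (@Lf_wide _ _ _ XfCD 1); last by rewrite /zz mulr1 size_poly1.
  rewrite big_ord1 /zz mulr1 coef1 /= /XfC (_ : 1 = 'X^0)// Xf_Xn.
  by rewrite /mC expr0 mul1r -rmorphM /= moment_gauss -expr2 sqr_sqrtr ?pi_ge0.
- by rewrite -L_m_up !mul0r.
- by rewrite -L_m_down !mul0r.
- rewrite -L_m_down IH eqSS; case: eqP => [->|]; last by rewrite !mul0r mulr0.
  by rewrite factS natrM; ring.
Qed.

Lemma Lf_iC (h : nat -> R) Q : L (fun j => 'i%C ^+ j * (h j)%:C) Q
  = (\sum_(j < size Q) Xf Q`_j * (complex.Re ('i%C ^+ j : C) * h j)) +i*
    (\sum_(j < size Q) Xf Q`_j * (complex.Im ('i%C ^+ j : C) * h j)).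
Proof.
rewrite /L /Lf.
elim: (index_enum _) => [|j r IH]; first by rewrite !big_nil.
rewrite !big_cons IH /XfC; apply/eqP; rewrite eq_complex.
by case: ('i%C ^+ j) => re im; rewrite /=; apply/andP; split; apply/eqP; ring.
Qed.

(** The real part of ['i%C ^+ j] selects the even [j], for which |y|^j = y^j. The half-plane
    boundary term thus becomes a full Gaussian moment. *)
Lemma Re_L_gC Q : complex.Re (L gC Q) = complex.Re (L mC Q).
Proof.
rewrite !Lf_iC /=; apply: eq_bigr => j _; congr (_ * _).
have ipow n : 'i%C ^+ n.*2 = ((-1) ^+ n)%:C :> C.
  by rewrite -mul2n exprM expr2 i2 rmorphXn rmorphN1.
have [oj|ej] := boolP (odd j).
  rewrite -(odd_double_half j) oj exprS ipow /=.
  by rewrite /=; ring.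
congr (_ * _); rewrite /g_moment /moment; congr Rintegral; apply/funext => y.
by rewrite /ew real_normK ?num_real// -normrX ger0_norm// exprn_even_ge0.
Qed.

Lemma Re_L_gC_zz p k : complex.Re (L gC (zz p k)) = (p == k)%:R * p`!%:R * pi.
Proof. by rewrite Re_L_gC L_m -!(rmorph_nat (real_complex R)) -!rmorphM. Qed.

Lemma Im_L_hC_rec p k :
  complex.Im (L hC (zz p k.+1)) - k%:R * complex.Im (L hC (zz p k.-1))
  = moment 1 (p + k) - erfc_const R / 2 * ((p == k)%:R * p`!%:R * pi).
Proof.
have := congr1 (@complex.Im R) (L_h_rec p k); rewrite -Re_L_gC_zz.
rewrite -(rmorph_nat (real_complex R) k) -(rmorph_nat (real_complex R) 2) -fmorph_div.
case: (L hC _) (L hC _) (L gC _) => [a b] [c d] [e f] /= h.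
by apply: (etrans _ (etrans h _)); ring.
Qed.

End ComplexMoments.

Section PlaneMoments.
Variable R : realType.
Local Notation C := R[i].
Implicit Types (Q : {poly {poly R}}) (p k : nat).

Lemma linear_integral_sum X (I : (X -> R) -> R -> Prop) (hI : linear_integral I)
    n (g : 'I_n -> X -> R) (r : 'I_n -> R) : (forall j, I (g j) (r j)) ->
  I (fun x => \sum_(j < n) g j x) (\sum_(j < n) r j).
Proof.
move=> gr; elim: (index_enum _) => [|j s IH].
  rewrite big_nil; apply: (linear_integral_ext hI) (linear_integral0 hI) => x.
  by rewrite big_nil.
rewrite big_cons -[r j]mul1r.
apply: (linear_integral_ext hI) (linear_integral_lin hI 1 (gr j) IH) => x.
by rewrite big_cons mul1r.
Qed.

Lemma linear_integralZ X (I : (X -> R) -> R -> Prop) (hI : linear_integral I)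
    a g r : I g r -> I (fun x => a * g x) (a * r).
Proof.
move=> gr; have := linear_integral_lin hI a gr (linear_integral0 hI).
by rewrite addr0; apply: (linear_integral_ext hI) => x; rewrite addr0.
Qed.

Lemma realI_poly (P : {poly R}) : realI (fun u => P.[u] * ew 1 u) (Xf P).
Proof.
have lin := @realI_linear R.
have := @linear_integral_sum _ _ lin (size P) _ _ (fun j =>
  linear_integralZ lin P`_j (realI_moment j (@ltr01 R))).
apply: (linear_integral_ext lin) => u; rewrite horner_coef mulr_suml.
by apply: eq_bigr => j _; rewrite mulrA.
Qed.

(* [z = u +i* y] is substituted in [Q(u, 'i y)]. *)
Definition evalz Q (z : C) : C :=
  \sum_(j < size Q) 'i%C ^+ j * ((Q`_j).[complex.Re z] * complex.Im z ^+ j)%:C.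

Lemma evalz_zz p k (z : C) : evalz (polyz R ^+ p * polyzb R ^+ k) z
  = z ^+ p * conjc z ^+ k.
Proof.
pose phi : {rmorphism {poly R} -> C} := real_complex R \o horner_eval (complex.Re z).
pose w : C := 'i%C * (complex.Im z)%:C.
have e Q : evalz Q z = (map_poly phi Q).[w].
  rewrite (horner_coef_wide _ (size_poly _ _)); apply: eq_bigr => j _.
  rewrite coef_map /= /horner_eval exprMn real_complexM.
  by rewrite -(rmorphXn (real_complex R)) /=; ring.
rewrite e rmorphM !rmorphXn rmorphD rmorphB /= map_polyC map_polyX /=.
rewrite /horner_eval hornerX !hornerE.
by congr (_ ^+ _ * _ ^+ _); rewrite /w; case: z {phi w e} => a b; apply/eqP;
  rewrite eq_complex /=; apply/andP; split; apply/eqP; ring.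
Qed.

Lemma planeI_evalz Q :
  planeI (fun z => ew 1 (complex.Re z) * hw `|complex.Im z|
    * complex.Im (evalz Q (complex.Re z +i* `|complex.Im z|)))
  (complex.Im (L (hC R) Q)).
Proof.
have lin := @planeI_linear R; rewrite Lf_iC /=.
have := @linear_integral_sum _ _ lin (size Q) _ _ (fun j =>
  planeI_prod (realI_poly Q`_j)
   (linear_integralZ (@realI_linear R) (complex.Im ('i%C ^+ j : C)) (@realI_h_moment R j))).
apply: (linear_integral_ext lin) => z.
rewrite /evalz /= (raddf_sum (@complex.Im R : {additive C -> R})) mulr_sumr.
apply: eq_bigr => j _; case: ('i%C ^+ j) => re im /=; ring.
Qed.

Lemma upperE (z : C) : upper z = complex.Re z +i* `|complex.Im z|.
Proof.
rewrite /upper; case: z => a b /=; case: ltP => b0; first by rewrite gtr0_norm.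
by rewrite ler0_norm.
Qed.

Definition pairC p k (z : C) : R :=
  - 2 * (ew 1 (complex.Re z) * hw (complex.Im z) * complex.Im (z ^+ p * conjc z ^+ k)).

Definition HC p k : R := - 2 * complex.Im (L (hC R) (polyz R ^+ p * polyzb R ^+ k)).

Lemma planeI_pairC p k : planeI (fun z => pairC p k (upper z)) (HC p k).
Proof.
have lin := @planeI_linear R.
have := linear_integralZ lin (- 2) (planeI_evalz (polyz R ^+ p * polyzb R ^+ k)).
apply: (linear_integral_ext lin) => z.
by rewrite evalz_zz upperE.
Qed.

Lemma pairCN p k z : pairC k p z = - pairC p k z.
Proof.
rewrite /pairC; have -> : z ^+ k * conjc z ^+ p = conjc (z ^+ p * conjc z ^+ k).
  by rewrite conjcM !conjcX conjcK mulrC.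
by case: (z ^+ p * _) => a b /=; ring.
Qed.

Lemma HCN p k : HC k p = - HC p k.
Proof.
have lin := @planeI_linear R.
apply: (planeI_uniq (planeI_pairC k p)).
rewrite -mulN1r; apply: (linear_integral_ext lin)
  (linear_integralZ lin (-1) (planeI_pairC p k)) => z.
by rewrite mulN1r -pairCN.
Qed.

Lemma u_v_pairC M (z : C) (p q : 'I_(2 * M)) :
  u_cplx M z 0 p * v_cplx M z 0 q - v_cplx M z 0 p * u_cplx M z 0 q
  = (pairC p q z)%:C.
Proof.
rewrite !mxE; set w := half_weight z.
have ww : w * conjc w = (ew 1 (complex.Re z) * hw (complex.Im z))%:C.
  rewrite /w /half_weight conjcM conjc_real mulrACA cexp_mulJ.
  rewrite -!real_complexM -expr2 sqr_sqrtr ?erfc_ge0// /hw /herfc /erfcI mulrA.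
  congr (_ * _)%:C; rewrite -expRD.
  by congr expR; case: z {w} => a b; rewrite /= !expr2 /=; field.
have -> : w * z ^+ p * ('i%C * conjc w * conjc z ^+ q) -
   'i%C * conjc w * conjc z ^+ p * (w * z ^+ q)
  = (w * conjc w) * ('i%C * (z ^+ p * conjc z ^+ q - conjc (z ^+ p * conjc z ^+ q))).
  by rewrite conjcM !conjcX conjcK; ring.
rewrite ww /pairC; case: (z ^+ p * _) => a b; apply/eqP; rewrite eq_complex /=.
by apply/andP; split; apply/eqP; ring.
Qed.

(** This serves the last index k = N - 1 of the Gram relation, where k + 1 is out of range and the
    recursion cannot be used directly; as N is even, k - 1 is even. *)
Lemma skew_rec_even (h : nat -> nat -> R) c : (forall p k, h k p = - h p k) ->
  (forall p k, h p k.+1 = k%:R * h p k.-1 + (p == k)%:R * c * k`!%:R) ->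
  forall m, (forall p, (p <= m.*2)%N -> h p m.*2 = 0)
    /\ h m.*2.+1 m.*2 = - (c * (m.*2)`!%:R).
Proof.
move=> hN hS.
have h0 p : h p p = 0.
  by have := hN p p; lra.
elim=> [|m [IH1 IH2]]; split.
- by case=> // _; exact: h0.
- by rewrite hN hS mul0r add0r mul1r.
- move=> p; rewrite doubleS leq_eqVlt => /predU1P[->|]; first exact: h0.
  rewrite ltnS hS /= leq_eqVlt => /predU1P[->|].
    by rewrite IH2 eqxx mul1r factS natrM; ring.
  by rewrite ltnS => pm; rewrite IH1// ltn_eqF ?ltnS// mulr0 !mul0r addr0.
- rewrite doubleS hN hS eqxx /= [h m.*2.+2 _]hN hS /= eqxx IH2 !mul1r factS natrM.
  by rewrite !factS !natrM; ring.
Qed.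

Definition HR p k : R := 2 * J R p k.

Let erfc_const_pi : erfc_const R * pi * (Num.sqrt (2 * pi))^-1 = 2.
Proof.
have pi0 := pi_gt0 R; have s0 : Num.sqrt pi != 0 :> R by rewrite gt_eqF ?sqrtr_gt0.
have t0 : Num.sqrt 2 != 0 :> R by rewrite gt_eqF ?sqrtr_gt0.
have sq : pi = Num.sqrt pi ^+ 2 :> R by rewrite sqr_sqrtr// ltW.
rewrite /erfc_const sqrtrM// [X in _ * X * _]sq; field.
by rewrite s0.
Qed.

Lemma Gram M (p k : 'I_(2 * M)) :
  \sum_(q < 2 * M) (HR p q + HC p q)%:C * tri R M k q = 2 * (p == k)%:R.
Proof.
pose c := erfc_const R * pi; pose kappa : R := (Num.sqrt (2 * pi))^-1.
have ck : c * kappa = 2 by exact: erfc_const_pi.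
pose h p q := HR p q + HC p q.
have hN a b : h b a = - h a b by rewrite /h /HR J_antisym HCN; ring.
(* The boundary terms [moment 1 (a + b)] of the real and the complex recursion enter with factors 2
   and -2 and cancel; only the diagonal term survives. *)
have hS a b : h a b.+1 = b%:R * h a b.-1 + (a == b)%:R * c * b`!%:R.
  rewrite /h /HR /HC.
  have := J_rec R a b; have := Im_L_hC_rec R a b.
  have -> : (a == b)%:R * a`!%:R * pi = (a == b)%:R * b`!%:R * pi :> R.
    by case: eqP => [->|]; rewrite ?mul0r.
  rewrite /c => e1 e2.
  have {}e1 := canRL (subrK _) e1; have {}e2 := canRL (subrK _) e2.
  by rewrite e1 e2; field.
have fact0 b : b`!%:R != 0 :> R by rewrite pnatr_eq0 -lt0n fact_gt0.
transitivity (\sum_(q < 2 * M) h p q * (kappa *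
    ((q == k.+1 :> nat)%:R / k`!%:R - (k == q.+1 :> nat)%:R / q`!%:R)))%:C.
  rewrite rmorph_sum; apply: eq_bigr => q _; rewrite !mxE [RHS]real_complexM.
  congr (_ * _); rewrite real_complexM rmorphB !rmorphM !fmorphV.
  by rewrite !rmorph_nat.
rewrite -(rmorph_nat (real_complex R) 2) -(rmorph_nat (real_complex R) (p == k)).
rewrite -real_complexM; congr (_%:C).
pose T1 := \sum_(q < 2 * M) (q == k.+1 :> nat)%:R * h p q.
pose T2 := \sum_(q < 2 * M) (k == q.+1 :> nat)%:R * (h p q / q`!%:R).
transitivity (kappa * (T1 / k`!%:R - T2)).
  rewrite mulrBr /T1 /T2 mulr_suml !mulr_sumr -sumrB.
  by apply: eq_bigr => q _; ring.
have t2 : T2 = k%:R * h p k.-1 / k`!%:R.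
  rewrite /T2; case: k {T1 T2} => [[|k] kM] /=.
    by rewrite big1 ?mul0r// => q _; rewrite mul0r.
  rewrite (bigD1 (Ordinal (ltnW kM)))//= eqxx mul1r big1 ?addr0.
    have k1 : k.+1%:R != 0 :> R by rewrite pnatr_eq0.
    by rewrite factS natrM invfM mulrACA divff// mul1r.
  move=> q /eqP qk; rewrite eqSS; case: eqP => [e|]; rewrite ?mul0r//.
  by case: qk; exact: val_inj.
have [kM|Mk] := ltnP k.+1 (2 * M).
  have -> : T1 = h p k.+1.
    rewrite /T1 (bigD1 (Ordinal kM))//= eqxx mul1r big1 ?addr0// => q /eqP qk.
    by case: eqP => [e|]; rewrite ?mul0r//; case: qk; exact: val_inj.
  rewrite t2 hS (_ : (p == k :> nat) = (p == k))//.
  by rewrite -ck; field.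
have -> : T1 = 0.
  rewrite /T1 big1// => q _; rewrite ltn_eqF ?mul0r//.
  exact: leq_trans (ltn_ord q) Mk.
have ek : (k : nat) = (M.-1).*2.+1.
  have M0 : (0 < M)%N by have := leq_ltn_trans (leq0n k) (ltn_ord k); case: (M).
  move: (nat_of_ord k) (ltn_ord k) Mk => n; rewrite -(prednK M0) mulnS mul2n /=.
  by rewrite add2n ltnS => nM Mn; apply/eqP; rewrite eqn_leq nM.
have [h1 h2] := skew_rec_even hN hS M.-1.
have pM : (p <= M.-1.*2.+1)%N.
  by rewrite -ek -ltnS (leq_trans (ltn_ord p)).
rewrite t2 ek /= mul0r sub0r (_ : (p == k) = (p == M.-1.*2.+1 :> nat)); last by rewrite -ek.
move: pM; rewrite leq_eqVlt => /predU1P[->|pM].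
  rewrite h2 eqxx mulr1 -ck factS natrM; field.
  by rewrite fact0 nat1r pnatr_eq0.
by rewrite (ltn_eqF pM) (h1 p)// !mulr0 mul0r oppr0 mulr0.
Qed.

End PlaneMoments.

(** * Correlation functions *)

Section MeasurableSequences.
Variable R : realType.
Local Notation C := R[i].
Local Notation mu := (@lebesgue_measure R).

Section MeasurableFamilies.
Variables (d : measure_display) (P : measurableType d).
Implicit Types (f g : P -> C).

Definition cmeas f : Prop :=
  measurable_fun [set: P] (fun p => complex.Re (f p) : R)
  /\ measurable_fun [set: P] (fun p => complex.Im (f p) : R).

(** The length is constant in the parameter; an index beyond it gives the default 0, so all [i] can
    be allowed. *)
Definition mseqR (xs : P -> seq R) : Prop := exists n,
  (forall p, size (xs p) = n)
  /\ forall i, measurable_fun [set: P] (fun p => (xs p)`_i : R).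

Definition mseqC (zs : P -> seq C) : Prop := exists n,
  (forall p, size (zs p) = n) /\ forall i, cmeas (fun p => (zs p)`_i).

Let measurable_ext (f g : P -> R) : f =1 g ->
  measurable_fun [set: P] f -> measurable_fun [set: P] g.
Proof. by move=> /funext->. Qed.

Lemma cmeas_cst (c : C) : cmeas (fun=> c).
Proof. by split; exact: measurable_cst. Qed.

Lemma cmeasD f g : cmeas f -> cmeas g -> cmeas (fun p => f p + g p).
Proof.
move=> [f1 f2] [g1 g2]; split.
  by apply: measurable_ext (measurable_funD f1 g1) => p /=; case: (f p) (g p) => ? ? [? ?].
by apply: measurable_ext (measurable_funD f2 g2) => p /=; case: (f p) (g p) => ? ? [? ?].
Qed.

Lemma cmeasM f g : cmeas f -> cmeas g -> cmeas (fun p => f p * g p).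
Proof.
move=> [f1 f2] [g1 g2]; split.
  apply: measurable_ext (measurable_funB (measurable_funM f1 g1) (measurable_funM f2 g2)).
  by move=> p /=; case: (f p) (g p) => ? ? [? ?].
apply: measurable_ext (measurable_funD (measurable_funM f1 g2) (measurable_funM f2 g1)).
by move=> p /=; case: (f p) (g p) => ? ? [? ?].
Qed.

Lemma cmeas_sum I (r : seq I) (f : I -> P -> C) : (forall i, cmeas (f i)) ->
  cmeas (fun p => \sum_(i <- r) f i p).
Proof.
move=> fm; elim: r => [|i r IH].
  by rewrite (_ : (fun _ => _) = fun=> 0); [exact: cmeas_cst|apply/funext => p; rewrite big_nil].
rewrite (_ : (fun _ => _) = fun p => f i p + \sum_(j <- r) f j p); first exact: cmeasD.
by apply/funext => p; rewrite big_cons.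
Qed.

Lemma cmeas_prod I (r : seq I) (f : I -> P -> C) : (forall i, cmeas (f i)) ->
  cmeas (fun p => \prod_(i <- r) f i p).
Proof.
move=> fm; elim: r => [|i r IH].
  by rewrite (_ : (fun _ => _) = fun=> 1); [exact: cmeas_cst|apply/funext => p; rewrite big_nil].
rewrite (_ : (fun _ => _) = fun p => f i p * \prod_(j <- r) f j p); first exact: cmeasM.
by apply/funext => p; rewrite big_cons.
Qed.

Lemma cmeas_exp f n : cmeas f -> cmeas (fun p => f p ^+ n).
Proof.
move=> fm; rewrite (_ : (fun _ => _) = fun p => \prod_(i < n) f p); first exact: cmeas_prod.
by apply/funext => p; rewrite prodr_const card_ord.
Qed.

Lemma cmeas_conj f : cmeas f -> cmeas (fun p => conjc (f p)).
Proof.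
move=> [f1 f2]; split.
  by apply: measurable_ext f1 => p /=; case: (f p).
by apply: measurable_ext (measurableT_comp (@oppr_measurable R setT) f2) => p /=; case: (f p).
Qed.

Lemma cmeas_norm f : cmeas f -> measurable_fun [set: P] (fun p => complex.Re `|f p| : R).
Proof.
move=> [f1 f2]; rewrite (_ : (fun _ => _) = fun p => Num.sqrt
  (complex.Re (f p) ^+ 2 + complex.Im (f p) ^+ 2)).
  apply: (@measurableT_comp _ _ _ _ _ _ (@Num.sqrt R)).
    by apply: continuous_measurable_fun => x; exact: sqrt_continuous.
  by apply: measurable_funD; apply: measurable_funX.
by apply/funext => p /=; case: (f p).
Qed.

Lemma cmeas_eigenvalues xs zs i : mseqR xs -> mseqC zs ->
  cmeas (fun p => (eigenvalues (xs p) (zs p))`_i).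
Proof.
move=> [n [nx xm]] [k [kz zm]].
have nth_pairs (s : seq C) j : (flatten [seq [:: t; conjc t] | t <- s])`_j
    = if odd j then conjc s`_j./2 else s`_j./2.
  elim: s j => [j|t s IH [|[|j]]] //; last by rewrite /= IH negbK.
  by rewrite !nth_nil conjc0 if_same.
have [ik|ki] := ltnP i n.
  rewrite (_ : (fun _ => _) = fun p => ((xs p)`_i)%:C).
    by split; [exact: xm|exact: measurable_cst].
  by apply/funext => p; rewrite nth_cat size_map nx ik (nth_map 0) ?nx.
rewrite (_ : (fun _ => _) = fun p => if odd (i - n) then conjc (zs p)`_(i - n)./2
  else (zs p)`_(i - n)./2).
  by case: odd => //; exact: cmeas_conj.
by apply/funext => p; rewrite nth_cat size_map nx ltnNge ki /= nth_pairs.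
Qed.

Lemma size_eigenvalues (x : seq R) (z : seq C) :
  size (eigenvalues x z) = (size x + 2 * size z)%N.
Proof. by rewrite size_cat size_map size_pairs. Qed.

Lemma measurable_weightC : measurable_fun [set: R * R] (fun u => weightC (u.1 +i* u.2)).
Proof.
apply: measurable_funM.
  apply: (measurableT_comp (@measurable_expR R)) => /=.
  rewrite (_ : (fun _ => _) = fun u : R * R => - (u.1 ^+ 2 - u.2 ^+ 2)).
    apply: measurableT_comp => //; apply: measurable_funB; apply: measurable_funX;
    [exact: measurable_fst|exact: measurable_snd].
  by apply/funext => -[a b] /=; rewrite !expr2 /=; field.
apply: (measurableT_comp (f := @herfc R)).
  by apply: continuous_measurable_fun; exact: continuous_herfc.
by apply: (measurableT_comp (@normr_measurable R setT)) => //; exact: measurable_snd.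
Qed.

Lemma measurable_Omega xs zs : mseqR xs -> mseqC zs ->
  measurable_fun [set: P] (fun p => Omega (xs p) (zs p)).
Proof.
move=> xm zm; have [n [nx xm']] := xm; have [k [kz zm']] := zm.
(* The size of the Vandermonde matrix depends on the lists; the Leibniz formula over one fixed
   symmetric group exposes the measurable entries. *)
have e p : Omega (xs p) (zs p) = 2 ^+ k * (\prod_(i < n) weightR (xs p)`_i)
    * (\prod_(i < k) weightC (zs p)`_i)
    * complex.Re `|\sum_(s : 'S_(n + 2 * k)) (-1) ^+ s *
      \prod_(i < n + 2 * k) (eigenvalues (xs p) (zs p))`_(s i) ^+ i|.
  rewrite /Omega kz [\prod_(t <- xs p) _](big_nth 0) [\prod_(t <- zs p) _](big_nth 0)
    nx kz !big_mkord.
  congr (_ * complex.Re `|_|); rewrite /vdm_det.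
  move: (size_eigenvalues (xs p) (zs p)); rewrite nx kz => <-.
  by apply: eq_bigr => s _; congr (_ * _); apply: eq_bigr => i _; rewrite !mxE.
apply: (measurable_ext (fun p => esym (e p))).
apply: measurable_funM; first apply: measurable_funM; first apply: measurable_funM.
- exact: measurable_cst.
- apply: measurable_prod => i _; apply: (measurableT_comp (f := @weightR R)) (xm' i).
  rewrite (_ : @weightR R = ew 2^-1); last by apply/funext => t; exact: weightR_ew.
  by apply: continuous_measurable_fun; exact: continuous_ew.
- apply: measurable_prod => i _.
  have [m1 m2] := zm' i.
  have := measurableT_comp measurable_weightC (measurable_fun_pair m1 m2).
  by apply: measurable_ext => p /=; case: (_`_i).
- apply: cmeas_norm; apply: cmeas_sum => s; apply: cmeasM; first exact: cmeas_cst.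
  by apply: cmeas_prod => i; apply: cmeas_exp; exact: cmeas_eigenvalues.
Qed.

End MeasurableFamilies.

Section Composition.
Context d d' (P : measurableType d) (P' : measurableType d') (phi : P' -> P).
Hypothesis mphi : measurable_fun [set: P'] phi.

Lemma mseqR_comp xs : mseqR xs -> mseqR (xs \o phi).
Proof.
move=> [n [nx xm]]; exists n; split=> [p|i]; first exact: nx.
exact: measurableT_comp (xm i) mphi.
Qed.

Lemma mseqC_comp zs : mseqC zs -> mseqC (zs \o phi).
Proof.
move=> [n [nz zm]]; exists n; split=> [p|i]; first exact: nz.
have [m1 m2] := zm i.
by split; [exact: measurableT_comp m1 mphi|exact: measurableT_comp m2 mphi].
Qed.

End Composition.

Section Rcons.
Context d (P : measurableType d).

Lemma mseqR_rcons xs (f : P -> R) : mseqR xs -> measurable_fun [set: P] f ->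
  mseqR (fun p => rcons (xs p) (f p)).
Proof.
move=> [n [nx xm]] fm; exists n.+1; split=> [p|i]; first by rewrite size_rcons nx.
rewrite (_ : (fun _ => _) = fun p => if (i < n)%N then (xs p)`_i
  else if i == n then f p else 0).
  case: ltnP => _; first exact: xm.
  by case: eqP => // _; exact: measurable_cst.
by apply/funext => p; rewrite nth_rcons nx.
Qed.

Lemma mseqC_rcons zs (f : P -> C) : mseqC zs -> cmeas f ->
  mseqC (fun p => rcons (zs p) (f p)).
Proof.
move=> [n [nz zm]] fm; exists n.+1; split=> [p|i]; first by rewrite size_rcons nz.
rewrite (_ : (fun _ => _) = fun p => if (i < n)%N then (zs p)`_i
  else if i == n then f p else 0).
  case: ltnP => _; first exact: zm.
  by case: eqP => // _; exact: cmeas_cst.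
by apply/funext => p; rewrite nth_rcons nz.
Qed.

End Rcons.

(** Joint measurability is tested along all measurable families of lists, over an arbitrary
    parameter space. In this form an integration variable can be absorbed into the parameters. *)
Definition jmeas (h : seq R -> seq C -> \bar R) : Prop :=
  forall (d : measure_display) (P : measurableType d) (xs : P -> seq R) (zs : P -> seq C),
    mseqR xs -> mseqC zs -> measurable_fun [set: P] (fun p => h (xs p) (zs p)).

Definition nonneg2 (h : seq R -> seq C -> \bar R) : Prop :=
  forall x z, (0 <= h x z)%E.

Section IteratedIntegrals.
Variable h : seq R -> seq C -> \bar R.
Hypotheses (hm : jmeas h) (h0 : nonneg2 h).

Let hR x z := intR (fun t => h (rcons x t) z).
Let hC x z := intC (fun c => h x (rcons z c)).

Section WithParameters.
Context d (P : measurableType d) (xs : P -> seq R) (zs : P -> seq C).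
Hypotheses (xm : mseqR xs) (zm : mseqC zs).

Lemma measurable_rconsR :
  measurable_fun [set: P * R] (fun q => h (rcons (xs q.1) q.2) (zs q.1)).
Proof.
apply: hm.
  by apply: mseqR_rcons; [exact: mseqR_comp measurable_fst _ xm|exact: measurable_snd].
exact: mseqC_comp measurable_fst _ zm.
Qed.

Lemma measurable_rconsC : measurable_fun [set: P * R * R]
  (fun q => h (xs q.1.1) (rcons (zs q.1.1) (q.1.2 +i* q.2))).
Proof.
have m1 : measurable_fun [set: P * R * R] (fun q => q.1.1).
  exact: measurableT_comp measurable_fst measurable_fst.
apply: hm; first exact: mseqR_comp m1 _ xm.
apply: mseqC_rcons; first exact: mseqC_comp m1 _ zm.
split=> /=; last exact: measurable_snd.
exact: measurableT_comp measurable_snd measurable_fst.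
Qed.

Lemma measurable_rconsC_inner : measurable_fun [set: P * R]
  (fun q => \int[mu]_v h (xs q.1) (rcons (zs q.1) (q.2 +i* v)))%E.
Proof.
exact: (measurable_fun_fubini_tonelli_F (m2 := mu) (fun q : (P * R) * R =>
  h (xs q.1.1) (rcons (zs q.1.1) (q.1.2 +i* q.2))) measurable_rconsC (fun q => h0 _ _)).
Qed.

End WithParameters.

Lemma jmeas_intR : jmeas hR.
Proof.
move=> d P xs zs xm zm.
exact: (measurable_fun_fubini_tonelli_F (m2 := mu)
  (fun q => h (rcons (xs q.1) q.2) (zs q.1)) (measurable_rconsR xm zm) (fun q => h0 _ _)).
Qed.

Lemma jmeas_intC : jmeas hC.
Proof.
move=> d P xs zs xm zm.
apply: (measurable_fun_fubini_tonelli_F (m2 := mu)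
  (fun q => \int[mu]_v h (xs q.1) (rcons (zs q.1) (q.2 +i* v)))%E
  (measurable_rconsC_inner xm zm)).
by move=> q; exact: integral_ge0.
Qed.

Lemma nonneg2_intR : nonneg2 hR.
Proof. by move=> x z; exact: integral_ge0. Qed.

Lemma nonneg2_intC : nonneg2 hC.
Proof. by move=> x z; apply: integral_ge0 => u _; exact: integral_ge0. Qed.

End IteratedIntegrals.

End MeasurableSequences.

(** * Tonelli's theorem and the recursion for the sums of integrals *)

Section Tonelli.
Variable R : realType.
Local Notation C := R[i].
Local Notation mu := (@lebesgue_measure R).
Implicit Types (x : seq R) (z : seq C).

Lemma mseqR_cst d (P : measurableType d) x : mseqR (fun _ : P => x).
Proof. by exists (size x); split=> // i; exact: measurable_cst. Qed.

Lemma mseqC_cst d (P : measurableType d) z : mseqC (fun _ : P => z).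
Proof. by exists (size z); split=> // i; exact: cmeas_cst. Qed.

(** The plane integral is a pair of line integrals, so Tonelli's theorem is applied twice. *)
Lemma intR_intC (h : seq R -> seq C -> \bar R) x z : jmeas h -> nonneg2 h ->
  intR (fun t => intC (fun c => h (rcons x t) (rcons z c)))
  = intC (fun c => intR (fun t => h (rcons x t) (rcons z c))).
Proof.
move=> hm h0; rewrite /intR /intC.
have xm : mseqR (fun t : R => rcons x t).
  exact: (mseqR_rcons (mseqR_cst _ x) (@measurable_id _ R setT)).
rewrite (fubini_tonelli (m1 := mu) (m2 := mu) (fun q : R * R =>
  \int[mu]_v h (rcons x q.1) (rcons z (q.2 +i* v)))%E).
- apply: eq_integral => u _.
  rewrite (fubini_tonelli (m1 := mu) (m2 := mu) (fun q : R * R =>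
    h (rcons x q.1) (rcons z (u +i* q.2))))//.
  apply: hm.
    exact: mseqR_rcons (mseqR_cst _ x) measurable_fst.
  apply: mseqC_rcons (mseqC_cst _ z) _; split; first exact: measurable_cst.
  exact: measurable_snd.
- exact: measurable_rconsC_inner hm h0 _ _ _ _ xm (mseqC_cst _ z).
- by move=> q; exact: integral_ge0.
Qed.

Definition Tint x z a b : \bar R :=
  iterated_int (@intR R) a (fun s =>
    iterated_int (@intC R) b (fun w => (Omega (x ++ s) (z ++ w))%:E)).

Lemma TintR x z a b : Tint x z a.+1 b = intR (fun t => Tint (rcons x t) z a b).
Proof.
rewrite /Tint /=; congr intR; apply/funext => t; congr iterated_int.
by apply/funext => s; congr iterated_int; apply/funext => w; rewrite cat_rcons.
Qed.

Let Tint0C x z b : Tint x z 0 b.+1 = intC (fun c => Tint x (rcons z c) 0 b).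
Proof.
rewrite /Tint /=; congr intC; apply/funext => c; congr iterated_int.
by apply/funext => w; rewrite cat_rcons.
Qed.

Let Omega_ge0 x z : 0 <= Omega x z.
Proof.
rewrite /Omega !mulr_ge0 ?exprn_ge0 ?prodr_ge0// => [t _|t _|]; first exact: expR_ge0.
  by rewrite mulr_ge0 ?expR_ge0 ?erfc_ge0.
by have := normr_ge0 (vdm_det (eigenvalues x z)); rewrite lecE => /andP[].
Qed.

Lemma Tint_ge0 a b : nonneg2 (fun x z => Tint x z a b).
Proof.
elim: a => [|a IH]; last first.
  by move=> x z; rewrite TintR; exact: (nonneg2_intR IH).
elim: b => [x z|b IH x z]; first by rewrite /Tint /= lee_fin.
by rewrite Tint0C; exact: (nonneg2_intC IH).
Qed.

Lemma Tint_jmeas a b : jmeas (fun x z => Tint x z a b).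
Proof.
elim: a => [|a IH]; last first.
  rewrite (_ : (fun _ _ => _) = fun x z => intR (fun t => Tint (rcons x t) z a b)).
    exact: (jmeas_intR IH (@Tint_ge0 a b)).
  by apply/funext => x; apply/funext => z; rewrite TintR.
elim: b => [|b IH].
  move=> d P xs zs xm zm; apply/measurable_EFinP.
  by under eq_fun do rewrite !cats0; exact: measurable_Omega.
rewrite (_ : (fun _ _ => _) = fun x z => intC (fun c => Tint x (rcons z c) 0 b)).
  exact: (jmeas_intC IH (@Tint_ge0 0 b)).
by apply/funext => x; apply/funext => z; rewrite Tint0C.
Qed.

(** The first complex integral is carried outwards through the [a] real ones, one at a time. *)
Lemma TintC x z a b : Tint x z a b.+1 = intC (fun c => Tint x (rcons z c) a b).
Proof.
elim: a x z => [|a IH] x z; first exact: Tint0C.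
rewrite TintR; transitivity (intR (fun t => intC (fun c => Tint (rcons x t) (rcons z c) a b))).
  by congr intR; apply/funext => t; exact: IH.
rewrite (intR_intC x z (@Tint_jmeas a b) (@Tint_ge0 a b)).
by congr intC; apply/funext => c; rewrite TintR.
Qed.

Lemma intR_sum I (r : seq I) (k : I -> R) (g : I -> R -> \bar R) :
  (forall i, 0 <= k i) -> (forall i, measurable_fun [set: R] (g i)) ->
  (forall i t, (0 <= g i t)%E) ->
  intR (fun t => \sum_(i <- r) (k i)%:E * g i t)%E
  = (\sum_(i <- r) (k i)%:E * intR (g i))%E.
Proof.
move=> k0 gm g0; rewrite /intR ge0_integral_sum//.
- apply: eq_bigr => i _; rewrite ge0_integralZl//.
    exact: gm.
  by rewrite lee_fin.
- by move=> i; exact: (measurable_funeM _ (gm i)).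
- by move=> i t _; rewrite mule_ge0// lee_fin.
Qed.

Lemma intC_sum I (r : seq I) (k : I -> R) (g : I -> C -> \bar R) :
  (forall i, 0 <= k i) ->
  (forall i, measurable_fun [set: R * R] (fun q => g i (q.1 +i* q.2))) ->
  (forall i t, (0 <= g i t)%E) ->
  intC (fun t => \sum_(i <- r) (k i)%:E * g i t)%E
  = (\sum_(i <- r) (k i)%:E * intC (g i))%E.
Proof.
move=> k0 gm g0; rewrite /intC.
have gv i u : measurable_fun [set: R] (fun v => g i (u +i* v)).
  exact: measurableT_comp (gm i) (measurable_pair1 u).
transitivity (\int[mu]_u \sum_(i <- r) (k i)%:E * \int[mu]_v g i (u +i* v))%E.
  by apply: eq_integral => u _; exact: intR_sum.
apply: (@intR_sum _ _ _ (fun i u => \int[mu]_v g i (u +i* v))%E) => //.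
  move=> i; exact: (measurable_fun_fubini_tonelli_F (m2 := mu)
    (fun q => g i (q.1 +i* q.2)) (gm i) (fun q => g0 i _)).
by move=> i t; exact: integral_ge0.
Qed.

Section Recursion.
Variable M : nat.

(** Being 0 outside the admissible range, it allows a sum over all [L], [K] and hides the truncated
    subtractions. *)
Definition corr_coef l m L K : R :=
  if (L + 2 * K == 2 * M)%N && (l <= L)%N && (m <= K)%N
  then (((L - l)`! * (K - m)`! * 2 ^ (K - m))%N%:R)^-1 else 0.

Lemma corr_coef_ge0 l m L K : 0 <= corr_coef l m L K.
Proof. by rewrite /corr_coef; case: ifP; rewrite // invr_ge0. Qed.

Lemma corr_sumE x z : corr_sum M x z
  = (\sum_(p : 'I_(2 * M).+1 * 'I_M.+1)
      (corr_coef (size x) (size z) p.1 p.2)%:E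
      * Tint x z (p.1 - size x) (p.2 - size z))%E.
Proof.
rewrite /corr_sum; under eq_bigr do rewrite big_mkcond.
rewrite pair_bigA; apply: eq_bigr => -[L K] _ /=; rewrite /corr_coef.
by case: ifP; rewrite ?mul0e.
Qed.

(** With a = L - l and b = K - m, fixing one more real point multiplies the coefficient by a, and
    fixing one more pair by 2 b, the 2 coming from [2 ^ (K - m)]. On the support a + 2 b is the
    number of eigenvalues left. *)
Lemma corr_coef_step l m L K :
  corr_coef l.+1 m L K + corr_coef l m.+1 L K
  = (2 * M - (l + 2 * m))%N%:R * corr_coef l m L K.
Proof.
have fact_neq0 n : n`!%:R != 0 :> R by rewrite pnatr_eq0 -lt0n fact_gt0.
have two0 n : (2 ^ n)%:R != 0 :> R by rewrite pnatr_eq0 expn_eq0.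
rewrite /corr_coef; case: (eqVneq (L + 2 * K)%N (2 * M)%N) => [e|_] /=; last first.
  by rewrite addr0 mulr0.
have [lL|Ll] := leqP l L; last by rewrite ltnNge (ltnW Ll) /= addr0 mulr0.
have [mK|Km] := leqP m K; last first.
  by rewrite andbF (leq_gtF (ltnW Km)) /= addr0 mulr0.
rewrite /= andbT -e -(subnK lL) -(subnK mK).
move: (L - l)%N (K - m)%N => a b {e lL mK}; rewrite !addnK.
have -> : (a + l + 2 * (b + m) - (l + 2 * m))%N = (a + 2 * b)%N.
  by rewrite mulnDr addnACA addnK.
have s n k : (k < n + k)%N = (0 < n)%N by rewrite -[X in (X < _)%N]add0n ltn_add2r.
rewrite !s; have sub n k : (n + k - k.+1)%N = n.-1 by rewrite -addn1 addnC subnDl subn1.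
rewrite !sub; case: a b => [|a] [|b] /=;
  rewrite ?fact0 ?expn0 ?muln1 ?mul1n ?muln0 ?addn0 ?add0r ?addr0 ?mul0r//.
- rewrite add0n factS expnS !natrM; field.
  by rewrite fact_neq0 two0 nat1r pnatr_eq0.
- rewrite factS !natrM; field.
  by rewrite fact_neq0 nat1r pnatr_eq0.
- rewrite !factS expnS natrD !natrM; field.
  by rewrite !fact_neq0 two0 !nat1r !pnatr_eq0.
Qed.

Lemma corr_sum_step x z :
  (intR (fun t => corr_sum M (rcons x t) z) + intC (fun c => corr_sum M x (rcons z c))
  = (2 * M - (size x + 2 * size z))%N%:R%:E * corr_sum M x z)%E.
Proof.
set l := size x; set m := size z.
have -> : intR (fun t => corr_sum M (rcons x t) z)
  = (\sum_(p : 'I_(2 * M).+1 * 'I_M.+1)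
      (corr_coef l.+1 m p.1 p.2)%:E * Tint x z (p.1 - l) (p.2 - m))%E.
  transitivity (\sum_(p : 'I_(2 * M).+1 * 'I_M.+1) (corr_coef l.+1 m p.1 p.2)%:E
    * intR (fun t => Tint (rcons x t) z (p.1 - l.+1) (p.2 - m)))%E.
    rewrite -intR_sum//; last 3 first.
    - by move=> p; exact: corr_coef_ge0.
    - move=> p; exact: (@Tint_jmeas (p.1 - l.+1) (p.2 - m) _ _ _ _
        (mseqR_rcons (mseqR_cst _ x) (@measurable_id _ R setT)) (mseqC_cst _ z)).
    - by move=> p t; exact: Tint_ge0.
    by congr intR; apply/funext => t; rewrite corr_sumE size_rcons.
  apply: eq_bigr => p _; rewrite -TintR.
  have [lp|pl] := ltnP l p.1; first by rewrite -subSn.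
  by rewrite /corr_coef [(l < _)%N]leqNgt ltnS pl andbF /= !mul0e.
have -> : intC (fun c => corr_sum M x (rcons z c))
  = (\sum_(p : 'I_(2 * M).+1 * 'I_M.+1)
      (corr_coef l m.+1 p.1 p.2)%:E * Tint x z (p.1 - l) (p.2 - m))%E.
  transitivity (\sum_(p : 'I_(2 * M).+1 * 'I_M.+1) (corr_coef l m.+1 p.1 p.2)%:E
    * intC (fun c => Tint x (rcons z c) (p.1 - l) (p.2 - m.+1)))%E.
    rewrite -intC_sum//; last 3 first.
    - by move=> p; exact: corr_coef_ge0.
    - have zm : mseqC (fun q : R * R => rcons z (q.1 +i* q.2)).
        by apply: mseqC_rcons (mseqC_cst _ z) _; split;
          [exact: measurable_fst|exact: measurable_snd].
      move=> p; exact: (@Tint_jmeas (p.1 - l) (p.2 - m.+1) _ _ _ _ (mseqR_cst _ x) zm).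
    - by move=> p t; exact: Tint_ge0.
    by congr intC; apply/funext => t; rewrite corr_sumE size_rcons.
  apply: eq_bigr => p _; rewrite -TintC.
  have [lp|pl] := ltnP m p.2; first by rewrite -subSn.
  by rewrite /corr_coef [(m < _)%N]leqNgt ltnS pl andbF /= !mul0e.
rewrite corr_sumE ge0_sume_distrr => [|p _]; last first.
  by rewrite mule_ge0 ?Tint_ge0// lee_fin corr_coef_ge0.
rewrite -big_split; apply: eq_bigr => p _ /=.
rewrite -ge0_muleDl ?lee_fin ?corr_coef_ge0// muleA -EFinD -EFinM.
by rewrite corr_coef_step.
Qed.

Lemma corr_sum_gt x z : (2 * M < size x + 2 * size z)%N -> corr_sum M x z = 0%E.
Proof.
move=> lt; rewrite corr_sumE big1// => p _; rewrite /corr_coef.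
case: ifP => [|_]; last by rewrite mul0e.
case/andP => /andP[/eqP e lp] mp; suff : (size x + 2 * size z <= 2 * M)%N.
  by rewrite leqNgt lt.
by rewrite -[leqRHS]e leq_add ?leq_mul.
Qed.

Lemma corr_sum_top x z : (size x + 2 * size z = 2 * M)%N ->
  corr_sum M x z = (Omega x z)%:E.
Proof.
move=> e; rewrite corr_sumE.
have xM : (size x < (2 * M).+1)%N by rewrite ltnS -e leq_addr.
have zM : (size z < M.+1)%N by rewrite ltnS -(leq_pmul2l (ltn0Sn 1)) -e leq_addl.
rewrite (bigD1 (Ordinal xM, Ordinal zM))//= big1 ?adde0.
  rewrite /corr_coef e eqxx !leqnn !subnn /= invr1 mul1e.
  by rewrite /Tint /= !cats0.
move=> [L K] /= ne; rewrite /corr_coef; case: ifP => [|_]; last by rewrite mul0e.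
case/andP => /andP[/eqP e1 lp] mp; case/negP: ne; have {}e1 := etrans e1 (esym e).
have eK : (K : nat) = size z.
  apply/eqP; rewrite eqn_leq mp andbT -(leq_pmul2l (ltn0Sn 1)).
  by rewrite -(leq_add2l (size x)) -e1 leq_add2r.
apply/eqP; congr pair; apply: val_inj => //=.
by move: e1; rewrite eK => /addIn.
Qed.

End Recursion.

End Tonelli.

(** * Correlation functions as Pfaffians of tokens *)

Section CorrelationPfaffian.
Variables (R : realType) (M : nat).
Local Notation C := R[i].
Local Notation N := (2 * M)%N.
Local Notation mu := (@lebesgue_measure R).
Implicit Types (x : seq R) (z : seq C).

Definition v_real (t : R) : 'rV[C]_N := \row_(k < N) (vR k t)%:C.

Local Notation f := (gform v_real).
Local Notation toks := (tokens M).

Lemma weightC_upper (b : C) : weightC (upper b) = weightC b.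
Proof.
rewrite /weightC /upper; case: ifP => // _; rewrite conjcK [conjc b ^+ 2 + _]addrC.
by case: b => a b /=; rewrite normrN.
Qed.

(** Conjugating a point swaps two adjacent nodes of the Vandermonde product, which only changes its
    sign. *)
Lemma Omega_upper x z : Omega x (map (@upper R) z) = Omega x z.
Proof.
rewrite /Omega size_map big_map; congr (_ * _ * complex.Re _).
  by apply: eq_bigr => b _; exact: weightC_upper.
rewrite /vdm_det !det_Vandermonde_seq /eigenvalues.
elim: z [seq t%:C | t <- x] => //= b z IH r.
rewrite /upper; case: ifP => _.
  by rewrite -cat_rcons -[in RHS]cat_rcons -!(cat_rcons (conjc b)) IH.
rewrite conjcK vdm_swap normrN.
by rewrite -cat_rcons -[in RHS]cat_rcons -!(cat_rcons (conjc b)) IH.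
Qed.

Lemma intR_realI (g : R -> R) (r : R) : realI g r -> intR (fun t => (g t)%:E) = r%:E.
Proof. by move=> [ig <-]; rewrite /intR /Rintegral fineK// integrable_fin_num. Qed.

Lemma intC_planeI (g : C -> R) (r : R) : planeI g r -> intC (fun t => (g t)%:E) = r%:E.
Proof.
move=> [G [hG Gr]]; rewrite /intC -(intR_realI Gr); apply: eq_integral => u _.
exact: intR_realI (hG u).
Qed.

Lemma tokens_weight_tokens x z :
  tokens_weight (toks x z) = (size x + 2 * size z)%N%:R.
Proof.
rewrite /tokens_weight /tokens big_cat natrD; congr (_ + _).
  elim: x => [|t x IH] /=; first by rewrite big_nil.
  by rewrite !big_cons IH add0r -[(_).+1]add1n natrD.
elim: z => [|t z IH] /=; first by rewrite big_nil.
by rewrite !big_cons IH mulnS natrD addrA.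
Qed.

Lemma pfl_rcons_real x z t :
  pfl f (toks (rcons x t) z) = pfl f (inl (u_real M t) :: inr t :: toks x z).
Proof.
rewrite /tokens map_rcons flatten_rcons -catA /=.
have := @pfl_move _ _ f (@gformN _ _ _) [::]
  (flatten [seq [:: inl (u_real M y); inr y] | y : R <- x]) [:: inl (u_real M t); inr t].
by move=> /= ->; rewrite muln2 -mul2n exprM expr2 mulrNN mulr1 expr1n mul1r.
Qed.

Lemma pfl_rcons_cplx x z c : pfl f (toks x (rcons z c))
  = pfl f (inl (u_cplx M c) :: inl (v_cplx M c) :: toks x z).
Proof.
rewrite /tokens map_rcons flatten_rcons catA /=.
have := @pfl_move _ _ f (@gformN _ _ _) [::] (toks x z)
  [:: inl (u_cplx M c); inl (v_cplx M c)] [::].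
rewrite !cats0 /= => ->; rewrite muln2 -mul2n exprM expr2 mulrNN mulr1 expr1n mul1r.
by [].
Qed.

Definition pf_const : C := 2 ^+ M / pfl (fun i j => tri R M i j) (enum 'I_N).

Let pf_const_neq0 : pf_const != 0.
Proof. by rewrite mulf_neq0 ?invr_neq0 ?tri_pfl_neq0// expf_neq0 ?pnatr_eq0. Qed.

(** Finiteness and realness are part of the induction claim: the next integrand must be available as
    a real function, while the Pfaffian is complex and [corr_sum] extended-real. *)
Lemma corr_sum_pfl x z : exists2 r : R, corr_sum M x z = r%:E
  & r%:C = pf_const * pfl f (toks x (map (@upper R) z)).
Proof.
have [n] := ubnP (N.+1 - (size x + 2 * size z)).
elim: n x z => // n IH x z lt.
have [gt|le] := ltnP N (size x + 2 * size z).
  exists 0; first exact: corr_sum_gt.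
  by rewrite pfl_tokens_rank ?mulr0// size_map.
move: le; rewrite leq_eqVlt => /predU1P[e|ltN].
  exists (Omega x z); first exact: corr_sum_top.
  apply/esym/(mulIf (tri_pfl_neq0 R M)); rewrite /pf_const mulrAC mulfVK ?tri_pfl_neq0//.
  rewrite pfl_tokens_top ?size_map// 1?mulrC ?Omega_upper//.
  by rewrite all_map; apply/allP => b _ /=; rewrite upperE /=.
move: lt; rewrite subSn ?(ltnW ltN)// ltnS => lt.
have IHR t : {r : R | corr_sum M (rcons x t) z = r%:E
    & r%:C = pf_const * pfl f (inl (u_real M t) :: inr t :: toks x (map (@upper R) z))}.
  apply/cid2; have := IH (rcons x t) z; rewrite size_rcons pfl_rcons_real; apply.
  by rewrite addSn subSS.
have IHC c : {r : R | corr_sum M x (rcons z c) = r%:E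
    & r%:C = pf_const * pfl f (inl (u_cplx M (upper c)) :: inl (v_cplx M (upper c))
                               :: toks x (map (@upper R) z))}.
  apply/cid2; have := IH x (rcons z c).
  rewrite size_rcons map_rcons pfl_rcons_cplx; apply.
  by rewrite mulnS addnCA add2n subSS (leq_ltn_trans _ lt)// leq_sub2l.
pose g1 t := s2val (IHR t); pose g2 c := s2val (IHC c).
have uE (t : R) (k : 'I_N) : u_real M t 0 k = (uR k t)%:C.
  by rewrite mxE weightR_ew /uR mulrC real_complexM rmorphXn.
have [c1 [c2 [h1 h2 e12]]] := @integrate_out R M _ _ (@realI_linear R) (@planeI_linear R)
  (@uR R) (@vR R) (@pairC R) (@HR R) (@HC R) uE (@u_v_pairC R M)
  (fun p q => @realI_uv R p q) (fun p t => @realI_jump R p t)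
  (fun p q => @planeI_pairC R p q) (@Gram R M) (toks x (map (@upper R) z)).
have {h1} := cIZ (@realI_linear R) pf_const h1.
have {h2} := cIZ (@planeI_linear R) pf_const h2.
move=> /(cI_ext (@planeI_linear R) (fun c => esym (s2valP' (IHC c))))[hc ic].
move=> /(cI_ext (@realI_linear R) (fun t => esym (s2valP' (IHR t))))[hr ir].
(* The integrands have been replaced by real numbers, so their imaginary parts integrate to 0; hence
   [pf_const * c1] and [pf_const * c2] are real. *)
have ic0 := planeI_uniq ic (linear_integral0 (@planeI_linear R)).
have ir0 := realI_uniq ir (linear_integral0 (@realI_linear R)).
set d := (N - (size x + 2 * size z))%N.
have d0 : d%:R != 0 :> R by rewrite pnatr_eq0 -lt0n subn_gt0.
exists ((complex.Re (pf_const * c1) + complex.Re (pf_const * c2)) / d%:R).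
  have := corr_sum_step M x z; rewrite -/d.
  have -> : intR (fun t => corr_sum M (rcons x t) z) = (complex.Re (pf_const * c1))%:E.
    rewrite -(intR_realI hr); congr intR; apply/funext => t; exact: s2valP (IHR t).
  have -> : intC (fun c => corr_sum M x (rcons z c)) = (complex.Re (pf_const * c2))%:E.
    rewrite -(intC_planeI hc); congr intC; apply/funext => t; exact: s2valP (IHC t).
  move=> /(congr1 (fun e => (d%:R^-1)%:E * e)%E).
  by rewrite -EFinD muleA -!EFinM mulVf// mul1e mulrC => <-.
have rE (c : C) : complex.Im c = 0 -> (complex.Re c)%:C = c by case: c => a b /= ->.
rewrite rmorphM fmorphV rmorphD /= !rE// -mulrDr e12 tokens_weight_tokens size_map.
rewrite -natrB ?(ltnW ltN)// -/d rmorph_nat mulrCA mulrAC divff ?mul1r//.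
by rewrite -(rmorph_nat (real_complex R)) fmorph_eq0.
Qed.

Lemma corr_pfl x z : (corr M x z)%:C = pfl f (toks x (map (@upper R) z)).
Proof.
have [r e re] := corr_sum_pfl x z; have [r0 e0 re0] := corr_sum_pfl [::] [::].
rewrite /corr /partition_function e e0 /= rmorphM fmorphV /= re re0 /=.
rewrite [pfl _ (toks [::] [::])](_ : _ = 1); last by rewrite /tokens /= /pfl.
by rewrite mulr1 mulrAC divff ?mul1r// pf_const_neq0.
Qed.

End CorrelationPfaffian.

(** * Closed form of the kernel *)

Section Substitution.
Variable R : realType.
Local Notation mu := (@lebesgue_measure R).
Implicit Types (F h : R -> R) (X t s : R) (n : nat).

(** The integrand may be singular at 0, as 1 / sqrt t is; the fundamental theorem is used on
    [X / (n + 2), X] and followed by monotone convergence. *)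
Lemma FTC_open_left F h X : 0 < X -> continuous F ->
  (forall t, 0 < t -> is_derive t 1 F (h t)) ->
  (forall t, 0 < t -> {for t, continuous h}) -> (forall t, 0 < t -> 0 <= h t) ->
  \int[mu]_(t in `[0, X]) h t = F X - F 0.
Proof.
move=> X0 cF dF ch h0; pose e n : R := X / n.+2%:R.
have e0 n : 0 < e n by rewrite divr_gt0.
have eX n : e n < X by rewrite ltr_pdivrMr// ltr_pMr// ltr1n.
have e_le n m : (n <= m)%N -> e m <= e n.
  by move=> nm; rewrite ler_pM2l// lef_pV2 ?posrE// ler_nat !ltnS.
have e_cvg : e n @[n --> \oo] --> 0.
  rewrite -(mulr0 X); apply: cvgM; first exact: cvg_cst.
  by have := @cvg_harmonic R; rewrite -(cvg_shiftS (@harmonic R)).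
have ch_in n : {within `[e n, X], continuous h}.
  apply: continuous_in_subspaceT => t; rewrite inE /= in_itv /= => /andP[et _].
  by apply: ch; exact: lt_le_trans et.
have mh n : measurable_fun `[e n, X] h.
  exact: subspace_continuous_measurable_fun.
have U : \bigcup_n `[e n, X]%classic = `]0, X]%classic.
  apply/seteqP; split=> [t [n _]|t] /=; rewrite !in_itv /=.
    by move=> /andP[et ->]; rewrite (lt_le_trans (e0 n) et).
  move=> /andP[t0 tX].
  have : \forall n \near \oo, e n < t by apply: cvgr_lt e_cvg _ t0.
  case=> n _ /(_ n (leqnn _)) /= et; exists n => //=.
  by rewrite in_itv /= (ltW et).
have I n : (\int[mu]_(t in `[e n, X]) (h t)%:E = (F X - F (e n))%:E)%E.
  rewrite (@continuous_FTC2 _ h F)//.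
  - split.
    + move=> t; rewrite in_itv /= => /andP[et _].
      by have [] := dF t (lt_trans (e0 n) et).
    + by apply: cvg_at_right_filter; exact: cF.
    + by apply: cvg_at_left_filter; exact: cF.
  - move=> t; rewrite in_itv /= => /andP[et _].
    rewrite derive1E; have ? := dF t (lt_trans (e0 n) et); exact: derive_val.
have lim1 : (\int[mu]_(t in `[e n, X]) (h t)%:E)%E @[n --> \oo]
    --> (\int[mu]_(t in `]0%R, X]) (h t)%:E)%E.
  rewrite -U; apply: ge0_nondecreasing_set_cvg_integral => [n m nm|n|n|n t] //=.
  - apply/subsetPset => t /=; rewrite !in_itv /= => /andP[et ->].
    by rewrite (le_trans (e_le _ _ nm) et).
  - by apply/measurable_EFinP; exact: mh.
  - by rewrite in_itv /= lee_fin => /andP[et _]; exact: h0 (lt_le_trans (e0 n) et).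
have lim2 : (\int[mu]_(t in `[e n, X]) (h t)%:E)%E @[n --> \oo] --> (F X - F 0)%:E.
  under eq_fun do rewrite I.
  apply: cvg_EFin; first by near=> n.
  apply: cvgB; first exact: cvg_cst.
  exact: (cvg_comp e F e_cvg (cF 0)).
have m0X : measurable_fun `]0, X] (EFin \o h).
  by apply/measurable_EFinP; rewrite -U; apply/measurable_fun_bigcup.
rewrite /Rintegral -integral_itv_obnd_cbnd//.
by rewrite (cvg_unique _ lim1 lim2).
Unshelve. all: by end_near. Qed.

(** The substitution s = sqrt (2 t), with ds = dt / sqrt (2 t). *)
Lemma integral_sqrt_subst F h X : (forall s, is_derive s 1 F (h s)) ->
  continuous h -> (forall s, 0 <= s -> 0 <= h s) -> 0 <= X ->
  \int[mu]_(t in `[0, X]) (h (Num.sqrt (2 * t)) / Num.sqrt (2 * t))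
  = F (Num.sqrt (2 * X)) - F 0.
Proof.
move=> dF ch h0; rewrite le_eqVlt => /predU1P[<-|X0].
  by rewrite mulr0 sqrtr0 subrr set_itv1 Rintegral_set1.
have c2 : continuous (fun t : R => Num.sqrt (2 * t)).
  move=> t; apply: continuous_comp; last exact: sqrt_continuous.
  by apply: continuousM; [exact: cvg_cst|exact: cvg_id].
have := @FTC_open_left (fun t => F (Num.sqrt (2 * t)))
  (fun t => h (Num.sqrt (2 * t)) / Num.sqrt (2 * t)) X X0.
rewrite mulr0 sqrtr0; apply.
- move=> t; apply: continuous_comp; first exact: c2.
  exact: is_derive_continuous (dF _).
- move=> t t0; have t20 : 0 < 2 * t by rewrite mulr_gt0.
  have d1 : is_derive t 1 (fun t : R => 2 * t) 2.
    by apply: is_derive_eq (is_deriveZ (2 : R) (is_derive_id t 1)) _; rewrite /GRing.scale /= mulr1.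
  have d2 := is_derive1_comp (is_derive1_sqrt t20) d1.
  apply: is_derive_eq (is_derive1_comp (dF _) d2) _ => /=.
  have s0 : Num.sqrt (2 * t) != 0 by rewrite gt_eqF// sqrtr_gt0.
  by field.
- move=> t t0; have t20 : 0 < 2 * t by rewrite mulr_gt0.
  apply: continuousM; first by apply: continuous_comp; [exact: c2|exact: ch].
  by apply: continuousV; [rewrite gt_eqF// sqrtr_gt0|exact: c2].
- by move=> t t0; rewrite divr_ge0 ?sqrtr_ge0// h0 ?sqrtr_ge0.
Qed.

Lemma vR_even0 n : vR (2 * n) 0 = 0 :> R.
Proof.
elim: n => [|n IH].
  by rewrite muln0 /= tail0 ?invr_gt0// subrr.
by rewrite mulnS /= IH mulr0 expr0n /= mul0r addr0.
Qed.

Lemma vR_evenN n s : vR (2 * n) (- s) = - vR (2 * n) s.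
Proof.
elim: n => [|n IH].
  by rewrite muln0 /= tailN ?invr_gt0//; field.
rewrite mulnS /= IH ewN exprS exprM sqrrN -exprM -/(GRing.exp _ _).
by rewrite exprS; ring.
Qed.

Lemma sgr_vR_even n s : Num.sg s * vR (2 * n) `|s| = vR (2 * n) s.
Proof.
case: (sgrP s) => [->|s0|s0]; first by rewrite mul0r vR_even0.
  by rewrite mul1r.
by rewrite vR_evenN mulrNN mul1r.
Qed.

Let sqrt_half s : Num.sqrt (2 * (s ^+ 2 / 2)) = `|s|.
Proof. by rewrite mulrC divfK// sqrtr_sqr. Qed.

Let ew_half t : 0 <= t -> ew 2^-1 (Num.sqrt (2 * t)) = expR (- t).
Proof.
by move=> t0; rewrite /ew sqr_sqrtr ?mulr_ge0// mulrA mulVf ?mul1r.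
Qed.

(** Under t = s^2 / 2 the gamma integrand becomes a multiple of [uR (2 * n)], whose primitive
    vanishing at 0 is [- vR (2 * n)]. The sign factor extends the identity to negative [s], since
    this primitive is odd. *)
Lemma lower_gamma_vR n s :
  2 `^ (n%:R - 2^-1) * Num.sg s * lower_gamma (n%:R + 2^-1) (s ^+ 2 / 2)
  = - vR (2 * n) s.
Proof.
have X0 : 0 <= s ^+ 2 / 2 by rewrite divr_ge0 ?sqr_ge0.
have n2 : n%:R - 2^-1 != 0 :> R.
  rewrite subr_eq0; apply/eqP => e; have : (n * 2)%N%:R = 1 :> R.
    by rewrite natrM e mulVf.
  by move=> /eqP; rewrite pnatr_eq1 muln_eq1 andbF.
set c : R := 2 `^ (n%:R - 2^-1).
have c0 : c != 0 by rewrite gt_eqF// powR_gt0.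
suff -> : lower_gamma (n%:R + 2^-1) (s ^+ 2 / 2) = - (c^-1 * vR (2 * n) `|s|).
  rewrite mulrN mulrACA mulfV// mul1r sgr_vR_even//.
have := @integral_sqrt_subst (fun t => - (c^-1 * vR (2 * n) t))
  (fun t => c^-1 * uR (2 * n) t) _ _ _ _ X0.
rewrite sqrt_half vR_even0 mulr0 oppr0 subr0 => E; apply: etrans; last apply: E.
- apply: eq_Rintegral => t; rewrite inE /= in_itv /= => /andP[t0 _].
  have -> : n%:R + 2^-1 - 1 = n%:R - 2^-1 :> R by field.
  rewrite /uR ew_half//; move: t0; rewrite le_eqVlt => /predU1P[<-|t0].
    (* At [t = 0] both integrands take the default value 0: the inverse of 0 is 0, and [powR] at 0
       is 0 because the exponent is nonzero. *)
    by rewrite mulr0 sqrtr0 invr0 mulr0 powR0// mul0r.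
  have t20 : 0 <= 2 * t by rewrite mulr_ge0// ltW.
  rewrite exprM sqr_sqrtr// -powR_mulrn// -powR12_sqrt//.
  have -> : t `^ (n%:R - 2^-1) = c^-1 * ((2 * t) `^ n%:R / (2 * t) `^ 2^-1).
    rewrite -powRB; last by rewrite (gt_eqF (mulr_gt0 _ t0))// implybT.
    by rewrite powRM ?ltW// -/c mulKf.
  by ring.
- move=> t; have := is_deriveN (is_deriveZ (c^-1 : R) (is_derive_vR (2 * n) t)).
  by rewrite /GRing.scale /= mulrN opprK.
- by move=> t; apply: cvgM; [exact: cvg_cst|exact: continuous_uR].
- by move=> t t0; rewrite !mulr_ge0 ?exprn_ge0 ?ew_ge0// invr_ge0 powR_ge0.
Qed.

(** The same substitution, applied to each term of [cM]. *)
Lemma IS_halfE M (x y : R) : IS_half M x y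
  = - ((Num.sqrt (2 * pi))^-1 * ew 2^-1 x *
       \sum_(k < M) x ^+ (2 * k) / (2 * k)`!%:R * vR (2 * k) y).
Proof.
have X0 : 0 <= y ^+ 2 / 2 by rewrite divr_ge0 ?sqr_ge0.
pose c (k : 'I_M) : R := Num.sqrt 2 * (x ^+ (2 * k) / (2 * k)`!%:R).
have c0 k : 0 <= c k by rewrite mulr_ge0 ?sqrtr_ge0// divr_ge0// exprM exprn_ge0 ?sqr_ge0.
have dF t : is_derive t 1 (fun t => - \sum_(k < M) c k * vR (2 * k) t)
    (\sum_(k < M) c k * uR (2 * k) t).
  have h := is_deriveN (is_derive_sum (fun k : 'I_M =>
    is_deriveZ (c k : R) (is_derive_vR (2 * k) t))).
  rewrite (_ : (fun _ => _) = - \sum_(k < M) (c k \*: vR (2 * k))).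
    apply: is_derive_eq h _; rewrite -sumrN; apply: eq_bigr => k _.
    by rewrite scalerN opprK.
  by apply/funext => u; rewrite /GRing.opp /= fct_sumE.
have z : \sum_(k < M) c k * vR (2 * k) 0 = 0.
  by rewrite big1// => k _; rewrite vR_even0 mulr0.
have := @integral_sqrt_subst _ _ _ dF _ _ X0.
rewrite /= sqrt_half z oppr0 subr0 => E.
have s2 : Num.sqrt 2 != 0 :> R by rewrite gt_eqF// sqrtr_gt0.
have sp : Num.sqrt pi != 0 :> R by rewrite gt_eqF// sqrtr_gt0 pi_gt0.
rewrite /IS_half [\int[mu]_(t in _) _](_ : _ = - \sum_(k < M) c k * vR (2 * k) `|y|).
  rewrite mulrN -mulrA mulr_sumr; congr (- _).
  have -> : expR (- x ^+ 2 / 2) = ew 2^-1 x by rewrite /ew mulNr mulrC.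
  rewrite !mulr_sumr; apply: eq_bigr => k _.
  rewrite -[vR (2 * k) y]sgr_vR_even /c sqrtrM//; field: (sqr_sqrtr (ler0n R 2)).
  by rewrite s2 sp pnatr_eq0 -lt0n fact_gt0.
apply: etrans; last apply: E.
- apply: eq_Rintegral => t; rewrite inE /= in_itv /= => /andP[t0 _].
  rewrite /cM; set r := Num.sqrt (2 * t).
  have -> : expR (- t) / Num.sqrt t = Num.sqrt 2 * (expR (- t) / r).
    by rewrite /r sqrtrM// invfM mulrCA; congr (_ * _); rewrite mulVKf.
  rewrite mulr_sumr mulr_suml; apply: eq_bigr => k _.
  by rewrite /uR ew_half// exprMn /c; ring.
- elim: (index_enum _) => [|k r IH].
    by rewrite (_ : (fun _ => _) = fun=> 0); [exact: cst_continuous|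
      apply/funext => t; rewrite big_nil].
  rewrite (_ : (fun _ => _) = fun t => c k * uR (2 * k) t
      + \sum_(j <- r) c j * uR (2 * j) t); last by apply/funext => t; rewrite big_cons.
  move=> t; apply: cvgD (IH t).
  by apply: cvgM; [exact: cvg_cst|exact: continuous_uR].
- move=> t t0; apply: sumr_ge0 => k _.
  by rewrite mulr_ge0 ?c0// mulr_ge0 ?exprn_ge0 ?ew_ge0.
Qed.

End Substitution.

Lemma enum_pf_index n : enum 'I_(2 * n)
  = flatten [seq [:: pf_index i false; pf_index i true] | i <- enum 'I_n].
Proof.
apply: (inj_map val_inj); rewrite val_enum_ord map_flatten -map_comp.
rewrite (_ : _ \o _ = (fun i => [:: (2 * i)%N; (2 * i).+1]) \o val); last first.
  by apply/funext => i /=; rewrite addn0 addn1.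
rewrite map_comp val_enum_ord.
elim: n => // n IH; rewrite -(addn1 n) mulnDr (iotaD 0 (2 * n)) (iotaD 0 n) IH map_cat flatten_cat.
by rewrite add0n.
Qed.

Lemma enum_lshift_rshift l m : enum 'I_(l + m)
  = map (@lshift l m) (enum 'I_l) ++ map (@rshift l m) (enum 'I_m).
Proof.
apply: (inj_map val_inj); rewrite map_cat.
rewrite -[map val (map (@lshift l m) _)]map_comp -[map val (map (@rshift l m) _)]map_comp.
have -> : val \o @lshift l m = val by [].
have -> : val \o @rshift l m = addn l \o val by [].
by rewrite [in RHS]map_comp !val_enum_ord iotaD -iotaDl addn0.
Qed.

(** * The kernel entries as values of the token form *)

Section KernelEntries.
Variables (R : realType) (M : nat).
Hypothesis M0 : (0 < M)%N.
Local Notation C := R[i].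
Local Notation N := (2 * M)%N.
Local Notation D := (tri R M).
Implicit Types (al be : nat -> C) (g c z : C) (x : R).

Let kappa : C := (Num.sqrt (2 * pi))^-1%:C.

Let NE : N = N.-1.+1. Proof. by rewrite prednK// muln_gt0. Qed.

Lemma sum_succ n (F : nat -> nat -> C) :
  \sum_(p < n.+1) \sum_(j < n.+1) (j == p.+1 :> nat)%:R * F p j
  = \sum_(k < n) F k k.+1.
Proof.
rewrite big_ord_recr /= [X in _ + X]big1 ?addr0; last first.
  by move=> j _; rewrite ltn_eqF// mul0r.
apply: eq_bigr => p _; rewrite big_ord_recl mul0r add0r (bigD1 p)//= eqxx mul1r.
rewrite big1 ?addr0// => j /negPf jp; rewrite /bump /= add1n eqSS.
by rewrite (_ : (j == p :> nat) = false) ?mul0r.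
Qed.

Lemma dform_rows al be : dform D (\row_(k < N) al k) (\row_(k < N) be k)
  = kappa * \sum_(k < N.-1) (al k * be k.+1 - al k.+1 * be k) / k`!%:R.
Proof.
rewrite dformE.
transitivity (\sum_(p < N) \sum_(j < N) (j == p.+1 :> nat)%:R * (kappa * (al p * be j / p`!%:R))
  - \sum_(j < N) \sum_(p < N) (p == j.+1 :> nat)%:R * (kappa * (al p * be j / j`!%:R))).
  rewrite [X in _ - X]exchange_big -sumrB; apply: eq_bigr => p _.
  by rewrite -sumrB; apply: eq_bigr => j _; rewrite !mxE -/kappa; ring.
have := sum_succ N.-1 (fun p j => kappa * (al p * be j / p`!%:R)); rewrite -NE => ->.
have := sum_succ N.-1 (fun j p => kappa * (al p * be j / j`!%:R)); rewrite -NE => ->.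
by rewrite -sumrB mulr_sumr; apply: eq_bigr => k _; ring.
Qed.

Let G z : C := cexp (- z ^+ 2 / 2).

(** Expanding the square cancels the mixed factor e^(- z z') and splits the Gaussian into one factor
    per point. *)
Lemma gauss_expe z z' :
  gauss (z - z') * Defs.expe M (z * z') = G z * G z' * kappa * eM M (z * z').
Proof.
have e : cexp (- (z - z') ^+ 2 / 2) * cexp (- (z * z')) = G z * G z'.
  by rewrite /G -!cexpD; congr cexp; field.
by rewrite -e /gauss /Defs.expe /kappa fmorphV; ring.
Qed.

(** For powers each summand is already (g' - g) (g g')^k / k!, so the truncated exponential appears
    term by term. *)
Lemma dform_pvec c g c' g' :
  dform D (pvec M c g) (pvec M c' g') = c * c' * (g' - g) * kappa * eM M (g * g').
Proof.
rewrite (dform_rows (fun k => c * g ^+ k) (fun k => c' * g' ^+ k)) /eM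
  [RHS]mulrAC [RHS]mulrC; congr (_ * _); rewrite mulr_sumr.
by apply: eq_bigr => k _; rewrite !exprS exprMn; ring.
Qed.

Let vR0 x : (vR 1 x)%:C = (weightR x)%:C :> C. Proof. by rewrite weightR_ew. Qed.

Let vRS k x : (vR k.+2 x)%:C
  = k.+1%:R * (vR k x)%:C + x%:C ^+ k.+1 * (weightR x)%:C :> C.
Proof.
by rewrite [vR _ _]/= weightR_ew rmorphD !rmorphM rmorph_nat rmorphXn.
Qed.

Let fact_neq0 n : n`!%:R != 0 :> C.
Proof. by rewrite pnatr_eq0 -lt0n fact_gt0. Qed.

(** The recursion of [vR] makes the sum telescope; the term left at the upper end becomes [rM]. *)
Lemma dform_pvec_real c g x : dform D (pvec M c g) (v_real M x)
  = c * kappa * (eM M (g * x%:C) * (weightR x)%:C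
      - g ^+ N.-1 * (vR N.-2 x)%:C / (N.-2)`!%:R).
Proof.
have key n (V : nat -> C) (X w : C) : V 1%N = w ->
    (forall k, V k.+2 = k.+1%:R * V k + X ^+ k.+1 * w) ->
  \sum_(k < n.+1) (c * g ^+ k * V k.+1 - c * g ^+ k.+1 * V k) / k`!%:R
  = c * ((\sum_(k < n.+1) (g * X) ^+ k / k`!%:R) * w - g ^+ n.+1 * V n / n`!%:R).
  move=> V1 VS; elim: n => [|n IH].
    by rewrite !big_ord1 V1 fact0 !expr0 expr1 !mulr1 !divr1; ring.
  rewrite big_ord_recr IH [in RHS]big_ord_recr /= VS factS natrM exprMn !exprS.
  by field; rewrite fact_neq0 nat1r pnatr_eq0.
rewrite (dform_rows (fun k => c * g ^+ k) (fun k => (vR k x)%:C)) /eM.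
rewrite (_ : N.-1 = N.-2.+1); last by rewrite -(prednK M0) mulnS.
by rewrite (key _ _ x%:C _ (vR0 x) (vRS^~ x)) mulrCA mulrA.
Qed.

(** The sum is built up two terms at a time: the recursion of [vR] links indices of equal parity,
    which leaves only the even powers of [cM]. *)
Lemma dform_real_real x y : dform D (v_real M x) (v_real M y)
  = (IS_half M x y - IS_half M y x)%:C.
Proof.
rewrite (dform_rows (fun k => (vR k x)%:C) (fun k => (vR k y)%:C)).
have key n (V W : nat -> C) (X Y v w : C) : V 1%N = v -> W 1%N = w ->
    (forall k, V k.+2 = k.+1%:R * V k + X ^+ k.+1 * v) ->
    (forall k, W k.+2 = k.+1%:R * W k + Y ^+ k.+1 * w) ->
  \sum_(k < (2 * n.+1).-1) (V k * W k.+1 - V k.+1 * W k) / k`!%:R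
  = w * (\sum_(k < n.+1) Y ^+ (2 * k) / (2 * k)`!%:R * V (2 * k)%N)
  - v * (\sum_(k < n.+1) X ^+ (2 * k) / (2 * k)`!%:R * W (2 * k)%N).
  move=> V1 W1 VS WS; elim: n => [|n IH].
    by rewrite !big_ord1 muln0 !expr0 fact0 !divr1 !mul1r V1 W1; ring.
  have e : (2 * n.+1)%N = (2 * n).+2 by rewrite mulnS.
  rewrite [(2 * n.+2).-1](_ : _ = (2 * n).+3); last by rewrite 2!mulnS.
  rewrite e /= in IH; rewrite 2!big_ord_recr IH /=.
  rewrite ![in RHS](big_ord_recr n.+1) /= e.
  move: (2 * n)%N => j {IH}; rewrite !VS !WS.
  move: (\sum_(i < _) _) (\sum_(i < _) _) => A B.
  rewrite !factS !natrM !exprS; field.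
  by rewrite fact_neq0 nat1r -(natrD _ 2) !pnatr_eq0.
have := key M.-1 _ _ x%:C y%:C _ _ (vR0 x) (vR0 y) (vRS^~ x) (vRS^~ y).
rewrite (prednK M0) => ->.
have e (a b : R) : \sum_(k < M) a%:C ^+ (2 * k) / (2 * k)`!%:R * (vR (2 * k) b)%:C
    = (\sum_(k < M) a ^+ (2 * k) / (2 * k)`!%:R * vR (2 * k) b)%:C :> C.
  rewrite rmorph_sum; apply: eq_bigr => k _.
  by rewrite !rmorphM fmorphV rmorph_nat rmorphXn.
rewrite !e !IS_halfE !weightR_ew /kappa -!real_complexM.
by rewrite -!(rmorphB (real_complex R)) -!real_complexM; congr (_%:C); ring.
Qed.

Let sE z : C := (Num.sqrt (erfcI z))%:C.

Let half_weightE z : half_weight z = G z * sE z. Proof. by []. Qed.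

Let half_weightJ z : conjc (half_weight z) = G (conjc z) * sE z.
Proof.
rewrite half_weightE conjcM conjc_real /G -cexpJ; congr (cexp _ * _).
by case: z => a b; apply/eqP; rewrite eq_complex /=; apply/andP; split; apply/eqP;
  rewrite !expr2 /=; field.
Qed.

Let weightR_G x : (weightR x)%:C = G x%:C.
Proof.
rewrite /weightR /G -cexp_real; congr cexp.
by rewrite rmorphM fmorphV rmorph_nat rmorphN rmorphXn.
Qed.

Let sqrt_erfcIM z z' : (Num.sqrt (erfcI z * erfcI z'))%:C = sE z * sE z'.
Proof. by rewrite sqrtrM ?erfc_ge0// real_complexM. Qed.

Lemma rME z x : rM M z x = - (G z * kappa * (Num.sqrt (erfc (Num.sqrt 2 * `|complex.Im z|)))%:C
  * (z ^+ N.-1 * (vR N.-2 x)%:C / (N.-2)`!%:R)).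
Proof.
(* The index is even, so [lower_gamma_vR] applies with [n = M.-1]. *)
have eN : N.-2 = (2 * M.-1)%N by rewrite -{1}(prednK M0) mulnS.
rewrite /rM subn2 subn1 -/(G z) eN; set r := (Num.sqrt (erfc _))%:C.
have -> : M%:R - 3 / 2 = M.-1%:R - 2^-1 :> R.
  by rewrite -{1}(prednK M0) -natr1; field.
have -> : M%:R - 1 / 2 = M.-1%:R + 2^-1 :> R.
  by rewrite -{1}(prednK M0) -natr1; field.
have e : (2 `^ (M.-1%:R - 2^-1) * Num.sg x)%:C
    * (lower_gamma (M.-1%:R + 2^-1) (x ^+ 2 / 2))%:C = - (vR (2 * M.-1) x)%:C :> C.
  by rewrite -real_complexM lower_gamma_vR rmorphN.
have -> : (2 `^ (M.-1%:R - 2^-1) / (2 * M.-1)`!%:R * Num.sg x)%:C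
    = (2 `^ (M.-1%:R - 2^-1) * Num.sg x)%:C / (2 * M.-1)`!%:R :> C.
  by rewrite mulrAC !rmorphM fmorphV rmorph_nat.
transitivity (G z * kappa * r * z ^+ N.-1 / (2 * M.-1)`!%:R
  * ((2 `^ (M.-1%:R - 2^-1) * Num.sg x)%:C
     * (lower_gamma (M.-1%:R + 2^-1) (x ^+ 2 / 2))%:C)).
  by rewrite /kappa fmorphV; ring.
by rewrite e; ring.
Qed.

Let rM_upper z x : 0 <= complex.Im z -> rM M z x
  = - (G z * kappa * sE z * (z ^+ N.-1 * (vR N.-2 x)%:C / (N.-2)`!%:R)).
Proof. by move=> z0; rewrite rME ger0_norm. Qed.

Let rM_lower z x : 0 <= complex.Im z -> rM M (conjc z) x
  = - (G (conjc z) * kappa * sE z * (conjc z ^+ N.-1 * (vR N.-2 x)%:C / (N.-2)`!%:R)).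
Proof. by move=> z0; rewrite rME; case: z z0 => a b /= b0; rewrite normrN ger0_norm. Qed.

Let rM_real x y : rM M x%:C y
  = - (G x%:C * kappa * (x%:C ^+ N.-1 * (vR N.-2 y)%:C / (N.-2)`!%:R)).
Proof. by rewrite rME /= normr0 mulr0 erfc0 sqrtr1 mulr1. Qed.

Definition point_token (g : Defs.point R) (b : bool) : token C R N :=
  match g, b with
  | inl x, false => inl (u_real M x)
  | inl x, true => inr x
  | inr z, false => inl (u_cplx M z)
  | inr z, true => inl (v_cplx M z)
  end.

Definition upper_point (g : Defs.point R) : Prop :=
  if g is inr z then 0 <= complex.Im z else True.

Local Notation f := (gform (v_real M)).

Let DS_token (g g' : Defs.point R) :
  DS_kernel M g g' = f (point_token g false) (point_token g' false).
Proof.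
case: g g' => [x|z] [x'|z']; rewrite /gform /token_form /= addr0 dform_pvec;
  rewrite ?weightR_G ?half_weightE.
- rewrite rmorphB mulrAC real_complexM gauss_expe; ring.
- rewrite /DS_kernel_RC -/(sE z'); ring: (gauss_expe x%:C z').
- rewrite /DS_kernel_RC -/(sE z) [z * x'%:C]mulrC; ring: (gauss_expe x'%:C z).
- rewrite sqrt_erfcIM; ring: (gauss_expe z z').
Qed.

Let S_token (g g' : Defs.point R) : upper_point g ->
  S_kernel M g g' = f (point_token g false) (point_token g' true).
Proof.
case: g g' => [x|z] [x'|z'] /= g0; rewrite /gform /token_form /= addr0;
  rewrite ?dform_pvec ?dform_pvec_real ?weightR_G ?half_weightE ?half_weightJ.
- by rewrite rmorphB real_complexM gauss_expe rM_real; ring.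
- rewrite -/(sE z'); ring: (gauss_expe x%:C (conjc z')).
- rewrite rM_upper// -/(sE z) [z * x'%:C]mulrC; ring: (gauss_expe x'%:C z).
- rewrite sqrt_erfcIM; ring: (gauss_expe z (conjc z')).
Qed.

Let half_sgn_token (g g' : Defs.point R) : half_sgn g g'
  = token_jump (jump 2^-1) (point_token g true) (point_token g' true).
Proof.
case: g g' => [x|z] [x'|z'] //=.
by rewrite /jump sgrEz rmorphM rmorph_int fmorphV rmorph_nat mulrC.
Qed.

Let IS_token (g g' : Defs.point R) : upper_point g -> upper_point g' ->
  IS_kernel M g g' + half_sgn g g' = f (point_token g true) (point_token g' true).
Proof.
(* [v_cplx] is a vector of powers of conj z, so the boundary term of [dform_pvec_real] is [rM] at
   conj z; the factor ['i] comes with it. *)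
have skew x z : 0 <= complex.Im z -> IS_kernel_RC M x z
    = dform D (v_real M x) (v_cplx M z).
  move=> z0; rewrite (dformN (@triN R M)) dform_pvec_real /IS_kernel_RC rM_lower//.
  rewrite half_weightJ weightR_G -/(sE z) [conjc z * x%:C]mulrC.
  ring: (gauss_expe x%:C (conjc z)).
move=> g0 g'0; rewrite half_sgn_token /gform /token_form; congr (_ + _).
case: g g' g0 g'0 => [x|z] [x'|z'] /= g0 g'0.
- by rewrite dform_real_real.
- exact: skew.
- by rewrite skew// (dformN (@triN R M)) opprK.
- rewrite dform_pvec !half_weightJ sqrt_erfcIM.
  ring: (gauss_expe (conjc z) (conjc z')) (sqr_i R).
Qed.

Lemma kernel_token (g g' : Defs.point R) (b b' : bool) :
  upper_point g -> upper_point g' ->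
  Defs.kernel M g g' (inord b) (inord b') = f (point_token g b) (point_token g' b').
Proof.
move=> g0 g'0; rewrite /Defs.kernel mxE.
have e (c : bool) : (inord c == 0 :> 'I_2) = ~~ c.
  by rewrite -val_eqE /= inordK; case: c.
rewrite !e; case: b b' => [] [] /=.
- exact: IS_token.
- by rewrite S_token// gformN opprK.
- exact: S_token.
- exact: DS_token.
Qed.

Lemma Pf_kernel_mx l m (x : l.-tuple R) (z : m.-tuple C) :
  all (fun z => 0 <= complex.Im z) z ->
  Pf (kernel_mx M x z) = pfl f (tokens M x z).
Proof.
move=> z0; pose p := points x z.
have p0 i : upper_point (p i).
  rewrite /p /points; case: fintype.split => // k /=.
  by move/allP: z0; apply; exact: mem_tnth.
pose tok (i : 'I_(2 * (l + m))) := point_token (p (block_index i)) (odd i).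
have AE i j : kernel_mx M x z i j = f (tok i) (tok j).
  by rewrite mxE kernel_token.
rewrite Pf_pfl; last by move=> i j; rewrite !AE gformN.
transitivity (pfl f (map tok (enum 'I_(2 * (l + m))))).
  by rewrite [RHS]pfl_map; apply: eq_pfl => i j; exact: AE.
congr pfl; rewrite enum_pf_index map_flatten -map_comp.
have -> : map tok \o (fun i => [:: pf_index i false; pf_index i true])
    = fun i => [:: point_token (p i) false; point_token (p i) true].
  apply/funext => i /=; rewrite /tok.
  by move: (pf_indexK i false) (pf_indexK i true) => [-> ->] [-> ->].
rewrite enum_lshift_rshift map_cat flatten_cat /tokens.
rewrite -[map _ (map (@lshift l m) _)]map_comp -[map _ (map (@rshift l m) _)]map_comp.
rewrite -[in RHS](map_tnth_enum x) -[in RHS](map_tnth_enum z).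
rewrite -[map _ (map (tnth x) _)]map_comp -[map _ (map (tnth z) _)]map_comp.
congr (flatten _ ++ flatten _); apply: eq_map => k; rewrite /= /p /points.
  by have -> : fintype.split (lshift m k) = inl k by exact: (unsplitK (inl k)).
by have -> : fintype.split (rshift l k) = inr k by exact: (unsplitK (inr k)).
Qed.

End KernelEntries.

Theorem theorem8 (R : realType) (M l m : nat)
    (hM : (1 <= M)%N) (hlm : ~ (l = 0%N /\ m = 0%N))
    (hle : (l + 2 * m <= 2 * M)%N)
    (x : l.-tuple R) (z : m.-tuple R[i])
    (hz : forall k : 'I_m, complex.Im (tnth z k) != 0) :
  (corr M x z)%:C = Pf (kernel_mx M x [tuple of map (@upper R) z]).
Proof.
rewrite corr_pfl Pf_kernel_mx//.
by apply/allP => _ /mapP[w _ ->]; rewrite upperE /=.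
Qed.
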